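(* Let $\gamma$ be the standard Gaussian measure on $\mathbb{R}^d$, and define $\alpha:\mathbb{R}\to[0,\infty]$ by $\alpha(x)=2d\arcsin^2\!\big(\sqrt x/(2\sqrt d)\big)$ if $0\le x\le4d$ and $\alpha(x)=\infty$ otherwise. For every $\mu\in\mathcal P(\mathbb{R}^d)$ we have $$\alpha(\mathcal W_2^2(\gamma,\mu))\le I(\mu):=\begin{cases}H(\mu\,|\,\gamma)+\frac12\big(d-m_2(\mu)\big)&\text{if }\mu\in\mathcal P_2(\mathbb{R}^d),\ m_2(\mu)\le d,\ m_1(\mu)=0,\\\infty&\text{otherwise.}\end{cases}$$ Moreover, $I$ is the lower semicontinuous envelope (with respect to weak convergence) of the function $J:\mathcal P(\mathbb{R}^d)\to[0,\infty]$ defined by $$J(\mu):=\begin{cases}H(\mu\,|\,\gamma)&\text{if }\mu\in\mathcal S,\\\infty&\text{otherwise,}\end{cases}\qquad\mathcal S:=\Big\{\rho\in\mathcal P_2(\mathbb{R}^d):\int x\,\rho(dx)=0,\ \int|x|^2\,\rho(dx)=d\Big\}.$$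
   Context: $\mathcal P(\mathbb{R}^d)$: Borel probability measures on $\mathbb{R}^d$; $\mathcal P_2(\mathbb{R}^d)$: those with finite second moment. $\mathcal W_2$ is the 2-Wasserstein distance ($\mathcal W_2^2$ is the infimum over couplings of $\int|x-y|^2$, with no factor $1/2$; $\mathcal W_2(\gamma,\mu)=\infty$ if $\mu\notin\mathcal P_2(\mathbb{R}^d)$). $m_1(\mu)=\int x\,\mu(dx)$ and $m_2(\mu)=\int|x|^2\,\mu(dx)$. $H(\mu\,|\,\gamma)=\int\log\frac{d\mu}{d\gamma}\,d\mu$ if $\mu\ll\gamma$ and $+\infty$ otherwise. The lower semicontinuous envelope of $J$ is the pointwise supremum of all weakly lower semicontinuous functions dominated by $J$. *)

(* Defs.v *)
From HB Require Import structures.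
From mathcomp Require Import all_boot all_order all_algebra.
From mathcomp Require Import all_classical all_reals all_analysis.
From mathcomp Require Import measurable_realfun.

Set Implicit Arguments.
Unset Strict Implicit.
Unset Printing Implicit Defensive.

Import Order.TTheory GRing.Theory Num.Theory.
Import numFieldNormedType.Exports.

Local Open Scope classical_set_scope.
Local Open Scope ring_scope.
Local Open Scope charge_scope.

(* R^d is 'rV[R]_d with its library topology and the sigma-algebra generated
   by the open sets. *)
Section borel.
Variables (R : realType) (m n : nat).

Let G : set (set 'M[R]_(m, n)) := open.

HB.instance Definition _ := @isMeasurable.Build (sigma_display G)
  'M[R]_(m, n) <<s G >> (@sigma_algebra0 _ setT G) (@sigma_algebraC _ G)
  (@sigma_algebra_bigcup _ setT G).

End borel.

Section gaussian.
Context {R : realType}.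

Definition cons_pair (n : nat)
    (x : measurableTypeR R * n.-tuple (measurableTypeR R)) :
  n.+1.-tuple (measurableTypeR R) := [tuple of x.1 :: x.2].

Lemma measurable_cons_pair (n : nat) :
  measurable_fun [set: measurableTypeR R * n.-tuple (measurableTypeR R)]
    (@cons_pair n).
Proof. exact: measurable_cons. Qed.

HB.instance Definition _ (n : nat) :=
  @isMeasurableFun.Build _ _ _ _ (@cons_pair n) (@measurable_cons_pair n).

Fixpoint gaussian_tuple (n : nat) :
    probability (n.-tuple (measurableTypeR R)) R :=
  if n is m.+1 then
    distribution (normal_prob 0 1 \x gaussian_tuple m)%E (@cons_pair m)
  else \d_[tuple].

Lemma gaussian_tuple_box (n : nat) (A : 'I_n -> set R) :
  (forall i, measurable (A i)) ->
  gaussian_tuple n [set t | forall i, A i (tnth t i)] =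
  (\prod_(i < n) normal_prob 0 1 (A i))%E.
Proof.
elim: n A => [|n IH] A mA.
  by rewrite big_ord0 /= diracE mem_set//=; case.
pose B := [set t : n.-tuple (measurableTypeR R) |
  forall i, A (lift ord0 i) (tnth t i)].
have mB : measurable B.
  rewrite (_ : B = \bigcap_(i in [set: 'I_n])
    ((@tnth _ (measurableTypeR R) ^~ i) @^-1` A (lift ord0 i))).
    apply: fin_bigcap_measurable => // i _.
    by rewrite -[X in measurable X]setTI; apply: measurable_tnth => //;
      exact: mA.
  by apply/seteqP; split => t h i => [_|]; exact: h.
rewrite big_ord_recl /= /distribution /pushforward.
rewrite (_ : _ @^-1` _ = A ord0 `*` B).
  rewrite product_measure1E//; last exact: mA.
  by congr (_ * _)%E; apply: (IH (fun i => A (lift ord0 i))).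
apply/seteqP; split => -[x t] /=.
  move=> h; split; first by have := h ord0; rewrite tnth0.
  by move=> i; have := h (lift ord0 i); rewrite tnthS.
move=> [h0 h] i; have [j ->|->] := unliftP ord0 i; last by rewrite tnth0.
by rewrite tnthS; exact: h.
Qed.

Definition row_of_tuple (n : nat) (t : n.-tuple (measurableTypeR R)) :
  'rV[R]_n := \row_i tnth t i.

Lemma measurable_row_of_tuple (n : nat) :
  measurable_fun [set: n.-tuple (measurableTypeR R)] (@row_of_tuple n).
Proof.
apply: (measurability (@open ('rV[R]_n))) => //.
move=> _ [U oU <-]; rewrite setTI.
pose box (qr : 'rV[rat]_n * rat) : set 'rV[R]_n :=
  [set x | forall i, `|ratr (qr.1 ord0 i) - x ord0 i| < ratr qr.2].
have -> : @row_of_tuple n @^-1` U =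
    \bigcup_(qr in [set: 'rV[rat]_n * rat])
      (if `[< box qr `<=` U >] then @row_of_tuple n @^-1` box qr else set0).
  apply/seteqP; split => [t Ut|t [qr _]]; last first.
    by case: asboolP => // sub /sub.
  have /nbhs_ballP[e /= e0 eU] : nbhs (row_of_tuple t) U.
    exact: open_nbhs_nbhs.
  have [r] : exists q : rat, ratr q \in `]0%R, (e / 2)[.
    by apply: rat_in_itvoo; rewrite divr_gt0.
  rewrite in_itv/= => /andP[r0 re].
  have /choice[q qP] : forall i : 'I_n, exists q : rat,
      `|ratr q - tnth t i : R| < ratr r.
    move=> i; have [q] : exists q : rat,
        ratr q \in `](tnth t i - ratr r : R)%R, (tnth t i + ratr r)[.
      by apply: rat_in_itvoo; rewrite ltrBlDr -addrA ltrDl addr_gt0.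
    by rewrite in_itv/= => qI; exists q; rewrite ltr_distl.
  exists (\row_i q i, r) => //=.
  rewrite asboolT.
    by move=> i /=; rewrite !mxE.
  move=> x xq; apply: eU; split => // i j; rewrite !mxE (ord1 i).
  rewrite -ball_normE/=.
  have := xq j; rewrite /= mxE => xqj.
  rewrite [e]splitr -(subrKA (ratr (q j)) (tnth t j)).
  rewrite (le_lt_trans (ler_normD _ _))// ltrD//.
    by rewrite distrC (lt_trans (qP j)).
  by rewrite (lt_trans xqj).
apply: countable_bigcupT_measurable => [|qr]; first exact: countableP.
case: ifP => // _.
rewrite (_ : _ @^-1` _ = \bigcap_(i in [set: 'I_n])
    (@tnth _ (measurableTypeR R) ^~ i @^-1`
       ball (ratr (qr.1 ord0 i) : R) (ratr qr.2))); last first.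
  apply/seteqP; split => t /= tb i.
    by move=> _; have := tb i; rewrite mxE -ball_normE.
  by have := tb i Logic.I; rewrite mxE -ball_normE.
apply: fin_bigcap_measurable => // i _.
rewrite -[X in measurable X]setTI; apply: measurable_tnth => //.
exact: measurable_ball.
Qed.

HB.instance Definition _ (n : nat) :=
  @isMeasurableFun.Build _ _ _ _ (@row_of_tuple n)
    (@measurable_row_of_tuple n).

End gaussian.

(* The law of d independent N(0, 1) coordinates. *)
Definition std_gaussian (R : realType) (d : nat) : probability 'rV[R]_d R :=
  distribution (gaussian_tuple d) (@row_of_tuple R d).

(* The library norm on 'rV[R]_d is the sup norm, hence the explicit Euclidean
   square. *)
Definition sqnorm (R : realType) (d : nat) (x : 'rV[R]_d) : R :=
  \sum_(i < d) x ord0 i ^+ 2.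

Section moments.
Context {R : realType} {d : nat}.
Implicit Types mu nu : probability 'rV[R]_d R.

Definition m2 mu : \bar R := (\int[mu]_x (sqnorm x)%:E)%E.

Definition finite_m2 mu : Prop := (m2 mu < +oo)%E.

(* Each coordinate is [fine] of an integral, so this is the mean only when mu
   has a finite first moment, e.g. when finite_m2 mu holds. *)
Definition m1 mu : 'rV[R]_d := \row_i \int[mu]_x (x ord0 i).

Definition coupling mu nu : set (probability ('rV[R]_d * 'rV[R]_d)%type R) :=
  [set pi | (forall A, measurable A -> pi (fst @^-1` A) = mu A) /\
            (forall B, measurable B -> pi (snd @^-1` B) = nu B)].

(* W_2^2, set to +oo as soon as one of the measures is not in P_2. *)
Definition W2sq mu nu : \bar R :=
  if `[< finite_m2 mu /\ finite_m2 nu >] then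
    ereal_inf [set (\int[pi]_p (sqnorm (p.1 - p.2))%:E)%E
              | pi in coupling mu nu]
  else +oo%E.

End moments.

(* The negative part of the integrand is always mu-integrable, so the integral
   is never of the form oo - oo. *)
Definition relative_entropy (disp : measure_display) (T : measurableType disp)
    (R : realType) (mu nu : probability T R) : \bar R :=
  if `[< mu `<< nu >] then
    (\int[mu]_x lne (('d (charge_of_finite_measure mu) '/d nu) x))%E
  else +oo%E.

Section weak_topology.
Variables (R : realType) (d : nat).

Definition bounded_continuous :=
  {f : 'rV[R]_d -> R | continuous f /\ exists M : R, forall x, `|f x| <= M}.

Definition integral_bc (mu : probability 'rV[R]_d R) :
    {ptws bounded_continuous -> R} :=
  fun f => \int[mu]_x (sval f x).

(* Borel probability measures on R^d with the topology of weak convergence,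
   i.e. the coarsest one making mu |-> \int f dmu continuous for every bounded
   continuous f. *)
Definition weak_probability : Type := probability 'rV[R]_d R.

HB.instance Definition _ :=
  Topological.copy weak_probability (initial_topology integral_bc).

Lemma weak_probability_cvg (F : set_system weak_probability)
    (mu : weak_probability) : Filter F ->
  F --> mu <->
  forall f : bounded_continuous,
    \int[nu]_x (sval f x) @[nu --> F] --> (\int[mu]_x (sval f x) : R).
Proof.
move=> FF; split => [Fmu f|H A [B [[C oC <-] Cmu] sub]].
  have c : continuous (fun nu : weak_probability => integral_bc nu f : R).
    move=> nu; apply: (@continuous_comp _ _ _
        (integral_bc : weak_probability -> {ptws _ -> _})
        (fun g : {ptws bounded_continuous -> R} => g f : R)).
      exact: initial_continuous.
    move: {nu} (integral_bc nu) => g B Bg.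
    have /cvg_sup/(_ f) h :
      nbhs g --> (g : {ptws bounded_continuous -> R}) by [].
    exact: (h _ (@initial_continuous _ _
      (fun g : bounded_continuous -> R => g f) g B Bg)).
  exact: (cvg_trans (cvg_app _ Fmu) (c mu)).
apply: (filterS sub).
have : integral_bc @ F --> (integral_bc mu : {ptws _ -> _}).
  apply/cvg_sup => f D [E [[G oG <-] Gm] subD].
  rewrite nbhs_filterE; apply: (filterS subD).
  exact: (H f G (open_nbhs_nbhs (conj oG Gm))).
by apply; exact: open_nbhs_nbhs.
Qed.

End weak_topology.

Definition lsc_envelope (R : realType) (X : topologicalType)
    (J : X -> \bar R) (x : X) : \bar R :=
  ereal_sup [set g x | g in
    [set g : X -> \bar R | lower_semicontinuous g /\ forall y, (g y <= J y)%E]].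

(* The argument is extended since W_2^2 may be +oo, where alpha is +oo. *)
Definition alpha (R : realType) (d : nat) (x : \bar R) : \bar R :=
  if (0 <= x <= (4 * d)%:R%:E)%E then
    (2 * d%:R * asin (Num.sqrt (fine x) / (2 * Num.sqrt d%:R)) ^+ 2)%:E
  else +oo%E.

Section functionals.
Context {R : realType} {d : nat}.

Definition fun_I (mu : weak_probability R d) : \bar R :=
  if `[< [/\ finite_m2 mu, (m2 mu <= d%:R%:E)%E & m1 mu = 0] >] then
    (relative_entropy mu (std_gaussian R d) + 2^-1%:E * (d%:R%:E - m2 mu))%E
  else +oo%E.

Definition set_S : set (probability 'rV[R]_d R) :=
  [set rho | [/\ finite_m2 rho, m1 rho = 0 & m2 rho = d%:R%:E]].

Definition fun_J (mu : weak_probability R d) : \bar R :=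
  if `[< set_S mu >] then relative_entropy mu (std_gaussian R d) else +oo%E.

End functionals.

(* Main.v *)
(**
Transport inequality.  In dimension one, let [T] be the monotone map pushing a
law [p] to the standard normal law, [g] the density of [p] with respect to that
law, [phi] the Gaussian density and [J = exp ((y^2 - (T y)^2) / 2) / g y] (so
[J = 1 / T']).  The tail identity [phi (T z) = \int_(y > z) T y dp] and Fubini
give [2 \int J dp + \int (y - T y)^2 dp <= 1 + \int y^2 dp] without
differentiating [T].  Applied to conditional laws, one coordinate at a time, it
yields a triangular (Knothe) coupling; since [ln J <= J / lam - 1 + ln lam], the
sum of the [ln J] is controlled by the cost, and optimising in [lam], i.e.
[lam = exp (- I / d)], gives [W_2^2 <= 2 d (1 - exp (- I / d))].  The bound with
[asin] follows from [cos s <= exp (- s^2 / 2)] on [0, pi].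

Lower semicontinuity.  Let [gs] be the law N(0, s^2 Id) with [s > 1].  On
centered measures with second moment [m <= d], [I mu] is
[H(mu | gs) + k + d / 2 - m / (2 s^2)] with [k] independent of [mu], and for
large [s] the last term is negligible.  [H(. | gs)] is a supremum of weakly
continuous functionals by the Donsker-Varadhan formula; the constraint on the
mean survives because second moments are bounded.

Relaxation.  Mix [mu], of second moment [m < d], with a mass [e] of N(0, s^2 Id),
[s] being such that the mixture has second moment [d].  The Gaussian has entropy
at most [d s^2 / 2], and [e d s^2 / 2] tends to [(d - m) / 2], so by convexity of
the entropy [J] of the mixture is asymptotically at most [I mu].
*)
Require Import Defs.
From HB Require Import structures.
From mathcomp Require Import all_boot all_order all_algebra.
From mathcomp Require Import all_classical all_reals all_analysis.
From mathcomp Require Import measurable_realfun.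
From mathcomp Require Import ring lra.

Set Implicit Arguments.
Unset Strict Implicit.
Unset Printing Implicit Defensive.

Import Order.TTheory GRing.Theory Num.Theory.
Import numFieldNormedType.Exports.

Local Open Scope classical_set_scope.
Local Open Scope ring_scope.
Local Open Scope charge_scope.

(** * Densities and image measures *)

(** The obstacle to lower semicontinuity is a sign: [m2] is only lower semicontinuous for weak
    convergence, yet it enters [fun_I] with the coefficient -1/2. Taking a wide Gaussian as
    reference law absorbs this term into a relative entropy, up to an error that the constraint
    [m2 <= d] makes uniform. In the transport part, the term [(d - m2) / 2] is the mean of the
    difference of the Gaussian exponents of the two coupled points, so that the entropy together
    with this term is minus the integral of the sum of the [ln J]. A single [lam] serves all
    coordinates: the tangent bound for [ln] is an equality when every [J] equals [lam], and the
    optimal [lam] is then dictated by the value of [I]. An inequality for the integral of [J] is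
    enough, which is why the regularity of [T] is never discussed. Conditional laws are given by
    explicit densities instead of an abstract disintegration: the joint measurability of the
    conditional transport maps then follows from Tonelli's theorem for parameter integrals. *)

Section density.
Context d (T : measurableType d) (R : realType).
Local Open Scope ereal_scope.

(** Densities are real-valued and nonnegative everywhere, so that they can be multiplied, divided
    and truncated pointwise. [p] and [m] are bare set functions, so that the predicate applies to
    product measures as they come. *)
Definition has_density (p m : set T -> \bar R) (f : T -> R) : Prop :=
  [/\ measurable_fun setT f, (forall x, 0 <= f x)%R &
      forall A, measurable A -> p A = \int[m]_(x in A) (f x)%:E].

Section existence.
Variables (m : {measure set T -> \bar R}) (f : T -> R).
Hypotheses (mf : measurable_fun setT f) (f0 : forall x, (0 <= f x)%R).
Hypothesis f1 : \int[m]_x (f x)%:E = 1.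

Let p (A : set T) : \bar R := \int[m]_(x in A) (f x)%:E.

Let p0 : p set0 = 0.
Proof. by rewrite /p integral_set0. Qed.

Let p_ge0 A : 0 <= p A.
Proof. by apply: integral_ge0 => x _; rewrite lee_fin. Qed.

Let p_sigma_additive : semi_sigma_additive p.
Proof.
move=> A mA tA mUA; rewrite /p ge0_integral_bigcup//=; last 2 first.
  exact/measurable_EFinP/measurable_funTS.
  by move=> x _; rewrite lee_fin.
apply: is_cvg_ereal_nneg_natsum_cond => n _ _.
by apply: integral_ge0 => x _; rewrite lee_fin.
Qed.

HB.instance Definition _ := isMeasure.Build _ _ _ p p0 p_ge0 p_sigma_additive.
HB.instance Definition _ := @Measure_isProbability.Build _ _ R p f1.

Lemma ex_density : exists q : probability T R, has_density q m f.
Proof. by exists p; split. Qed.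

End existence.

Lemma has_density_dominates (p m : {measure set T -> \bar R}) f :
  has_density p m f -> p `<< m.
Proof.
move=> [mf f0 pE]; apply/null_content_dominatesP => A mA mA0.
rewrite pE//; apply: null_set_integral => //.
exact/measurable_EFinP/measurable_funTS.
Qed.

Section change_of_variables.
Variables (p : probability T R) (m : {sigma_finite_measure set T -> \bar R}).
Variable f : T -> R.
Hypothesis pf : has_density p m f.

Lemma density_integral1 : \int[m]_x (f x)%:E = 1.
Proof. by have [_ _ <-//] := pf; exact: probability_setT. Qed.

Lemma density_RN : ae_eq m setT (Radon_Nikodym_SigmaFinite.f p m) (EFin \o f).
Proof.
have pm := has_density_dominates pf.
have [mf f0 pE] := pf.
apply: integral_ae_eq => //.
- exact: Radon_Nikodym_SigmaFinite.f_integrable.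
- exact/measurable_EFinP.
- by move=> A _ mA; rewrite -Radon_Nikodym_SigmaFinite.f_integral//; exact: pE.
Qed.

(** The change of variables formula holds for the Radon-Nikodym derivative; [density_RN] carries it
    over to any other version of the density. *)
Lemma ge0_integral_density (h : T -> \bar R) : measurable_fun setT h ->
  (forall x, 0 <= h x) -> \int[p]_x h x = \int[m]_x (h x * (f x)%:E).
Proof.
move=> mh h0; have pm := has_density_dominates pf; have [mf f0 pE] := pf.
rewrite -(Radon_Nikodym_SigmaFinite.change_of_variables pm)//.
have mRN := measurable_int _ (Radon_Nikodym_SigmaFinite.f_integrable pm).
apply: ge0_ae_eq_integral => //.
- exact: emeasurable_funM.
- by apply: emeasurable_funM => //; exact/measurable_EFinP.
- by move=> x _; rewrite mule_ge0// Radon_Nikodym_SigmaFinite.f_ge0.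
- by move=> x _; rewrite mule_ge0// lee_fin.
- exact/ae_eqe_mul2l/density_RN.
Qed.

(** Multiplication by the nonnegative [f] commutes with taking positive and negative parts, so both
    sides are the same difference of extended reals, whether or not [h] is integrable. *)
Lemma integral_density (h : T -> \bar R) : measurable_fun setT h ->
  \int[p]_x h x = \int[m]_x (h x * (f x)%:E).
Proof.
move=> mh; have [mf f0 pE] := pf.
rewrite [LHS]integralE [RHS]integralE; congr (_ - _).
- rewrite ge0_integral_density//; last exact: measurable_funepos.
  apply: eq_integral => x _; rewrite !funeposE.
  by rewrite maxe_pMl ?lee_fin// mul0e.
- rewrite ge0_integral_density//; last exact: measurable_funeneg.
  apply: eq_integral => x _; rewrite !funenegE.
  by rewrite maxe_pMl ?lee_fin// mul0e mulNe.
Qed.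

Lemma integrable_density (h : T -> \bar R) : measurable_fun setT h ->
  p.-integrable setT h <-> m.-integrable setT (fun x => h x * (f x)%:E).
Proof.
move=> mh; have [mf f0 pE] := pf.
have mhf : measurable_fun setT (fun x => h x * (f x)%:E).
  by apply: emeasurable_funM => //; exact/measurable_EFinP.
have E : \int[p]_x `|h x| = \int[m]_x `|h x * (f x)%:E|.
  rewrite ge0_integral_density//; last exact: measurableT_comp.
  by apply: eq_integral => x _; rewrite abseM (@gee0_abs _ (f x)%:E) ?lee_fin.
by split=> /integrableP[_ h']; apply/integrableP; split => //=; [rewrite -E|rewrite E].
Qed.

Lemma density_gt0_ae : {ae p, forall x, (0 < f x)%R}.
Proof.
have [mf f0 pE] := pf.
have mN : measurable [set x | (f x <= 0)%R].
  rewrite -[X in measurable X]setTI.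
  exact: (measurable_fun_ler mf (measurable_cst _)).
exists [set x | (f x <= 0)%R]; split => //.
- rewrite pE//; under eq_integral => x.
    rewrite inE/= => fx; rewrite (_ : f x = 0%R); last first.
      by apply/eqP; rewrite eq_le fx f0.
    over.
  by rewrite integral0.
- by move=> x /= /negP; rewrite -leNgt.
Qed.

End change_of_variables.
End density.

Lemma probability_ae_eq d (T : measurableType d) (R : realType)
    (P : probability T R) (A B : set T) : measurable A -> measurable B ->
  {ae P, forall x, A x <-> B x} -> P A = P B.
Proof.
move=> mA mB AB; rewrite -[A]setIT -[B]setIT -!(integral_indic P)//.
apply: ge0_ae_eq_integral => //.
- exact/measurable_EFinP/measurable_indic.
- exact/measurable_EFinP/measurable_indic.
apply: negligibleS AB => x /=; apply: contra_not => h _; rewrite !indicE.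
by congr (_%:R%:E); congr nat_of_bool; apply/idP/idP; rewrite !inE/= h.
Qed.

Lemma ae_imp d (T : measurableType d) (R : realType)
    (P : {measure set T -> \bar R}) (A B : T -> Prop) :
  (forall x, A x -> B x) -> {ae P, forall x, A x} -> {ae P, forall x, B x}.
Proof.
by move=> AB; apply: negligibleS => x; apply: contra_not; exact: AB.
Qed.

Lemma ae_imp2 d (T : measurableType d) (R : realType)
    (P : {measure set T -> \bar R}) (A B C : T -> Prop) :
  (forall x, A x -> B x -> C x) ->
  {ae P, forall x, A x} -> {ae P, forall x, B x} -> {ae P, forall x, C x}.
Proof.
move=> ABC hA hB; apply: negligibleS (negligibleU hA hB) => x /= Cx.
by apply/not_andP => -[/ABC h /h].
Qed.

(** The inverse is the power with exponent -1; on nonnegative reals the two agree even at 0, where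
    both vanish. *)
Lemma ge0_measurable_funV d (T : measurableType d) (R : realType)
    (f : T -> R) : measurable_fun setT f -> (forall x, 0 <= f x) ->
  measurable_fun setT (fun x => (f x)^-1).
Proof.
move=> mf f0; rewrite (_ : (fun x => _) = (fun x => powR (f x) (-1))).
  exact: measurableT_comp (measurable_powR (-1)) mf.
by apply/funext => x; rewrite powR_inv1.
Qed.

Section product_probability_tonelli.
Context d1 d2 (T1 : measurableType d1) (T2 : measurableType d2) (R : realType).
Variables (P1 : probability T1 R) (P2 : probability T2 R).
Let P12 : probability (T1 * T2)%type R := (P1 \x P2)%E.
Variable h : T1 * T2 -> \bar R.
Hypotheses (mh : measurable_fun setT h) (h0 : forall z, (0 <= h z)%E).

Lemma product_probability_tonelli1 :
  (\int[P12]_z h z = \int[P1]_x \int[P2]_y h (x, y))%E.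
Proof. by rewrite -fubini_tonelli1//; exact: eq_measure_integral. Qed.

Lemma product_probability_tonelli2 :
  (\int[P12]_z h z = \int[P2]_y \int[P1]_x h (x, y))%E.
Proof. by rewrite -fubini_tonelli2//; exact: eq_measure_integral. Qed.

End product_probability_tonelli.

Section image_measure.
Context d1 d2 (T1 : measurableType d1) (T2 : measurableType d2) (R : realType).
Variables (P : probability T1 R) (Q : probability T2 R) (phi : T1 -> T2).
Hypothesis mphi : measurable_fun setT phi.
Hypothesis phiPQ : forall A, measurable A -> P (phi @^-1` A) = Q A.
Variable h : T2 -> \bar R.
Hypothesis mh : measurable_fun setT h.
Local Open Scope ereal_scope.

Lemma ge0_integral_image : (forall x, 0 <= h x) ->
  \int[P]_x h (phi x) = \int[Q]_y h y.
Proof.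
move=> h0; pose F : {mfun T1 >-> T2} := mfun_Sub (mem_set mphi).
transitivity (\int[distribution P F]_y h y).
  by rewrite ge0_integral_distribution.
by apply: eq_measure_integral => A mA _; exact: phiPQ.
Qed.

End image_measure.

Section image_measure_signed.
Context d1 d2 (T1 : measurableType d1) (T2 : measurableType d2) (R : realType).
Variables (P : probability T1 R) (Q : probability T2 R) (phi : T1 -> T2).
Hypothesis mphi : measurable_fun setT phi.
Hypothesis phiPQ : forall A, measurable A -> P (phi @^-1` A) = Q A.
Variable h : T2 -> \bar R.
Hypothesis mh : measurable_fun setT h.
Local Open Scope ereal_scope.

Lemma integral_image : \int[P]_x h (phi x) = \int[Q]_y h y.
Proof.
rewrite [LHS]integralE [RHS]integralE; congr (_ - _).
- rewrite -(ge0_integral_image mphi phiPQ (h := h^\+))//.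
    by apply: eq_integral => x _; rewrite !funeposE.
  exact: measurable_funepos.
- rewrite -(ge0_integral_image mphi phiPQ (h := h^\-))//.
    by apply: eq_integral => x _; rewrite !funenegE.
  exact: measurable_funeneg.
Qed.

Lemma integrable_image :
  P.-integrable setT (h \o phi) <-> Q.-integrable setT h.
Proof.
have E : \int[P]_x `|h (phi x)| = \int[Q]_y `|h y|.
  rewrite -(ge0_integral_image mphi phiPQ (h := fun y => `|h y|))//.
  exact: measurableT_comp.
split=> /integrableP[_ hi]; apply/integrableP; split => //.
- by rewrite -E.
- exact: measurableT_comp.
- by rewrite /= E.
Qed.

End image_measure_signed.

Lemma probability_indic d (T : measurableType d) (R : realType)
    (P : probability T R) (A : set T) : measurable A ->
  (\int[P]_x (\1_A x)%:E = P A)%E.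
Proof. by move=> mA; rewrite integral_indic// setIT. Qed.

Section image_almost_everywhere.
Context d1 d2 (T1 : measurableType d1) (T2 : measurableType d2) (R : realType).
Variables (P : probability T1 R) (Q : probability T2 R) (phi : T1 -> T2).
Hypothesis mphi : measurable_fun setT phi.
Hypothesis phiPQ : forall A, measurable A -> P (phi @^-1` A) = Q A.
Variable E : T2 -> Prop.

Lemma ae_preimage :
  {ae Q, forall y, E y} -> {ae P, forall x, E (phi x)}.
Proof.
move=> [N [mN QN NE]]; exists (phi @^-1` N); split.
- by rewrite -[X in measurable X]setTI; exact: mphi.
- by rewrite [LHS]phiPQ.
- by move=> x /= h; exact: NE.
Qed.

Lemma ae_image : measurable [set y | E y] ->
  {ae P, forall x, E (phi x)} -> {ae Q, forall y, E y}.
Proof.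
move=> mE EP; exists (~` [set y | E y]); split => //; first exact: measurableC.
rewrite -[LHS]phiPQ//; last exact: measurableC.
apply/negligibleP => //.
by rewrite -[X in measurable X]setTI; apply: mphi => //; exact: measurableC.
Qed.

End image_almost_everywhere.

Section product_probability_marginals.
Context d1 d2 (T1 : measurableType d1) (T2 : measurableType d2) (R : realType).
Variables (P1 : probability T1 R) (P2 : probability T2 R).

Lemma product_probability_fst (A : set T1) : measurable A ->
  (P1 \x P2)%E (fst @^-1` A) = P1 A.
Proof.
move=> mA; rewrite (_ : fst @^-1` A = A `*` setT); last first.
  by apply/seteqP; split => -[x y] //= -[].
transitivity (P1 A * P2 setT)%E; first exact: product_measure1E.
by rewrite probability_setT mule1.
Qed.

Lemma product_probability_snd (A : set T2) : measurable A ->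
  (P1 \x P2)%E (snd @^-1` A) = P2 A.
Proof.
move=> mA; rewrite (_ : snd @^-1` A = setT `*` A); last first.
  by apply/seteqP; split => -[x y] //= -[].
transitivity (P1 setT * P2 A)%E; first exact: product_measure1E.
by rewrite probability_setT mul1e.
Qed.

End product_probability_marginals.

(** * Transport to the normal law in dimension one *)

Section gaussian_moments.
Context (R : realType).
Variable s : R.
Hypothesis s0 : 0 < s.
Local Notation lebesgue := (@lebesgue_measure R).
Local Notation w := (normal_pdf 0 s).

Lemma normal_pdf0E x : w x = normal_peak s * expR (- x ^+ 2 / (s ^+ 2 *+ 2)).
Proof. by rewrite normal_pdfE ?gt_eqF// /normal_fun subr0. Qed.

Lemma normal_pdf_gt0 x : 0 < w x.
Proof. by rewrite normal_pdf0E mulr_gt0 ?expR_gt0// normal_peak_gt0// gt_eqF. Qed.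

Lemma is_derive_normal_pdf (x : R) : is_derive x 1 (fun x : R => - s ^+ 2 * w x) (x * w x).
Proof.
rewrite (_ : (fun x => _) =
  (fun x => - s ^+ 2 * (normal_peak s * expR (- x ^+ 2 / (s ^+ 2 *+ 2))))); last first.
  by apply/funext => y; rewrite normal_pdf0E.
rewrite normal_pdf0E; apply: is_derive_eq.
by rewrite !scaler0 ?addr0 /GRing.scale/=; field; rewrite ?gt_eqF.
Qed.

Lemma cvg_normal_pdf : (- s ^+ 2 * w x : R) @[x --> +oo%R] --> (0 : R).
Proof.
rewrite (_ : (fun x => _) = (fun x => - s ^+ 2 * normal_peak s *
    expR (- ((s ^+ 2 *+ 2)^-1 * x ^+ 2)))); last first.
  by apply/funext => x; rewrite normal_pdf0E mulrA; congr (_ * expR _); rewrite mulNr [_ * x ^+ 2]mulrC.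
rewrite -[X in _ --> X](mulr0 (- s ^+ 2 * normal_peak s)).
apply: cvgMr; apply: (cvg_comp _ (fun y => expR (- y))); last exact: cvgr_expR.
apply: gt0_cvgMry; last exact: cvgr_expr2.
by rewrite invr_gt0 pmulrn_lgt0// exprn_gt0.
Qed.

Lemma continuous_mul_normal_pdf : continuous (fun x : R => x * w x).
Proof.
move=> x; apply: cvgM; first exact: cvg_id.
by apply: continuous_normal_pdf; rewrite gt_eqF.
Qed.

(** [- s ^+ 2 * w x] is a primitive of [x * w x]. The improper form of the fundamental theorem asks
    for a nonnegative integrand, hence the split at 0 when [r] is negative. *)
Lemma lebesgue_tail_normal (r : R) :
  (\int[lebesgue]_(x in `]r, +oo[) (x * w x)%:E = (s ^+ 2 * w r)%:E)%E.
Proof.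
have dF (x : R) : derivable (fun x : R => - s ^+ 2 * w x) x 1.
  by have [] := is_derive_normal_pdf x.
have cF : continuous (fun x : R => - s ^+ 2 * w x).
  by move=> x; exact/differentiable_continuous/derivable1_diffP.
have F'E (x : R) : (fun x : R => - s ^+ 2 * w x)^`()%classic x = x * w x.
  by rewrite derive1E; apply: @derive_val; exact: is_derive_normal_pdf.
have mg : measurable_fun setT (fun x : R => (x * w x)%:E).
  apply/measurable_EFinP; apply: continuous_measurable_fun.
  exact: continuous_mul_normal_pdf.
have pos a : 0 <= a ->
    (\int[lebesgue]_(x in `]a, +oo[) (x * w x)%:E = (s ^+ 2 * w a)%:E)%E.
  move=> a0; rewrite integral_itv_obnd_cbnd; last exact: measurable_funTS.
  rewrite (@ge0_continuous_FTC2y _ _ (fun x : R => - s ^+ 2 * w x) a 0).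
  - by rewrite sub0e -EFinN mulNr opprK.
  - by move=> x ax; rewrite mulr_ge0 ?normal_pdf_ge0// (le_trans a0).
  - exact/continuous_subspaceT/continuous_mul_normal_pdf.
  - exact: cvg_normal_pdf.
  - by move=> x _; exact: dF.
  - exact/cvg_at_right_filter/cF.
  - by move=> x _; exact: F'E.
have [r0|r0] := leP 0 r; first exact: pos.
rewrite (_ : `]r, +oo[%classic = `]r, 0] `|` `]0, +oo[)%classic; last first.
  by rewrite -itv_bndbnd_setU// bnd_simp ltW.
rewrite integral_setU//=; last 2 first.
- exact: measurable_funTS.
- rewrite disj_set2E; apply/eqP/seteqP; split => x //=.
  by rewrite !in_itv/= andbT => -[/andP[_ x0]]; rewrite ltNge x0.
rewrite pos// integral_itv_obnd_cbnd; last exact: measurable_funTS.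
rewrite (@continuous_FTC2 _ _ (fun x : R => - s ^+ 2 * w x) r 0)//.
- by rewrite -!EFinD; congr EFin; ring.
- exact/continuous_subspaceT/continuous_mul_normal_pdf.
- split => //.
  + exact/cvg_at_right_filter/cF.
  + exact/cvg_at_left_filter/cF.
Qed.

Local Notation N := (normal_prob 0 s).

Lemma normal_has_density : has_density N lebesgue w.
Proof.
split=> //; first exact: measurable_normal_pdf.
by move=> x; exact: normal_pdf_ge0.
Qed.

Lemma normal_sqr_integrable : N.-integrable setT (fun x => (x ^+ 2)%:E).
Proof.
have m2 : measurable_fun setT (fun x : R => (x ^+ 2)%:E).
  by apply/measurable_EFinP; exact: measurable_funX.
apply/(integrable_density normal_has_density) => //.
(* Domination by a multiple of the Gaussian density of variance [2 * s ^+ 2]: the quotient of the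
   two exponentials is [expR (x ^+ 2 / (4 * s ^+ 2))], which exceeds [x ^+ 2 / (4 * s ^+ 2)]. This
   dictates the constant [c]. *)
pose t := Num.sqrt 2 * s.
have t0 : t != 0 by rewrite mulf_neq0 ?gt_eqF// sqrtr_gt0.
have tE : t ^+ 2 = 2 * s ^+ 2 by rewrite exprMn sqr_sqrtr.
pose c := 4 * s ^+ 2 * normal_peak s * (normal_peak t)^-1.
apply: (le_integrable _ _ _ (integrableZl measurableT c
  (integrable_normal_pdf 0 t))) => //.
  apply: emeasurable_funM => //; apply/measurable_EFinP.
  exact: measurable_normal_pdf.
move=> x _.
have c0 : 0 <= c.
  by rewrite /c divr_ge0 ?mulr_ge0 ?normal_peak_ge0// ltW.
rewrite -!EFinM !abse_EFin lee_fin !ger0_norm; last 2 first.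
- by rewrite mulr_ge0 ?normal_pdf_ge0.
- by rewrite mulr_ge0 ?sqr_ge0 ?normal_pdf_ge0.
rewrite normal_pdf0E (normal_pdfE _ t0) /normal_fun subr0 /c.
have -> : expR (- x ^+ 2 / (s ^+ 2 *+ 2)) =
    expR (- x ^+ 2 / (t ^+ 2 *+ 2)) / expR (x ^+ 2 / (4 * s ^+ 2)).
  rewrite -expRN -expRD; congr expR; rewrite tE.
  by field; rewrite gt_eqF.
have pt0 := normal_peak_gt0 t0.
set e2 := expR _; set e1 := expR _.
rewrite (_ : _ / _ * _ = normal_peak s * e2 * (4 * s ^+ 2)); last first.
  by field; rewrite gt_eqF.
rewrite [X in X <= _](_ : _ = normal_peak s * e2 * (x ^+ 2 / e1)); last by ring.
rewrite ler_wpM2l ?mulr_ge0 ?normal_peak_ge0 ?expR_ge0//.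
rewrite ler_pdivrMr ?expR_gt0// mulrC -ler_pdivrMr ?mulr_gt0 ?exprn_gt0//.
by rewrite (le_trans _ (expR_ge1Dx _))// lerDr.
Qed.

Lemma normal_id_integrable : N.-integrable setT (fun x => x%:E).
Proof.
have i1 : N.-integrable setT (EFin \o cst (1 : R)).
  exact: finite_measure_integrable_cst.
apply: (le_integrable measurableT _ _
  (integrableD measurableT i1 normal_sqr_integrable)).
  exact/measurable_EFinP.
move=> x _ /=; rewrite lee_fin (@ger0_norm _ (1 + _)) ?addr_ge0 ?sqr_ge0//.
have [x0|x0] := leP 0 x.
  by rewrite ger0_norm//; nra.
by rewrite ltr0_norm//; nra.
Qed.

Lemma normal_tail (r : R) :
  (\int[N]_v (if r < v then v else 0)%:E = (s ^+ 2 * w r)%:E)%E.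
Proof.
rewrite (integral_density normal_has_density); last first.
  apply/measurable_EFinP; apply: measurable_fun_ifT => //.
  exact: measurable_fun_ltr.
rewrite -lebesgue_tail_normal [RHS]integral_mkcond.
apply: eq_integral => x _; rewrite patchE; case: ifPn => [rx|rx].
  by rewrite mem_set//= in_itv/= rx.
by rewrite mul0e memNset//= in_itv/= (negbTE rx).
Qed.

(** The symmetry of the density exchanges the two half-lines; the tail formula at 0 shows that each
    half is finite, so that they cancel. *)
Lemma normal_mean : (\int[N]_v v%:E = 0)%E.
Proof.
rewrite (integral_density normal_has_density); last exact/measurable_EFinP.
have mf : measurable_fun setT (fun x : R => (x * w x)%:E).
  apply/measurable_EFinP; apply: continuous_measurable_fun.
  exact: continuous_mul_normal_pdf.
under eq_integral do rewrite -EFinM.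
rewrite -(setUv `]0, +oo[%classic) integral_setU//=; last 3 first.
- exact: measurableC.
- by rewrite setUv.
- exact/disj_setPCl.
rewrite setCitvr integral_itv_obnd_cbnd; last exact: measurable_funTS.
have pE : (\int[lebesgue]_(x in `[0%R, +oo[) (x * w x)%:E =
           \int[lebesgue]_(x in `[0%R, +oo[) (`|x| * w x)%:E)%E.
  apply: eq_integral => x; rewrite inE/= in_itv/= andbT => x0.
  by rewrite ger0_norm.
have nE : (\int[lebesgue]_(x in `]-oo, 0%R]) (x * w x)%:E =
           - \int[lebesgue]_(x in `]-oo, 0%R]) (`|x| * w x)%:E)%E.
  rewrite -integral_ge0N; last first.
    by move=> x _; rewrite lee_fin mulr_ge0// normal_pdf_ge0.
  apply: eq_integral => x; rewrite inE/= in_itv/= => x0.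
  by rewrite ler0_norm// mulNr opprK.
have wN x : w (- x) = w x by rewrite !normal_pdf0E sqrrN.
have hE : (\int[lebesgue]_(x in `[0%R, +oo[) (`|x| * w x)%:E =
           \int[lebesgue]_(x in `]-oo, 0%R]) (`|x| * w x)%:E)%E.
  rewrite ge0_integration_by_substitution0.
  - by apply: eq_integral => x _; rewrite normrN wN.
  - apply/measurable_EFinP; apply: measurable_funM; last exact: measurable_normal_pdf.
    exact: normr_measurable.
  - by move=> x; rewrite lee_fin mulr_ge0// normal_pdf_ge0.
have := lebesgue_tail_normal 0; rewrite integral_itv_obnd_cbnd; last exact: measurable_funTS.
by rewrite nE pE hE => ->; rewrite subee.
Qed.

End gaussian_moments.

(** * Distribution functions, quantiles and monotone rearrangement *)

Section cumulative.
Context (R : realType).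
Implicit Types P Q : probability (measurableTypeR R) R.

Lemma probability_ray_unique P Q :
  (forall r : R, P `]-oo, r]%classic = Q `]-oo, r]%classic) ->
  forall A, measurable A -> P A = Q A.
Proof.
move=> PQ A mA; apply: (@measure_unique _ R (measurableTypeR R) (@RGenOInfty.G R)
    (fun n : nat => `](- (n%:R : R)), +oo[%classic) _ _ _ _ P Q) => //.
- exact: RGenOInfty.measurableE.
- move=> _ _ [x ->] [y ->]; exists (Num.max x y).
  by apply/seteqP; split => z /=; rewrite !in_itv/= !andbT gt_max => /andP.
- by move=> n; exists (- n%:R).
- rewrite -subTset => x _; exists (Num.bound x) => //=.
  by rewrite in_itv/= andbT ltrNl unstable.ltrNbound.
- move=> _ [x ->].
  have rayC (U : probability (measurableTypeR R) R) :
      U `]x, +oo[%classic = (1 - U `]-oo, x]%classic)%E.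
    by rewrite -setCitvl probability_setC.
  by transitivity (1 - P `]-oo, x]%classic)%E;
    [exact: rayC|rewrite PQ; exact/esym/rayC].
- by move=> n; rewrite (le_lt_trans (probability_le1 _ _)) ?ltry.
Qed.

Definition cumul P (y : R) : R := fine (P `]-oo, y]%classic).

Lemma cumulE P y : (cumul P y)%:E = P `]-oo, y]%classic.
Proof. by rewrite fineK// fin_num_measure. Qed.

Lemma cumul_nondecreasing P : {homo cumul P : x y / x <= y}.
Proof.
move=> x y xy; rewrite -lee_fin !cumulE le_measure ?inE//.
by move=> z /=; rewrite !in_itv/= => /le_trans; exact.
Qed.

Lemma measurable_cumul P : measurable_fun setT (cumul P).
Proof.
apply: nondecreasing_measurable => // x y; exact: cumul_nondecreasing.
Qed.

Lemma cumul_ge0 P y : 0 <= cumul P y. Proof. exact: fine_ge0. Qed.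

Lemma cumul_le1 P y : cumul P y <= 1.
Proof. by rewrite -lee_fin cumulE probability_le1. Qed.

Let idTR : measurableTypeR R -> R := idfun.

#[local] HB.instance Definition _ :=
  @isMeasurableFun.Build _ _ _ _ idTR (@measurable_id _ _ setT).

(* Right continuity makes the superlevel sets of the distribution function
   closed rays. *)
Lemma ex_quantile P (u : R) : 0 < u < 1 ->
  exists y, forall z, (u <= cumul P z) = (y <= z).
Proof.
move=> /andP[u0 u1].
pose X : {RV P >-> R} := idTR.
have cdfE y : cdf X y = (cumul P y)%:E by rewrite cumulE.
pose S := [set z | u <= cumul P z].
have [z1 Sz1] : S !=set0.
  have /fine_cvgP[_ /cvgr_gt/(_ _ u1)[M [_ MP]]] := cvg_cdfy1 X.
  exists (M + 1); rewrite /S/= ltW//.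
  by have := MP (M + 1); rewrite /= cdfE; apply; rewrite ltrDl.
have [z0 Sz0] : has_lbound S.
  have /fine_cvgP[_ /cvgr_lt/(_ _ u0)[M [_ MP]]] := cvg_cdfNy0 X.
  exists M => z; rewrite /S/= leNgt; apply: contraNle => zM.
  by have := MP z zM; rewrite /= cdfE.
have hS : has_inf S by split; [exists z1|exists z0].
exists (inf S) => z; apply/idP/idP => [uz|Sz].
  by apply: ge_inf => //; exists z0.
have upS x y : S x -> x <= y -> S y.
  by move=> Sx xy; exact: le_trans Sx (cumul_nondecreasing P xy).
have [Sz'|zS] := ltP (inf S) z.
  by have [x Sx /ltW xz] := inf_lt hS.1 Sz'; exact: upS Sx xz.
have -> : z = inf S by apply/eqP; rewrite eq_le Sz zS.
rewrite -lee_fin -cdfE.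
apply: (cvge_ge _ (@cdf_right_continuous _ _ _ _ X (inf S))).
near=> x; rewrite cdfE lee_fin.
have Sx : inf S < x by [].
by have [y Sy /ltW yx] := inf_lt hS.1 Sx; exact: upS Sy yx.
Unshelve. all: by end_near. Qed.

(** The value is selected by its Galois connection with [cumul P], the property on which the later
    proofs rely. Outside the open unit interval, where no such point need exist, the default is
    0. *)
Definition quantile P (u : R) : R :=
  if 0 < u < 1 then xget 0 [set y | forall z, (u <= cumul P z) = (y <= z)]
  else 0.

Lemma quantile_le P (u z : R) : 0 < u < 1 ->
  (quantile P u <= z) = (u <= cumul P z).
Proof.
move=> u01; rewrite /quantile u01; case: xgetP => [y _ /(_ z)->//|].
by have [y Py] := ex_quantile P u01 => /(_ y).
Qed.

Lemma measurable_quantile P : measurable_fun setT (quantile P).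
Proof.
rewrite -(setUv `]0, 1[%classic); apply/measurable_funU => //.
  exact: measurableC.
split.
  apply: (measurability _ (RGenOInfty.measurableE R)) => // _ [_ [r ->] <-].
  rewrite (_ : _ `&` _ = `]0, 1[%classic `&` `]cumul P r, +oo[%classic); last first.
    apply/seteqP; split => u /= [u01]; rewrite !in_itv/= !andbT in u01 *.
      by move=> h; split=> //; rewrite ltNge -quantile_le// -ltNge.
    by move=> h; split=> //; rewrite ltNge quantile_le// -ltNge.
  exact: measurableI.
apply: (@eq_measurable_fun _ _ (measurableTypeR R) R _ (cst (0 : R))); last exact: measurable_cst.
by move=> x; rewrite inE/= in_itv/= => /negP/negbTE h; rewrite /quantile h.
Qed.

Section atomless.
Variable P : probability (measurableTypeR R) R.
Hypothesis P_atomless : forall y, P [set y] = 0%E.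

(** Without atoms, the closed ray ending at the quantile has the mass of the open one, which is an
    increasing limit of masses below [u]. *)
Lemma cumul_quantile (u : R) : 0 < u < 1 -> cumul P (quantile P u) = u.
Proof.
move=> u01; apply/eqP; rewrite eq_le -quantile_le// lexx andbT.
set q := quantile P u.
have Fl z : z < q -> cumul P z < u.
  by move=> zq; rewrite ltNge -quantile_le// -ltNge.
rewrite -lee_fin cumulE.
have -> : (P `]-oo, q]%classic = P `]-oo, q[%classic)%E.
  by rewrite -(@setUitv1 _ _ _ _ true)// measureU0//; exact: P_atomless.
pose A (n : nat) := `]-oo, q - n.+1%:R^-1]%classic : set R.
have AE : \bigcup_n A n = `]-oo, q[%classic.
  apply/seteqP; split => [z [n _]|z]; rewrite /A /= !in_itv/=.
    by move=> /le_lt_trans; apply; rewrite ltrBlDr ltrDl invr_gt0.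
  move=> /ltr_add_invr[k zk]; exists k => //=.
  by rewrite in_itv/= lerBrDr ltW.
have : (P \o A) n @[n --> \oo] --> P (\bigcup_n A n).
  apply: nondecreasing_cvg_mu.
  - by move=> n; exact: measurable_itv.
  - by rewrite AE; exact: measurable_itv.
  - move=> n m nm; apply/subsetPset => z; rewrite /A/= !in_itv/= => /le_trans; apply.
    by rewrite lerD2l lerN2 lef_pV2 ?posrE// ler_nat.
rewrite AE => /cvge_to_le; apply; near=> n.
by rewrite /= -cumulE lee_fin ltW// Fl// ltrBlDr ltrDl invr_gt0.
Unshelve. all: by end_near. Qed.

(** In other words, [cumul P] is uniformly distributed under [P]. A plateau of the distribution
    function at height [u] may extend beyond [quantile P u], so the upper bound goes through
    quantiles at levels [v] slightly above [u]. *)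
Lemma cumul_sublevel (u : R) : 0 <= u <= 1 ->
  P [set y | cumul P y <= u] = u%:E.
Proof.
have mS v : measurable [set y | cumul P y <= v].
  rewrite -[X in measurable X]setTI.
  exact: (measurable_fun_ler (measurable_cumul P) (measurable_cst _)).
move=> /andP[u0]; rewrite le_eqVlt => /predU1P[->|u1].
  rewrite [X in P X](_ : _ = setT) ?probability_setT//.
  by apply/seteqP; split => // y _ /=; exact: cumul_le1.
have ub v : u < v < 1 -> (P [set y | (cumul P y <= u)%R] <= v%:E)%E.
  move=> /andP[uv v1]; have v01 : 0 < v < 1 by rewrite v1 (le_lt_trans u0).
  rewrite -(cumul_quantile v01) cumulE le_measure ?inE//; first exact: mS.
  move=> y /= yu; rewrite in_itv/= leNgt; apply/negP => /ltW.
  rewrite quantile_le//.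
  by rewrite leNgt (le_lt_trans yu).
apply/eqP; rewrite eq_le; apply/andP; split.
  apply/lee_addgt0Pr => e e0; rewrite -EFinD.
  (* The second argument keeps [v] strictly between [u] and 1, however large [e] is. *)
  pose v := Num.min (u + e) ((u + 1) / 2).
  have := ub v; rewrite /v gt_min lt_min.
  have [h|h] := leP (u + e) ((u + 1) / 2).
    by apply; apply/andP; split; [apply/andP; split|]; lra.
  move=> /(_ _)/le_trans; apply; last by rewrite lee_fin; lra.
  by apply/andP; split; [apply/andP; split|]; lra.
have [->|u_neq0] := eqVneq u 0; first by rewrite measure_ge0.
have u01 : 0 < u < 1 by rewrite lt_neqAle eq_sym u_neq0 u0.
rewrite -[X in (X%:E <= _)%E](cumul_quantile u01) cumulE le_measure ?inE//; first exact: mS.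
move=> y; rewrite /= in_itv/= => /(cumul_nondecreasing P).
by rewrite cumul_quantile.
Qed.
Lemma cumul_gt0_lt1_ae : {ae P, forall y, 0 < cumul P y < 1}.
Proof.
have mle v : measurable [set y | cumul P y <= v].
  rewrite -[X in measurable X]setTI.
  exact: (measurable_fun_ler (measurable_cumul P) (measurable_cst _)).
have mge v : measurable [set y | v <= cumul P y].
  rewrite -[X in measurable X]setTI.
  exact: (measurable_fun_ler (measurable_cst _) (measurable_cumul P)).
have n0 : P.-negligible [set y | cumul P y <= 0].
  apply/negligibleP; first exact: mle.
  by apply: cumul_sublevel; rewrite lexx ler01.
have n1 : P.-negligible [set y | 1 <= cumul P y].
  apply/negligibleP; first exact: mge.
  suff : P [set y | 1 <= cumul P y] = 0%E by [].
  apply/eqP; rewrite eq_le measure_ge0 andbT.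
  apply/lee_addgt0Pr => e e0; rewrite add0e.
  pose v := Num.max 0 (1 - e).
  have v1 : v < 1 by rewrite gt_max ltr01/= ltrBlDr ltrDl.
  have -> : e%:E = (1 - (1 - e)%:E)%E by rewrite -EFinB; congr EFin; lra.
  apply: (@le_trans _ _ (1 - v%:E)%E); last first.
    by rewrite -!EFinB lee_fin lerD2l lerN2 le_max lexx orbT.
  rewrite -(@cumul_sublevel v) ?(ltW v1) ?le_max ?lexx//.
  rewrite -(probability_setC P (mle v)) le_measure ?inE//.
  - exact: mge.
  - by apply: measurableC; exact: mle.
  by move=> y /= y1; apply/negP; rewrite -ltNge (lt_le_trans v1).
apply: (negligibleS _ (negligibleU n0 n1)) => y /= /negP.
by rewrite negb_and -!leNgt => /orP.
Qed.

(** The exceptional set [D] is the plateau to the right of [z]: it is null because []-oo, z]] and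
    the sublevel set at height [cumul P z] both have mass [cumul P z]. *)
Lemma cumul_lt_ae (z : R) : {ae P, forall y, (z < y) = (cumul P z < cumul P y)}.
Proof.
pose D := [set y | cumul P y <= cumul P z] `\` `]-oo, z].
have mle : measurable [set y | cumul P y <= cumul P z].
  rewrite -[X in measurable X]setTI.
  exact: (measurable_fun_ler (measurable_cumul P) (measurable_cst _)).
have mD : measurable D by exact: measurableD.
have PD : P D = 0%E.
  rewrite measureD//; last by rewrite (le_lt_trans (probability_le1 _ _)) ?ltry.
  rewrite (_ : _ `&` _ = `]-oo, z]%classic); last first.
    by apply/setIidPr => y; rewrite /= in_itv/=; exact: cumul_nondecreasing.
  transitivity ((cumul P z)%:E - (cumul P z)%:E)%E; last by rewrite subee.
  congr (_ - _)%E; last exact/esym/cumulE.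
  by apply: cumul_sublevel; rewrite cumul_ge0 cumul_le1.
exists D; split => // y /= h; rewrite /D/= in_itv/=; split.
  rewrite leNgt; apply/negP => zy; apply: h; rewrite zy.
  by apply: contraTT zy; rewrite -!leNgt; exact: cumul_nondecreasing.
move=> yz; apply: h; rewrite ltNge yz/=; apply/esym/negbTE.
by rewrite -leNgt; exact: cumul_nondecreasing.
Qed.

Variable Q : probability (measurableTypeR R) R.

(** The increasing transport map: it pushes [P] to [Q] as soon as [P] has no atoms, whereas [Q] is
    arbitrary. *)
Definition rearrange (y : R) : R := quantile Q (cumul P y).

Lemma measurable_rearrange : measurable_fun setT rearrange.
Proof.
exact: measurableT_comp (measurable_quantile Q) (measurable_cumul P).
Qed.

Lemma rearrange_le_ae : {ae P, forall y, forall r,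
  (rearrange y <= r) = (cumul P y <= cumul Q r)}.
Proof.
apply: negligibleS cumul_gt0_lt1_ae => y /=; apply: contra_not => y01 r.
by rewrite /rearrange quantile_le.
Qed.

Lemma rearrange_preimage (A : set (measurableTypeR R)) : measurable A ->
  P (rearrange @^-1` A) = Q A.
Proof.
pose T : {mfun measurableTypeR R >-> measurableTypeR R} :=
  @mfun_Sub _ _ (measurableTypeR R) (measurableTypeR R) rearrange
    (mem_set measurable_rearrange).
move=> mA; rewrite -[LHS]/(distribution P T A); move: A mA.
apply: (@probability_ray_unique (distribution P T) Q) => r.
rewrite /distribution/= /pushforward.
have mle : measurable [set y | cumul P y <= cumul Q r].
  rewrite -[X in measurable X]setTI.
  exact: (measurable_fun_ler (measurable_cumul P) (measurable_cst _)).
have mT : measurable (rearrange @^-1` `]-oo, r]%classic).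
  by rewrite -[X in measurable X]setTI; exact: measurable_rearrange.
transitivity (P [set y | cumul P y <= cumul Q r]).
  rewrite -[LHS]/(P (rearrange @^-1` `]-oo, r]%classic)).
  apply: (@probability_ae_eq _ (measurableTypeR R) R P _ _ mT mle).
  apply: negligibleS rearrange_le_ae => y /=; apply: contra_not => /(_ r) h.
  by rewrite in_itv/= h.
by rewrite cumul_sublevel ?cumulE// cumul_ge0 cumul_le1.
Qed.

Lemma ge0_integral_rearrange (h : R -> \bar R) : measurable_fun setT h ->
  (forall x, 0 <= h x)%E ->
  (\int[P]_y h (rearrange y) = \int[Q]_x h x)%E.
Proof.
move=> mh h0.
pose T : {mfun measurableTypeR R >-> measurableTypeR R} :=
  @mfun_Sub _ _ (measurableTypeR R) (measurableTypeR R) rearrange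
    (mem_set measurable_rearrange).
transitivity (\int[distribution P T]_x h x)%E.
  by rewrite ge0_integral_distribution.
by apply: eq_measure_integral => A mA _; exact: rearrange_preimage.
Qed.

Lemma integral_rearrange (h : R -> \bar R) : measurable_fun setT h ->
  (\int[P]_y h (rearrange y) = \int[Q]_x h x)%E.
Proof.
move=> mh; rewrite [LHS]integralE [RHS]integralE; congr (_ - _)%E.
- rewrite -ge0_integral_rearrange//; last exact: measurable_funepos.
  by apply: eq_integral => x _; rewrite !funeposE.
- rewrite -ge0_integral_rearrange//; last exact: measurable_funeneg.
  by apply: eq_integral => x _; rewrite !funenegE.
Qed.

Lemma integrable_rearrange (h : R -> \bar R) : measurable_fun setT h ->
  Q.-integrable setT h -> P.-integrable setT (h \o rearrange).
Proof.
move=> mh /integrableP[_ hQ]; apply/integrableP; split.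
  exact: measurableT_comp measurable_rearrange.
rewrite /comp (ge0_integral_rearrange (h := fun x => `|h x|%E))//.
exact: measurableT_comp.
Qed.
End atomless. End cumulative.

(** * A signed layer-cake formula *)

Section layer_cake.
Context (R : realType).
Local Notation lebesgue := (@lebesgue_measure R).

(** Subtracting the indicator of [z < 0] makes the layers integrable: for either sign of [y], the
    integral in [z] is [y], and that of the absolute value is [|y|]. *)
Let k (y z : R) : R := (if z < y then 1 else 0) - (if z < 0 then 1 else 0).

Let kE (y : R) : k y =
  (fun z => if 0 <= y then \1_(`[0, y[%classic) z else - \1_(`[y, 0[%classic) z).
Proof.
apply/funext => z; rewrite /k !indicE.
have [y0|y0] := leP 0 y.
  have -> : (z \in `[0, y[%classic) = (0 <= z < y).
    by apply/idP/idP; rewrite inE/= in_itv.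
  by case: (ltP z y); case: (ltP z 0) => /=; rewrite ?subr0 ?sub0r//; lra.
have -> : (z \in `[y, 0[%classic) = (y <= z < 0).
  by apply/idP/idP; rewrite inE/= in_itv.
by case: (ltP z y); case: (ltP z 0) => /=; rewrite ?subr0 ?sub0r//; lra.
Qed.

Let measurable_k y : measurable_fun setT (k y).
Proof.
by apply: measurable_funB; apply: measurable_fun_ifT => //;
  exact: measurable_fun_ltr.
Qed.

Let k_abs y : (\int[lebesgue]_z `|k y z|%:E = `|y|%:E)%E.
Proof.
rewrite kE; have [y0|y0] := leP 0 y.
  under eq_integral do rewrite ger0_norm//.
  rewrite integral_indic//= setIT ger0_norm// lebesgue_measure_itv/= lte_fin.
  by case: ltP => [_|y0']; rewrite ?sube0//; congr EFin; lra.
under eq_integral do rewrite normrN ger0_norm//.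
rewrite integral_indic//= setIT ltr0_norm// lebesgue_measure_itv/= lte_fin y0.
by rewrite add0e.
Qed.

Let k_int y : (\int[lebesgue]_z (k y z)%:E = y%:E)%E.
Proof.
rewrite kE; have [y0|y0] := leP 0 y.
  rewrite integral_indic//= setIT lebesgue_measure_itv/= lte_fin.
  by case: ltP => [_|y0']; rewrite ?sube0//; congr EFin; lra.
under eq_integral do rewrite EFinN.
rewrite integral_ge0N//.
rewrite integral_indic//= setIT lebesgue_measure_itv/= lte_fin y0.
by rewrite add0e -EFinN opprK.
Qed.

(** Write [y] as the integral of [k y z] over [z] and exchange the integrals; the integrability of
    [y * r y] is exactly what Fubini's theorem needs. The centering of [r] then removes the part of
    [k] that does not depend on [y]. *)
Lemma integral_id_mul (P : probability (measurableTypeR R) R) (r : R -> R) :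
  measurable_fun setT r -> P.-integrable setT (fun y => (r y)%:E) ->
  P.-integrable setT (fun y => (y * r y)%:E) ->
  (\int[P]_y (r y)%:E = 0)%E ->
  (\int[P]_y (y * r y)%:E =
   \int[lebesgue]_z \int[P]_y (if z < y then r y else 0)%:E)%E.
Proof.
move=> mr ir iyr r0.
pose f (yz : measurableTypeR R * measurableTypeR R) : \bar R :=
  (k yz.1 yz.2 * r yz.1)%:E.
have mf : measurable_fun setT f.
  apply/measurable_EFinP; apply: measurable_funM; last exact: measurableT_comp.
  by apply: measurable_funB; apply: measurable_fun_ifT => //;
    exact: measurable_fun_ltr.
have fint : (P \x lebesgue)%E.-integrable setT f.
  apply/integrable12ltyP => //.
  move/integrableP : iyr => [_]; congr (_ < _)%E.
  apply: eq_integral => y _; rewrite /f/=.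
  under eq_integral do rewrite normrM EFinM.
  rewrite ge0_integralZr//; last first.
    by apply/measurable_EFinP; apply: measurableT_comp => //; exact: measurable_k.
  by rewrite k_abs normrM EFinM.
have := Fubini fint; rewrite /f/=.
have -> : (\int[P]_x \int[lebesgue]_y (k x y * r x)%:E =
           \int[P]_x (x * r x)%:E)%E.
  apply: eq_integral => y _.
  under eq_integral do rewrite EFinM.
  rewrite integralZr//; first by rewrite k_int EFinM.
  apply/integrableP; split; first by apply/measurable_EFinP; exact: measurable_k.
  by rewrite k_abs ltry.
move=> ->; apply: eq_integral => z _.
have iz : P.-integrable setT (fun y => (if z < y then r y else 0)%:E).
  apply: le_integrable ir => //.
    apply/measurable_EFinP; apply: measurable_fun_ifT => //.
    exact: measurable_fun_ltr.
  by move=> y _ /=; case: ifPn => // _; rewrite normr0 lee_fin.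
transitivity (\int[P]_y ((if z < y then r y else 0)%:E -
                         (if (z < 0)%R then 1 else 0)%:E * (r y)%:E))%E.
  apply: eq_integral => y _; rewrite -EFinM -EFinB /k mulrBl; congr (_ - _)%:E.
  by case: ifPn; rewrite ?mul1r ?mul0r.
rewrite integralB//; last exact: integrableZl.
by rewrite integralZl// r0 mule0 sube0.
Qed.

End layer_cake.
(** With the identity as [r], [integral_id_mul] reduces the second moment to the integral of the
    tails, which are [s ^+ 2] times the density. *)
Lemma normal_second_moment (R : realType) (s : R) : 0 < s ->
  (\int[normal_prob 0 s]_v (v ^+ 2)%:E = (s ^+ 2)%:E)%E.
Proof.
move=> s0.
have E := @integral_id_mul R (normal_prob 0 s) id.
under eq_integral do rewrite expr2.
rewrite E//.
- under eq_integral do rewrite normal_tail// EFinM.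
  rewrite integralZl//; last exact: integrable_normal_pdf.
  by rewrite integral_normal_pdf mule1.
- exact: normal_id_integrable.
- exact: normal_sqr_integrable.
- exact: normal_mean.
Qed.

Lemma dominated_atomless (R : realType)
    (P : probability (measurableTypeR R) R) (y : R) :
  P `<< @lebesgue_measure R -> P [set y] = 0%E.
Proof.
by move/null_content_dominatesP; apply => //; exact: lebesgue_measure_set1.
Qed.

(** * The Jacobian estimate for the rearrangement *)

Section one_dimensional_transport.
Context (R : realType).
Local Notation lebesgue := (@lebesgue_measure R).
Local Notation N := (normal_prob (0 : R) 1).
Local Notation w := (normal_pdf (0 : R) 1).
Variables (p : probability (measurableTypeR R) R) (g : R -> R).
Hypothesis pg : has_density p N g.

Let NP : probability (measurableTypeR R) R := N.
Let T := rearrange p NP.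

Let mT : measurable_fun setT T. Proof. exact: measurable_rearrange. Qed.

Let NP_atomless y : NP [set y] = 0%E.
Proof. by apply: dominated_atomless; exact: normal_prob_dominates. Qed.

Lemma density_normal_atomless y : p [set y] = 0%E.
Proof.
apply: dominated_atomless.
apply: (@null_dominates_trans _ _ _ _ NP); last exact: normal_prob_dominates.
exact: (@has_density_dominates _ _ _ p NP g).
Qed.
Let p_atomless := density_normal_atomless.

Let good (z : R) := 0 < cumul p z < 1.

(** The rearrangement turns the tail [z < y] into the tail [T z < T y], over which the Gaussian mean
    is the density at [T z]. Where [cumul p z] is 0 or 1 the quantile takes its default value; the
    tail is then everything or nothing up to a null set, and its integral is 0 because the Gaussian
    is centered. *)
Let tailE (z : R) :
  (\int[p]_y (if z < y then T y else 0)%:E =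
   (if good z then w (T z) else 0)%:E)%E.
Proof.
have mz : measurable_fun setT (fun y : R => (if z < y then T y else 0)%:E).
  apply/measurable_EFinP; apply: measurable_fun_ifT => //.
  exact: measurable_fun_ltr.
have mTz : measurable_fun setT (fun y : R => (if T z < T y then T y else 0)%:E).
  apply/measurable_EFinP; apply: measurable_fun_ifT => //.
  exact: measurable_fun_ltr.
have mTE : measurable_fun setT (fun y : R => (T y)%:E) by exact/measurable_EFinP.
have ltE := cumul_lt_ae p_atomless z.
have goodE := cumul_gt0_lt1_ae p_atomless.
have [gz|] := boolP (good z).
  transitivity (\int[p]_y (if T z < T y then T y else 0)%:E)%E.
    apply: ae_eq_integral => //; apply: ae_imp2 ltE goodE => y zy gy _.
    have -> // : (z < y) = (T z < T y).
    rewrite zy !ltNge [in RHS]quantile_le//.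
    by rewrite (cumul_quantile NP_atomless).
  rewrite (integral_rearrange p_atomless NP
    (h := fun v => (if T z < v then v else 0)%:E)).
    by rewrite normal_tail// expr1n mul1r.
  apply/measurable_EFinP; apply: measurable_fun_ifT => //.
  exact: measurable_fun_ltr.
rewrite /good negb_and -!leNgt => gz.
have [z0|z1] : cumul p z = 0 \/ cumul p z = 1.
- case/orP: gz => gz; [left|right]; apply/eqP; rewrite eq_le gz.
    by rewrite cumul_ge0.
  by rewrite cumul_le1.
- transitivity (\int[p]_y (T y)%:E)%E.
    apply: ae_eq_integral => //; apply: ae_imp2 ltE goodE => y zy /andP[gy _] _.
    by rewrite zy z0 gy.
  rewrite (integral_rearrange p_atomless NP (h := EFin))//.
  exact: normal_mean.
- transitivity (\int[p]_y (0 : \bar R))%E; last by rewrite integral0.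
  apply: ae_eq_integral => //; apply: ae_imp2 ltE goodE => y zy /andP[_ gy] _.
  by rewrite zy z1 ltNge ltW.
Qed.

(* The inverse of [T' y], because [g] times the normal density is the pullback
   of the normal density by [T]. *)
Definition jacobian (y : R) : R := expR ((y ^+ 2 - T y ^+ 2) / 2) / g y.

Lemma jacobian_ge0 y : 0 <= jacobian y.
Proof. by have [_ g0 _] := pg; rewrite divr_ge0 ?expR_ge0. Qed.

Let measurable_expdiff :
  measurable_fun setT (fun y : R => expR ((y ^+ 2 - T y ^+ 2) / 2)).
Proof.
apply: measurableT_comp => //; apply: measurable_funM => //.
by apply: measurable_funB; exact: measurable_funX.
Qed.

Lemma measurable_jacobian : measurable_fun setT jacobian.
Proof.
have [mg g0 _] := pg; apply: measurable_funM; first exact: measurable_expdiff.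
exact: ge0_measurable_funV.
Qed.

Let measurable_good : measurable_fun setT good.
Proof.
apply: measurable_and.
  exact: (measurable_fun_ltr (measurable_cst _) (measurable_cumul p)).
exact: (measurable_fun_ltr (measurable_cumul p) (measurable_cst _)).
Qed.

Let T_integrable : p.-integrable setT (fun y => (T y)%:E).
Proof.
apply: (@integrable_rearrange _ _ p_atomless NP EFin) => //.
exact: normal_id_integrable.
Qed.

Let T2_integrable : p.-integrable setT (fun y => (T y ^+ 2)%:E).
Proof.
apply: (@integrable_rearrange _ _ p_atomless NP (fun v => (v ^+ 2)%:E)).
  by apply/measurable_EFinP; exact: measurable_funX.
exact: normal_sqr_integrable.
Qed.

Let T2_integral : (\int[p]_y (T y ^+ 2)%:E = 1)%E.
Proof.
rewrite (integral_rearrange p_atomless NP (h := fun v => (v ^+ 2)%:E)).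
  by rewrite normal_second_moment// expr1n.
by apply/measurable_EFinP; exact: measurable_funX.
Qed.

Let yT_integrable : p.-integrable setT (fun y => (y ^+ 2)%:E) ->
  p.-integrable setT (fun y => (y * T y)%:E).
Proof.
move=> i2.
apply: le_integrable (integrableD measurableT i2 T2_integrable) => //.
  by apply/measurable_EFinP; exact: measurable_funM.
move=> y _ /=; rewrite lee_fin normrM (@ger0_norm _ (_ + _)); last first.
  by rewrite addr_ge0// sqr_ge0.
rewrite -[y ^+ 2]real_normK ?num_real// -[T y ^+ 2]real_normK ?num_real//.
have := normr_ge0 y; have := normr_ge0 (T y); nra.
Qed.

(** As [p] has density [g * w] for the Lebesgue measure, the left side is at most the integral of
    [w (T z)] over the good [z]. By [tailE] and the layer-cake formula with [r] equal to [T], this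
    is the right side. *)
Let jacobian_bound : p.-integrable setT (fun y => (y ^+ 2)%:E) ->
  (\int[p]_y (jacobian y)%:E <= \int[p]_y (y * T y)%:E)%E.
Proof.
move=> i2; have [mg g0 _] := pg.
have mJ1 : measurable_fun setT (fun y => (if good y then jacobian y else 0)%:E).
  apply/measurable_EFinP; apply: measurable_fun_ifT => //.
  exact: measurable_jacobian.
have mE1 : measurable_fun setT
    (fun y => (if good y then expR ((y ^+ 2 - T y ^+ 2) / 2) else 0)%:E).
  by apply/measurable_EFinP; apply: measurable_fun_ifT.
have mJ : measurable_fun setT (fun y => (jacobian y)%:E).
  by apply/measurable_EFinP; exact: measurable_jacobian.
rewrite (_ : \int[p]_y (jacobian y)%:E =
    \int[p]_y (if good y then jacobian y else 0)%:E)%E; last first.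
  apply: ae_eq_integral => //.
  apply: ae_imp (cumul_gt0_lt1_ae p_atomless) => y gy _.
  by rewrite /good gy.
rewrite (ge0_integral_density (m := NP) pg)//; last first.
  by move=> y; rewrite lee_fin; case: ifP => // _; exact: jacobian_ge0.
apply: (@le_trans _ _ (\int[NP]_y
    (if good y then expR ((y ^+ 2 - T y ^+ 2) / 2) else 0)%:E)%E).
  apply: ge0_le_integral => //.
  - move=> y _; rewrite mule_ge0 ?lee_fin//.
    by case: ifP => // _; exact: jacobian_ge0.
  - by apply: emeasurable_funM => //; exact/measurable_EFinP.
  - move=> y _; rewrite -EFinM lee_fin; case: ifP => _; rewrite ?mul0r//.
    (* Where [g] vanishes the left side does too, while the exponential stays positive: hence an
       inequality and not an identity. *)
    rewrite /jacobian; have [->|gy] := eqVneq (g y) 0.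
      by rewrite mulr0 expR_ge0.
    by rewrite mulfVK.
rewrite (ge0_integral_density (m := lebesgue) (normal_has_density (1 : R)))//; last first.
  by move=> y; rewrite lee_fin; case: ifP => // _; exact: expR_ge0.
rewrite (integral_id_mul mT T_integrable (yT_integrable i2)); last first.
  rewrite (integral_rearrange p_atomless NP (h := EFin))//.
  exact: normal_mean.
under [leRHS]eq_integral do rewrite tailE.
rewrite le_eqVlt; apply/orP; left; apply/eqP; apply: eq_integral => y _.
rewrite -EFinM; case: ifP => _; rewrite ?mul0r// !normal_pdf0E//; congr EFin.
by rewrite mulrCA -expRD; congr (_ * expR _); rewrite expr1n; field.
Qed.

(** The square is expanded and [jacobian_bound] applied to the cross term. An infinite second moment
    is allowed because the inequality will be used for every conditional law, whose moments are not
    controlled. *)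
Lemma one_dimensional_transport :
  (2%:E * (\int[p]_y (jacobian y)%:E) + \int[p]_y ((y - T y) ^+ 2)%:E
    <= 1 + \int[p]_y (y ^+ 2)%:E)%E.
Proof.
have mT2 : measurable_fun setT (fun y : R => ((y ^+ 2)%:E : \bar R)).
  by apply/measurable_EFinP; exact: measurable_funX.
have [ioo|] := eqVneq (\int[p]_y (y ^+ 2)%:E)%E +oo%E.
  by rewrite ioo addey// leey.
rewrite -ltey => ioo.
have i2 : p.-integrable setT (fun y => (y ^+ 2)%:E).
  apply/integrableP; split => //.
  by under eq_integral do rewrite /= ger0_norm ?sqr_ge0//.
have iyT := yT_integrable i2.
rewrite (_ : \int[p]_y ((y - T y) ^+ 2)%:E =
   \int[p]_y (y ^+ 2)%:E + 1 - 2%:E * \int[p]_y (y * T y)%:E)%E; last first.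
  rewrite -T2_integral -integralD// -integralZl// -integralB//; last 2 first.
  - exact: integrableD.
  - exact: integrableZl.
  by apply: eq_integral => y _ /=; rewrite -EFinD; congr EFin; ring.
have := jacobian_bound i2.
have J0 : (0 <= \int[p]_y (jacobian y)%:E)%E.
  by apply: integral_ge0 => y _; rewrite lee_fin jacobian_ge0.
have /fineK <- := integrable_fin_num measurableT i2.
have /fineK <- := integrable_fin_num measurableT iyT.
set a := fine _; set b := fine _ => h.
have Jfin : (\int[p]_y (jacobian y)%:E)%E \is a fin_num.
  by rewrite ge0_fin_numE// (le_lt_trans h) ?ltry.
move: h; rewrite -(fineK Jfin) lee_fin; set j := fine _ => h.
by rewrite -!EFinM -!EFinD lee_fin; lra.
Qed.

End one_dimensional_transport.

(** * Triangular couplings *)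

Section conditional_transport.
Context (R : realType) d (S : measurableType d).
Local Notation X := (measurableTypeR R).
Let N : probability X R := normal_prob (0 : R) 1.
Variables (gam : probability S R) (nu : probability (X * S)%type R).
Variable f : X * S -> R.
Let NG : probability (X * S)%type R := (N \x gam)%E.
Hypothesis nuf : has_density nu NG f.

Let mf : measurable_fun setT f. Proof. by case: nuf. Qed.
Let f0 z : 0 <= f z. Proof. by case: nuf. Qed.

Let F1 (t : S) : \bar R := (\int[N]_y (f (y, t))%:E)%E.

Let mF1 : measurable_fun setT F1.
Proof.
apply: (@measurable_fun_fubini_tonelli_G _ _ X S R N (fun z => (f z)%:E)).
  exact/measurable_EFinP.
by move=> z; rewrite lee_fin.
Qed.

Let F1_ge0 t : (0 <= F1 t)%E.
Proof. by apply: integral_ge0 => y _; rewrite lee_fin. Qed.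

Let F1_int : (\int[gam]_t F1 t = 1)%E.
Proof.
rewrite /F1 -(@fubini_tonelli2 _ _ X S R N gam (fun z => (f z)%:E)).
- by rewrite -(density_integral1 (m := NG) nuf); exact: eq_measure_integral.
- exact/measurable_EFinP.
- by move=> z; rewrite lee_fin.
Qed.

(** The integral may be infinite on a [gam]-null set, where [fine] returns 0. *)
Definition marginal_density (t : S) : R := fine (F1 t).
Let f' := marginal_density.

Lemma measurable_marginal_density : measurable_fun setT f'.
Proof. exact: measurableT_comp mF1. Qed.

Lemma marginal_density_ge0 t : 0 <= f' t. Proof. exact: fine_ge0. Qed.

Let F1_fin : {ae gam, forall t, F1 t \is a fin_num}.
Proof.
have : gam.-integrable setT F1.
  apply/integrableP; split => //.
  by under eq_integral do rewrite gee0_abs//; rewrite F1_int ltry.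
by move=> /(integrable_ae measurableT); apply: ae_imp => t; apply.
Qed.

Lemma ex_marginal : exists nu' : probability S R, has_density nu' gam f'.
Proof.
apply: ex_density.
- exact: measurable_marginal_density.
- exact: marginal_density_ge0.
rewrite -F1_int; apply: ae_eq_integral => //.
  exact/measurable_EFinP/measurable_marginal_density.
by apply: ae_imp F1_fin => t Ft _; rewrite fineK.
Qed.

(* With this default value, [g t] is a probability density for every [t]. *)
Let g (t : S) (y : X) : R := if 0 < f' t then f (y, t) / f' t else 1.

Let g0 t y : 0 <= g t y.
Proof. by rewrite /g; case: ifPn => // ft; exact: divr_ge0 (f0 _) (ltW ft). Qed.

Let mg2 : measurable_fun setT (fun z : S * X => g z.1 z.2).
Proof.
have mf1 : measurable_fun setT (fun z : S * X => f' z.1).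
  exact: (measurableT_comp measurable_marginal_density).
apply: measurable_fun_ifT.
- exact: measurable_fun_ltr.
- apply: measurable_funM.
    apply: (measurableT_comp mf); exact: measurable_fun_pair.
  by apply: ge0_measurable_funV => // z; exact: marginal_density_ge0.
- exact: measurable_cst.
Qed.

Let mg t : measurable_fun setT (g t).
Proof. exact: (measurableT_comp mg2 (pair1_measurable t)). Qed.

Let g1 t : (\int[N]_y (g t y)%:E = 1)%E.
Proof.
have [ft|/negbTE ft] := boolP (0 < f' t); last first.
  under eq_integral do rewrite /g ft.
  by rewrite integral_cst//= probability_setT mule1.
have Ffin : F1 t \is a fin_num.
  by move: ft; rewrite /f' /marginal_density; case: (F1 t) => //=; rewrite ltxx.
under eq_integral do rewrite /g ft mulrC EFinM.
rewrite ge0_integralZl//.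
- by rewrite -/(F1 t) -(fineK Ffin) -EFinM mulVf// gt_eqF.
- apply/measurable_EFinP; exact: (measurableT_comp mf (pair2_measurable t)).
- by move=> y _; rewrite lee_fin.
- by rewrite lee_fin invr_ge0 ltW.
Qed.

(** The laws are selected separately for each [t]. Measurability in [t] is never asked of this
    selection, only of integrals against the jointly measurable [g]. *)
Let p (t : S) : probability X R := sval (cid (ex_density (mg t) (g0 t) (g1 t))).

Let pg t : has_density (p t) N (g t).
Proof. by rewrite /p; case: cid. Qed.

Let T (t : S) (y : X) : R := rearrange (p t) N y.

Let mT : measurable_fun setT (fun z : S * X => T z.1 z.2).
Proof.
apply: (measurableT_comp (measurable_quantile N)).
(* The conditional distribution function is a parameter integral of [g], which is where joint
   measurability comes from. *)
rewrite (_ : (fun z : S * X => _) = fine \o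
  (fun z : S * X => \int[N]_v (if v <= z.2 then g z.1 v else 0)%:E)%E).
  apply: measurableT_comp => //.
  apply: (@measurable_fun_fubini_tonelli_F _ _ (S * X)%type X R N
    (fun zv => (if zv.2 <= zv.1.2 then g zv.1.1 zv.2 else 0)%:E)).
    apply/measurable_EFinP; apply: measurable_fun_ifT => //.
      apply: measurable_fun_ler => //.
      by apply: measurableT_comp.
    apply: (@measurableT_comp _ _ _ _ _ _ _ setT
      (fun zv : S * X * X => (zv.1.1, zv.2)) mg2).
    apply: measurable_fun_pair => //.
    by apply: measurableT_comp.
  by move=> zv; rewrite lee_fin; case: ifP.
apply/funext => -[t y] /=; rewrite /cumul; congr fine.
have [_ _ ->//] := pg t.
rewrite integral_mkcond; apply: eq_integral => v _; rewrite patchE.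
by rewrite mem_setE in_itv/=; case: ifP.
Qed.
Section extension.
Variables (nu' : probability S R) (pi' : probability (S * S)%type R).
Hypothesis nuf' : has_density nu' gam f'.
Hypothesis pi'_fst : forall A, measurable A -> pi' (fst @^-1` A) = gam A.
Hypothesis pi'_snd : forall A, measurable A -> pi' (snd @^-1` A) = nu' A.

Let PN : probability ((S * S) * X)%type R := (pi' \x N)%E.
Let G (w : (S * S) * X) : R := g w.1.2 w.2.

Let mG : measurable_fun setT G.
Proof.
apply: (@measurableT_comp _ _ _ _ _ _ _ setT
  (fun w : (S * S) * X => (w.1.2, w.2)) mg2).
by apply: measurable_fun_pair => //; exact: measurableT_comp.
Qed.

Let G1 : (\int[PN]_w (G w)%:E = 1)%E.
Proof.
rewrite (@product_probability_tonelli1 _ _ _ _ _ pi' N (EFin \o G))//; last 2 first.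
- exact/measurable_EFinP.
- by move=> w; rewrite lee_fin; exact: g0.
under eq_integral do rewrite /G/= g1.
by rewrite integral_cst//= probability_setT mule1.
Qed.

(** Under [rho] the pair of tails [(u, t)] follows [pi'] and, given this pair, the head [y] follows
    the conditional law [p t]. *)
Let rho : probability ((S * S) * X)%type R :=
  sval (cid (ex_density mG (fun w => g0 w.1.2 w.2) G1)).

Let rhoG : has_density rho PN G. Proof. by rewrite /rho; case: cid. Qed.

(** The transported head [T t y] joins the Gaussian tail [u], and the head [y] joins the tail [t] on
    which it was conditioned. *)
Let Psi (w : (S * S) * X) : (X * S) * (X * S) :=
  ((T w.1.2 w.2, w.1.1), (w.2, w.1.2)).

Let mPsi : measurable_fun setT Psi.
Proof.
apply: measurable_fun_pair; apply: measurable_fun_pair.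
- apply: (@measurableT_comp _ _ _ _ _ _ _ setT
    (fun w : (S * S) * X => (w.1.2, w.2)) mT).
  by apply: measurable_fun_pair => //; exact: measurableT_comp.
- exact: measurableT_comp.
- exact: measurable_snd.
- exact: measurableT_comp.
Qed.

Let PsiF : {mfun ((S * S) * X)%type >-> ((X * S) * (X * S))%type} :=
  mfun_Sub (mem_set mPsi).

Definition triangular_coupling : probability ((X * S) * (X * S))%type R :=
  distribution rho PsiF.
Let pi := triangular_coupling.

Let integral_pi (h : (X * S) * (X * S) -> \bar R) : measurable_fun setT h ->
  (forall z, (0 <= h z)%E) ->
  (\int[pi]_z h z = \int[pi']_ut \int[p ut.2]_y h (Psi (ut, y)))%E.
Proof.
move=> mh h0; have mhPsi : measurable_fun setT (h \o Psi).
  exact: measurableT_comp mPsi.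
have mEG : measurable_fun setT (EFin \o G) by exact/measurable_EFinP.
rewrite ge0_integral_distribution//.
rewrite (ge0_integral_density (m := PN) rhoG)//; last by move=> w /=.
rewrite (@product_probability_tonelli1 _ _ _ _ _ pi' N
  (fun w => h (Psi w) * (G w)%:E)%E)//.
- apply: eq_integral => -[u t] _.
  rewrite (ge0_integral_density (m := N) (pg t))//.
  exact: (measurableT_comp mhPsi (pair1_measurable (u, t))).
- exact: emeasurable_funM.
- by move=> w; rewrite mule_ge0// lee_fin; exact: g0.
Qed.

Lemma integral_triangular_coupling_tail (h : S * S -> \bar R) :
  measurable_fun setT h -> (forall z, (0 <= h z)%E) ->
  (\int[pi]_z h (z.1.2, z.2.2) = \int[pi']_ut h ut)%E.
Proof.
move=> mh h0; rewrite (integral_pi (h := fun z => h (z.1.2, z.2.2)))//.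
  apply: eq_integral => -[u t] _ /=.
  by rewrite integral_cst//= probability_setT mule1.
apply: (@measurableT_comp _ _ _ _ _ _ _ setT
  (fun z : (X * S) * (X * S) => (z.1.2, z.2.2)) mh).
by apply: measurable_fun_pair; exact: measurableT_comp.
Qed.

(** Given [(u, t)], the head [T t y] is standard normal whatever [t] is; the inner integral
    therefore depends on [u] alone, and [u] has law [gam]. *)
Lemma triangular_coupling_fst A : measurable A -> pi (fst @^-1` A) = (N \x gam)%E A.
Proof.
move=> mA; have mI : measurable_fun setT (fun z : X * S => (\1_A z)%:E : \bar R).
  exact/measurable_EFinP/measurable_indic.
have mA' : measurable ((fst : (X * S) * (X * S) -> X * S) @^-1` A).
  by rewrite -[X in measurable X]setTI; exact: measurable_fst.
rewrite -(probability_indic pi mA') -[RHS]/(NG A) -(probability_indic NG mA).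
rewrite (integral_pi (h := fun z => (\1_A z.1)%:E))//; last first.
  exact: (measurableT_comp mI measurable_fst).
rewrite (@product_probability_tonelli2 _ _ _ _ _ N gam (fun z => (\1_A z)%:E))//.
rewrite -(ge0_integral_image measurable_fst pi'_fst)//=; last 2 first.
- exact: (@measurable_fun_fubini_tonelli_G _ _ X S R N (fun z => (\1_A z)%:E)).
- by move=> u; apply: integral_ge0.
apply: eq_integral => -[u t] _ /=.
rewrite (@ge0_integral_rearrange _ (p t) (density_normal_atomless (pg t)) N
  (fun v => (\1_A (v, u))%:E))//.
exact: (measurableT_comp mI (pair2_measurable u)).
Qed.

Let measurable_inner (h : (X * S) * (X * S) -> \bar R) : measurable_fun setT h ->
  (forall z, (0 <= h z)%E) ->
  measurable_fun setT (fun ut => \int[p ut.2]_y h (Psi (ut, y)))%E.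
Proof.
move=> mh h0; have mhPsi : measurable_fun setT (h \o Psi).
  exact: measurableT_comp mPsi.
rewrite (_ : (fun _ => _) =
    (fun ut => \int[N]_y (h (Psi (ut, y)) * (G (ut, y))%:E))%E); last first.
  apply/funext => -[u t]; rewrite (ge0_integral_density (m := N) (pg t))//.
  exact: (measurableT_comp mhPsi (pair1_measurable (u, t))).
apply: (@measurable_fun_fubini_tonelli_F _ _ (S * S)%type X R N
  (fun w => h (Psi w) * (G w)%:E)%E).
  by apply: emeasurable_funM => //; exact/measurable_EFinP.
by move=> w; rewrite mule_ge0// lee_fin; exact: g0.
Qed.

(** This is the disintegration of [nu], with the factor [f' t] multiplied out so as to cover the
    case [f' t = 0]: there [f (y, t)] vanishes for almost every [y], provided that the marginal
    integral is finite. *)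
Let conditional_density_ae (h : X * S -> \bar R) : measurable_fun setT h ->
  (forall z, (0 <= h z)%E) ->
  {ae gam, forall t, (\int[p t]_y h (y, t) * (f' t)%:E =
                      \int[N]_y (h (y, t) * (f (y, t))%:E))%E}.
Proof.
move=> mh h0; apply: ae_imp F1_fin => t Ffin.
have mht : measurable_fun setT (fun y => h (y, t)).
  exact: (measurableT_comp mh (pair2_measurable t)).
have mft : measurable_fun setT (fun y => (f (y, t))%:E : \bar R).
  by apply/measurable_EFinP; exact: (measurableT_comp mf (pair2_measurable t)).
have [ft|ft] := boolP (0 < f' t).
  rewrite (ge0_integral_density (m := N) (pg t))//.
  rewrite -ge0_integralZr//.
  - apply: eq_integral => y _; rewrite -muleA -EFinM /g ft mulfVK//.
    by rewrite gt_eqF.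
  - by apply: emeasurable_funM => //; exact/measurable_EFinP.
  - by move=> y _; rewrite mule_ge0// lee_fin.
  - by rewrite lee_fin ltW.
have ft0 : f' t = 0 by apply/eqP; rewrite eq_le marginal_density_ge0 andbT leNgt.
have F10 : F1 t = 0%E by rewrite -(fineK Ffin) -[fine _]/(f' t) ft0.
rewrite ft0 mule0; apply/esym.
transitivity (\int[N]_y (0 : \bar R))%E; last by rewrite integral0.
have : ae_eq N setT (fun y => (f (y, t))%:E) (cst 0%E).
  apply/(ae_eq_integral_abs N measurableT mft).
  by under eq_integral do rewrite gee0_abs ?lee_fin//.
move=> f00; apply: ae_eq_integral => //; first exact: emeasurable_funM.
by apply: ae_imp f00 => y /(_ I) /= -> _; rewrite mule0.
Qed.

Lemma integral_triangular_coupling_snd (h : X * S -> \bar R) :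
  measurable_fun setT h -> (forall z, (0 <= h z)%E) ->
  (\int[pi]_z h z.2 = \int[nu]_y h y)%E.
Proof.
move=> mh h0.
have mh2 : measurable_fun setT (fun z : (X * S) * (X * S) => h z.2).
  exact: (measurableT_comp mh measurable_snd).
rewrite (integral_pi (h := fun z => h z.2))//=.
have mphi : measurable_fun setT (fun t => \int[p t]_y h (y, t))%E.
  apply: (@measurableT_comp _ _ _ _ _ _ _ setT (fun t : S => (t, t))
    (measurable_inner mh2 (fun z => h0 z.2))).
  exact: measurable_fun_pair.
rewrite (ge0_integral_image measurable_snd pi'_snd
  (h := fun t => \int[p t]_y h (y, t))%E)//; last first.
  by move=> t; exact: integral_ge0.
rewrite (ge0_integral_density (m := gam) nuf')//; last first.
  by move=> t; exact: integral_ge0.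
rewrite (ge0_integral_density (m := NG) nuf)//.
rewrite (@product_probability_tonelli2 _ _ _ _ _ N gam
  (fun z => h z * (f z)%:E)%E); last 2 first.
- by apply: emeasurable_funM => //; exact/measurable_EFinP.
- by move=> z; rewrite mule_ge0// lee_fin.
apply: ae_eq_integral => //.
- apply: emeasurable_funM => //.
  exact/measurable_EFinP/measurable_marginal_density.
- apply: (@measurable_fun_fubini_tonelli_G _ _ X S R N
    (fun z => h z * (f z)%:E)%E).
    by apply: emeasurable_funM => //; exact/measurable_EFinP.
  by move=> z; rewrite mule_ge0// lee_fin.
- by apply: ae_imp (conditional_density_ae mh h0) => t ht _.
Qed.

Definition triangular_jacobian (y : X * S) : R :=
  jacobian (p y.2) (g y.2) y.1.
Let J := triangular_jacobian.

Lemma triangular_jacobian_ge0 y : 0 <= J y.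
Proof. exact: jacobian_ge0 (pg _) _. Qed.

Let swapXS (y : X * S) : S * X := (y.2, y.1).

Let mswapXS : measurable_fun setT swapXS.
Proof. exact: measurable_fun_pair. Qed.

Let mTs : measurable_fun setT (fun y : X * S => T y.2 y.1).
Proof. exact: (@measurableT_comp _ _ _ _ _ _ _ setT swapXS mT). Qed.

Let mgs : measurable_fun setT (fun y : X * S => g y.2 y.1).
Proof. exact: (@measurableT_comp _ _ _ _ _ _ _ setT swapXS mg2). Qed.

Lemma measurable_triangular_jacobian : measurable_fun setT J.
Proof.
apply: measurable_funM; last exact: ge0_measurable_funV.
apply: measurableT_comp => //; apply: measurable_funM => //.
by apply: measurable_funB; exact: measurable_funX.
Qed.

(** Each side is gathered into the integral over [pi] of a single nonnegative function, so that the
    one-dimensional inequality for [p t] can be applied under the outer integral over [(u, t)]. *)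
Lemma triangular_coupling_cost :
  (2%:E * (\int[pi]_z (J z.2)%:E) + \int[pi]_z ((z.2.1 - z.1.1) ^+ 2)%:E
    <= 1 + \int[nu]_y (y.1 ^+ 2)%:E)%E.
Proof.
have m2 : measurable_fun setT (fun y : X * S => (y.1 ^+ 2)%:E : \bar R).
  by apply/measurable_EFinP; exact: measurable_funX.
have m22 : measurable_fun setT
    (fun z : (X * S) * (X * S) => (z.2.1 ^+ 2)%:E : \bar R).
  exact: (measurableT_comp m2 measurable_snd).
have mJ : measurable_fun setT (fun z : (X * S) * (X * S) => (J z.2)%:E : \bar R).
  apply/measurable_EFinP.
  exact: (measurableT_comp measurable_triangular_jacobian measurable_snd).
have md : measurable_fun setT
    (fun z : (X * S) * (X * S) => ((z.2.1 - z.1.1) ^+ 2)%:E : \bar R).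
  apply/measurable_EFinP; apply: measurable_funX; apply: measurable_funB;
    exact: measurableT_comp.
rewrite -(integral_triangular_coupling_snd m2); last first.
  by move=> y; rewrite lee_fin sqr_ge0.
pose h (z : (X * S) * (X * S)) :=
  (2%:E * (J z.2)%:E + ((z.2.1 - z.1.1) ^+ 2)%:E)%E : \bar R.
pose k (z : (X * S) * (X * S)) := (1 + (z.2.1 ^+ 2)%:E)%E : \bar R.
have J0 z : (0 <= (J z)%:E)%E by rewrite lee_fin triangular_jacobian_ge0.
have h0 z : (0 <= h z)%E.
  by rewrite /h adde_ge0 ?mule_ge0// lee_fin sqr_ge0.
have k0 z : (0 <= k z)%E by rewrite /k adde_ge0// lee_fin sqr_ge0.
have mh : measurable_fun setT h.
  by apply: emeasurable_funD => //; exact: emeasurable_funM.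
have mk : measurable_fun setT k by exact: emeasurable_funD.
have -> : (2%:E * (\int[pi]_z (J z.2)%:E) +
    \int[pi]_z ((z.2.1 - z.1.1) ^+ 2)%:E = \int[pi]_z h z)%E.
  rewrite -ge0_integralZl// -ge0_integralD//.
  - by move=> z _; rewrite mule_ge0.
  - exact: emeasurable_funM.
  - by move=> z _; rewrite lee_fin sqr_ge0.
have -> : (1 + \int[pi]_z (z.2.1 ^+ 2)%:E = \int[pi]_z k z)%E.
  rewrite ge0_integralD//.
    by rewrite integral_cst//= probability_setT mule1.
  by move=> z _; rewrite lee_fin sqr_ge0.
rewrite (integral_pi mh h0) (integral_pi mk k0).
apply: ge0_le_integral => //.
- by move=> ut _; exact: integral_ge0.
- exact: measurable_inner.
- exact: measurable_inner.
move=> [u t] _ /=.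
have mJt : measurable_fun setT (fun y => (jacobian (p t) (g t) y)%:E).
  by apply/measurable_EFinP; exact: measurable_jacobian (pg t).
have mT2t : measurable_fun setT (fun y : X => ((y - T t y) ^+ 2)%:E : \bar R).
  apply/measurable_EFinP; apply: measurable_funX; apply: measurable_funB => //.
  exact: measurable_rearrange.
have my2 : measurable_fun setT (fun y : X => (y ^+ 2)%:E : \bar R).
  by apply/measurable_EFinP; exact: measurable_funX.
rewrite /h /k /Psi /= ge0_integralD//; last 3 first.
- by move=> y _; rewrite mule_ge0.
- exact: emeasurable_funM.
- by move=> y _; rewrite lee_fin sqr_ge0.
rewrite ge0_integralZl//.
rewrite ge0_integralD//; last by move=> y _; rewrite lee_fin sqr_ge0.
rewrite integral_cst//= probability_setT mule1.
exact: one_dimensional_transport (pg t).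
Qed.

(** Along the coupling [z.1.1] is the transported head, so the definition of the Jacobian can be
    solved for [g], and [f] is [f'] times [g]. The divisions are legitimate because a density is
    positive almost everywhere for the law that it defines. *)
Lemma triangular_coupling_density_ae : {ae pi, forall z,
  0 < J z.2 /\
  f z.2 = f' z.2.2 * (expR ((z.2.1 ^+ 2 - z.1.1 ^+ 2) / 2) / J z.2)}.
Proof.
pose Bad := [set z : (X * S) * (X * S) | (J z.2 <= 0) ||
  (f z.2 != f' z.2.2 * (expR ((z.2.1 ^+ 2 - z.1.1 ^+ 2) / 2) / J z.2))].
have mJ : measurable_fun setT (fun z : (X * S) * (X * S) => J z.2).
  exact: (measurableT_comp measurable_triangular_jacobian measurable_snd).
have mbad : measurable_fun setT (fun z : (X * S) * (X * S) => (J z.2 <= 0) ||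
  (f z.2 != f' z.2.2 * (expR ((z.2.1 ^+ 2 - z.1.1 ^+ 2) / 2) / J z.2))).
  apply: measurable_or.
    exact: measurable_fun_ler.
  apply: measurable_neg; apply: measurable_fun_eqr.
    exact: (measurableT_comp mf measurable_snd).
  apply: measurable_funM.
    by apply: (measurableT_comp measurable_marginal_density); exact: measurableT_comp.
  apply: measurable_funM; last first.
    by apply: ge0_measurable_funV => // z; exact: triangular_jacobian_ge0.
  apply: measurableT_comp => //; apply: measurable_funM => //.
  by apply: measurable_funB; apply: measurable_funX; exact: measurableT_comp.
have mBad : measurable Bad by rewrite -[X in measurable X]setTI; exact: mbad.
exists Bad; split => //; last first.
  move=> z /= h; apply/negPn/negP => /norP[]; rewrite -ltNge => Jz /negPn/eqP fz.
  exact: h.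
suff : rho (Psi @^-1` Bad) = 0%E by [].
have mPB : measurable (Psi @^-1` Bad).
  by rewrite -[X in measurable X]setTI; exact: mPsi.
apply/(negligibleP rho mPB).
have G_gt0 := density_gt0_ae (m := PN) rhoG.
(* Here only the tail [t] matters; its law is [nu'], which has density [f']. *)
have f'_gt0 : {ae rho, forall w, 0 < f' w.1.2}.
  have mf'0 : measurable [set t | f' t <= 0].
    rewrite -[X in measurable X]setTI.
    exact: (measurable_fun_ler measurable_marginal_density (measurable_cst _)).
  have nu'0 : nu' [set t | f' t <= 0] = 0%E.
    apply/(negligibleP nu' mf'0).
    apply: negligibleS (density_gt0_ae (m := gam) nuf') => t /= ft.
    by apply/negP; rewrite -leNgt.
  have mf'1 : measurable_fun setT (fun w : (S * S) * X => f' w.1.2).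
    by apply: (measurableT_comp measurable_marginal_density); exact: measurableT_comp.
  have mf'2 : measurable_fun setT (fun z : (X * S) * (X * S) => f' z.2.2).
    by apply: (measurableT_comp measurable_marginal_density); exact: measurableT_comp.
  pose D := [set w : (S * S) * X | f' w.1.2 <= 0].
  have mD : measurable D.
    rewrite -[X in measurable X]setTI.
    exact: (measurable_fun_ler mf'1 (measurable_cst _)).
  exists D; split => //; last by move=> w /negP; rewrite -leNgt.
  pose h (ut : S * S) : \bar R := (\1_[set t | f' t <= 0] ut.2)%:E.
  have mh : measurable_fun setT h.
    have mI : measurable_fun setT (fun t => (\1_[set t | f' t <= 0] t)%:E : \bar R).
      exact/measurable_EFinP/measurable_indic.
    exact: (measurableT_comp mI measurable_snd).
  have mD' : measurable [set z : (X * S) * (X * S) | f' z.2.2 <= 0].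
    rewrite -[X in measurable X]setTI.
    exact: (measurable_fun_ler mf'2 (measurable_cst _)).
  transitivity (pi [set z | f' z.2.2 <= 0]); first by [].
  rewrite -(probability_indic pi mD').
  transitivity (\int[pi]_z h (z.1.2, z.2.2))%E; first by [].
  rewrite integral_triangular_coupling_tail//; last first.
    by move=> ut; rewrite lee_fin.
  rewrite (ge0_integral_image measurable_snd pi'_snd
    (h := fun t => (\1_[set t | f' t <= 0] t)%:E))//.
  - by rewrite probability_indic.
  - exact/measurable_EFinP/measurable_indic.
apply: negligibleS (negligibleU G_gt0 f'_gt0) => -[[u t] y] /= bad.
apply/not_andP => -[]; rewrite /G/= => gt ft.
move: bad; rewrite /Bad/= /Psi/= /J /triangular_jacobian/= /jacobian -/(T t y).
have gE : g t y = f (y, t) / f' t by rewrite /g ft.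
rewrite leNgt divr_gt0 ?expR_gt0//= => /negP; apply; apply/eqP.
set e := expR _; have e0 : e != 0 by rewrite gt_eqF// expR_gt0.
rewrite (_ : e / (e / g t y) = g t y); last by field; rewrite e0 gt_eqF.
by rewrite gE mulrC mulfVK// gt_eqF.
Qed.

End extension.
End conditional_transport.

(** * Induction on the number of coordinates *)

Section tuple_coupling.
Context (R : realType).
Local Notation X := (measurableTypeR R).

Definition uncons (n : nat) (t : n.+1.-tuple X) : X * n.-tuple X :=
  (tnth t ord0, [tuple of behead t]).

Lemma cons_pairK n : cancel (@cons_pair R n) (@uncons n).
Proof.
move=> [x t]; rewrite /uncons /cons_pair /= tnth0; congr (_, _).
by apply/val_inj.
Qed.

Lemma unconsK n : cancel (@uncons n) (@cons_pair R n).
Proof.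
by move=> t; rewrite [RHS](tuple_eta t); apply/val_inj.
Qed.

Lemma measurable_uncons n : measurable_fun setT (@uncons n).
Proof.
by apply: measurable_fun_pair; [exact: measurable_tnth|exact: measurable_behead].
Qed.

Definition sqdist (n : nat) (x y : n.-tuple X) : R :=
  \sum_(i < n) (tnth x i - tnth y i) ^+ 2.

Definition sqlen (n : nat) (x : n.-tuple X) : R := \sum_(i < n) tnth x i ^+ 2.

Lemma sqdist_cons n (x y : X * n.-tuple X) :
  sqdist (cons_pair x) (cons_pair y) = (y.1 - x.1) ^+ 2 + sqdist x.2 y.2.
Proof.
rewrite /sqdist big_ord_recl !tnth0 -sqrrN opprB; congr (_ + _).
by apply: eq_bigr => i _; rewrite !tnthS.
Qed.

Lemma sqlen_cons n (x : X * n.-tuple X) :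
  sqlen (cons_pair x) = x.1 ^+ 2 + sqlen x.2.
Proof.
rewrite /sqlen big_ord_recl !tnth0; congr (_ + _).
by apply: eq_bigr => i _; rewrite !tnthS.
Qed.

Lemma sqlen_ge0 n (x : n.-tuple X) : 0 <= sqlen x.
Proof. by apply: sumr_ge0 => i _; exact: sqr_ge0. Qed.

Lemma sqdist_ge0 n (x y : n.-tuple X) : 0 <= sqdist x y.
Proof. by apply: sumr_ge0 => i _; exact: sqr_ge0. Qed.

Lemma measurable_sqlen n : measurable_fun setT (@sqlen n).
Proof.
by apply: measurable_sum => i; apply: measurable_funX; exact: measurable_tnth.
Qed.

Lemma measurable_sqdist n :
  measurable_fun setT (fun z : n.-tuple X * n.-tuple X => sqdist z.1 z.2).
Proof.
apply: measurable_sum => i; apply: measurable_funX; apply: measurable_funB.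
  exact: (measurableT_comp (measurable_tnth i) measurable_fst).
exact: (measurableT_comp (measurable_tnth i) measurable_snd).
Qed.

(* The lower bound on the density is the exponential of
   [- ln f y + (|y|^2 - |x|^2) / 2 <= K / lam - n (1 - ln lam)]; stated in this
   form, it requires no integrability along the induction. *)
Definition tuple_coupling (lam : R) n (f : n.-tuple X -> R)
    (nu : probability (n.-tuple X) R)
    (pi : probability (n.-tuple X * n.-tuple X)%type R)
    (K : n.-tuple X * n.-tuple X -> R) :=
  [/\ forall A, measurable A -> pi (fst @^-1` A) = gaussian_tuple n A,
      forall A, measurable A -> pi (snd @^-1` A) = nu A,
      measurable_fun setT K /\ (forall z, 0 <= K z),
      {ae pi, forall z, expR ((sqlen z.2 - sqlen z.1) / 2 +
        n%:R * (1 - ln lam) - K z / lam) <= f z.2} &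
      (2%:E * (\int[pi]_z (K z)%:E) + \int[pi]_z (sqdist z.1 z.2)%:E <=
       n%:R%:E + \int[nu]_y (sqlen y)%:E)%E].

(** The space has one point, where the density must be 1; there is no Jacobian yet, so [K] is 0. *)
Lemma ex_tuple_coupling0 (lam : R) (f : 0.-tuple X -> R)
    (nu : probability (0.-tuple X) R) :
  has_density nu (gaussian_tuple 0) f -> exists pi K, tuple_coupling lam f nu pi K.
Proof.
move=> nuf.
exists (gaussian_tuple 0 \x nu)%E, (cst 0); split => //.
- by move=> A mA; exact: product_probability_fst.
- by move=> A mA; exact: product_probability_snd.
- apply: aeW => -[x y] /=; rewrite (tuple0 x) (tuple0 y).
  have [mf f0 _] := nuf.
  have := density_integral1 (m := gaussian_tuple 0) nuf.
  rewrite integral_dirac//; last exact/measurable_EFinP.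
  rewrite diracE in_setT mul1e => -[->].
  by rewrite subrr !mul0r add0r subrr expR0.
- under eq_integral do rewrite /cst.
  rewrite integral0 mule0 add0e add0e.
  under eq_integral do rewrite /sqdist big_ord0.
  rewrite integral0; apply: integral_ge0 => y _.
  by rewrite lee_fin sqlen_ge0.
Qed.

(** The induction hypothesis couples the tails, and the head is then coupled conditionally on them;
    [K] accumulates the Jacobians. *)
Lemma ex_tuple_couplingS (lam : R) n (f : n.+1.-tuple X -> R)
    (nu : probability (n.+1.-tuple X) R) : 0 < lam ->
  (forall (f' : n.-tuple X -> R) (nu' : probability (n.-tuple X) R),
    has_density nu' (gaussian_tuple n) f' ->
    exists pi K, tuple_coupling lam f' nu' pi K) ->
  has_density nu (gaussian_tuple n.+1) f -> exists pi K, tuple_coupling lam f nu pi K.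
Proof.
move=> lam0 IH nuf; have [mf f0 nuE] := nuf.
pose fc := f \o @cons_pair R n.
pose unconsF : {mfun n.+1.-tuple X >-> (X * n.-tuple X)%type} :=
  mfun_Sub (mem_set (@measurable_uncons n)).
pose nuc : probability (X * n.-tuple X)%type R := distribution nu unconsF.
pose NG : probability (X * n.-tuple X)%type R :=
  (normal_prob (0 : R) 1 \x gaussian_tuple n)%E.
have mfc : measurable_fun setT fc by exact: measurableT_comp mf _.
have nucf : has_density nuc NG fc.
  split => [//|z|A mA]; first exact: f0.
  have mA' : measurable (@uncons n @^-1` A).
    by rewrite -[X in measurable X]setTI; exact: measurable_uncons.
  transitivity (nu (@uncons n @^-1` A)); first by [].
  rewrite -(probability_indic nu mA').
  have mI : measurable_fun setT
      (fun t : n.+1.-tuple X => (\1_(@uncons n @^-1` A) t)%:E : \bar R).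
    exact/measurable_EFinP/measurable_indic.
  rewrite (ge0_integral_density (m := gaussian_tuple n.+1) nuf)//.
  rewrite -(@ge0_integral_image _ _ _ _ _ NG (gaussian_tuple n.+1) (@cons_pair R n)
    (@measurable_cons_pair R n) (fun A _ => erefl)
    (fun t => (\1_(@uncons n @^-1` A) t)%:E * (f t)%:E)%E).
  - rewrite [RHS]integral_mkcond; apply: eq_integral => z _.
    rewrite patchE -EFinM indicE.
    rewrite (_ : (cons_pair z \in @uncons n @^-1` A) = (z \in A)).
      by case: ifPn => _; rewrite ?mul1r ?mul0r.
    by apply/idP/idP; rewrite !inE/= cons_pairK.
  - by apply: emeasurable_funM => //; exact/measurable_EFinP.
  - by move=> t; rewrite mule_ge0// lee_fin.
have [nu' nu'f] := ex_marginal nucf.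
have [pi' [K' [pi'1 pi'2 [mK' K'0] ae' cost']]] := IH _ _ nu'f.
pose pi2 := triangular_coupling nucf pi'.
pose J := triangular_jacobian nucf.
pose CC (z : (X * n.-tuple X) * (X * n.-tuple X)) : n.+1.-tuple X * n.+1.-tuple X :=
  (cons_pair z.1, cons_pair z.2).
have mCC : measurable_fun setT CC.
  by apply: measurable_fun_pair;
    apply: (measurableT_comp (@measurable_cons_pair R n)).
pose CCF : {mfun ((X * n.-tuple X) * (X * n.-tuple X))%type >->
    (n.+1.-tuple X * n.+1.-tuple X)%type} := mfun_Sub (mem_set mCC).
pose pi : probability (n.+1.-tuple X * n.+1.-tuple X)%type R :=
  distribution pi2 CCF.
have piE A : measurable A -> pi2 (CC @^-1` A) = pi A by [].
pose tl (z : n.+1.-tuple X * n.+1.-tuple X) : n.-tuple X * n.-tuple X :=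
  ((uncons z.1).2, (uncons z.2).2).
have mun1 : measurable_fun setT
    (fun z : n.+1.-tuple X * n.+1.-tuple X => uncons z.1).
  exact: (measurableT_comp (@measurable_uncons n) measurable_fst).
have mun2 : measurable_fun setT
    (fun z : n.+1.-tuple X * n.+1.-tuple X => uncons z.2).
  exact: (measurableT_comp (@measurable_uncons n) measurable_snd).
have mtl : measurable_fun setT tl.
  by apply: measurable_fun_pair; exact: (measurableT_comp measurable_snd).
pose K z := K' (tl z) + J (uncons z.2).
have mJ := measurable_triangular_jacobian nucf.
have mK1 : measurable_fun setT (fun z => K' (tl z)) by exact: measurableT_comp mtl.
have mK2 : measurable_fun setT
    (fun z : n.+1.-tuple X * n.+1.-tuple X => J (uncons z.2)).
  exact: (measurableT_comp mJ mun2).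
have pi2_snd A : measurable A -> pi2 (snd @^-1` A) = nuc A.
  move=> mA; have mA' : measurable
      ((snd : (X * n.-tuple X) * (X * n.-tuple X) -> X * n.-tuple X) @^-1` A).
    by rewrite -[X in measurable X]setTI; exact: measurable_snd.
  have mI : measurable_fun setT (fun z : X * n.-tuple X => (\1_A z)%:E : \bar R).
    exact/measurable_EFinP/measurable_indic.
  rewrite -(probability_indic pi2 mA') -(probability_indic nuc mA).
  rewrite -(integral_triangular_coupling_snd nucf nu'f pi'2 mI)//.
have mtl2 : measurable_fun setT
    (fun z : (X * n.-tuple X) * (X * n.-tuple X) => (z.1.2, z.2.2)).
  by apply: measurable_fun_pair; exact: measurableT_comp.
have pi2_tail A : measurable A ->
    pi2 ((fun z => (z.1.2, z.2.2)) @^-1` A) = pi' A.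
  move=> mA; have mA' : measurable
      ((fun z : (X * n.-tuple X) * (X * n.-tuple X) => (z.1.2, z.2.2)) @^-1` A).
    by rewrite -[X in measurable X]setTI; exact: mtl2.
  have mI : measurable_fun setT
      (fun z : n.-tuple X * n.-tuple X => (\1_A z)%:E : \bar R).
    exact/measurable_EFinP/measurable_indic.
  rewrite -(probability_indic pi2 mA') -(probability_indic pi' mA).
  by rewrite -(integral_triangular_coupling_tail nucf pi' mI).
have KE z : K (CC z) = K' (z.1.2, z.2.2) + J z.2 by rewrite /K /tl !cons_pairK.
exists pi, K; split.
- move=> A mA.
  have mA' : measurable (@cons_pair R n @^-1` A).
    by rewrite -[X in measurable X]setTI; exact: measurable_cons_pair.
  exact: (triangular_coupling_fst nucf pi'1 mA').
- move=> A mA.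
  have mA' : measurable (@cons_pair R n @^-1` A).
    by rewrite -[X in measurable X]setTI; exact: measurable_cons_pair.
  transitivity (pi2 (snd @^-1` (@cons_pair R n @^-1` A))); first by [].
  transitivity (nuc (@cons_pair R n @^-1` A)); first exact: pi2_snd.
  transitivity (nu (@uncons n @^-1` (@cons_pair R n @^-1` A))); first by [].
  by congr (nu _); apply/seteqP; split => z /=; rewrite unconsK.
- split; first exact: measurable_funD.
  by move=> z; rewrite addr_ge0// triangular_jacobian_ge0.
- apply: (ae_image mCC piE).
    rewrite -[X in measurable X]setTI; apply: measurable_fun_ler => //.
      apply: measurableT_comp => //; apply: measurable_funB.
        apply: measurable_funD => //; apply: measurable_funM => //.
        by apply: measurable_funB;
          apply: (measurableT_comp (@measurable_sqlen n.+1)).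
      by apply: measurable_funM => //; exact: measurable_funD.
    exact: (measurableT_comp mf measurable_snd).
  have ae2 : {ae pi2, forall z, expR ((sqlen z.2.2 - sqlen z.1.2) / 2 +
        n%:R * (1 - ln lam) - K' (z.1.2, z.2.2) / lam)
        <= marginal_density fc z.2.2}.
    exact: (ae_preimage mtl2 pi2_tail ae').
  apply: ae_imp2 ae2 (triangular_coupling_density_ae nucf nu'f pi'2) => z.
  rewrite KE -[f _]/(fc z.2) -[(CC z).1]/(cons_pair z.1).
  rewrite -[(CC z).2]/(cons_pair z.2) !sqlen_cons.
  rewrite -/J; move: z.1 z.2 => x y h [J0 ->].
  apply: le_trans (ler_wpM2r (divr_ge0 (expR_ge0 _) (ltW J0)) h).
  move: (J y) J0 => j J0.
  (* The tangent bound for the logarithm at [lam], in exponential form. It contributes the new term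
     [1 - ln lam - j / lam] to the exponent. *)
  have jl : j / lam <= expR (j / lam - 1) by have := expR_ge1Dx (j / lam - 1); lra.
  have jE : expR (1 - ln lam - j / lam) <= j^-1.
    rewrite (_ : _ - _ - _ = - ln lam + - (j / lam - 1)); last by ring.
    rewrite expRD !expRN lnK ?posrE// -invfM.
    rewrite lef_pV2 ?posrE ?mulr_gt0 ?expR_gt0//.
    by rewrite mulrC -ler_pdivrMr.
  rewrite (_ : _ - _ = ((sqlen y.2 - sqlen x.2) / 2 + n%:R * (1 - ln lam) -
      K' (x.2, y.2) / lam) +
      ((y.1 ^+ 2 - x.1 ^+ 2) / 2 + (1 - ln lam - j / lam))); last first.
    by rewrite -natr1; field; rewrite gt_eqF.
  by rewrite expRD ler_wpM2l ?expR_ge0// expRD ler_wpM2l ?expR_ge0.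
- have mKE : measurable_fun setT (fun z => (K z)%:E : \bar R).
    by apply/measurable_EFinP; exact: measurable_funD.
  have msd : measurable_fun setT
      (fun z : n.+1.-tuple X * n.+1.-tuple X => (sqdist z.1 z.2)%:E : \bar R).
    by apply/measurable_EFinP; exact: measurable_sqdist.
  have mK'E : measurable_fun setT (fun z => (K' z)%:E : \bar R).
    exact/measurable_EFinP.
  have msd' : measurable_fun setT
      (fun z : n.-tuple X * n.-tuple X => (sqdist z.1 z.2)%:E : \bar R).
    by apply/measurable_EFinP; exact: measurable_sqdist.
  have mJE : measurable_fun setT
      (fun z : (X * n.-tuple X) * (X * n.-tuple X) => (J z.2)%:E : \bar R).
    by apply/measurable_EFinP; exact: (measurableT_comp mJ measurable_snd).
  have mK'2 : measurable_fun setT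
      (fun z : (X * n.-tuple X) * (X * n.-tuple X) =>
        (K' (z.1.2, z.2.2))%:E : \bar R).
    exact: (measurableT_comp mK'E mtl2).
  have msd2 : measurable_fun setT
      (fun z : (X * n.-tuple X) * (X * n.-tuple X) =>
        (sqdist z.1.2 z.2.2)%:E : \bar R).
    exact: (measurableT_comp msd' mtl2).
  have msq : measurable_fun setT
      (fun z : (X * n.-tuple X) * (X * n.-tuple X) =>
        ((z.2.1 - z.1.1) ^+ 2)%:E : \bar R).
    apply/measurable_EFinP; apply: measurable_funX; apply: measurable_funB;
      exact: measurableT_comp.
  have K'0E z : (0 <= (K' z)%:E)%E by rewrite lee_fin.
  have J0 z : (0 <= (J z)%:E)%E by rewrite lee_fin triangular_jacobian_ge0.
  have sd0 m (x y : m.-tuple X) : (0 <= (sqdist x y)%:E)%E.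
    by rewrite lee_fin sqdist_ge0.
  rewrite -(ge0_integral_image mCC piE mKE); last first.
    by move=> z; rewrite lee_fin addr_ge0// triangular_jacobian_ge0.
  rewrite -(ge0_integral_image mCC piE msd)//.
  have EK' : (\int[pi2]_z (K' (z.1.2, z.2.2))%:E = \int[pi']_z (K' z)%:E)%E.
    exact: (@integral_triangular_coupling_tail _ _ _ _ _ _ nucf pi'
      (fun z => (K' z)%:E) mK'E K'0E).
  have EK : (\int[pi2]_z (K (CC z))%:E =
      \int[pi2]_z (K' (z.1.2, z.2.2))%:E + \int[pi2]_z (J z.2)%:E)%E.
    rewrite -(@ge0_integralD _ _ _ pi2 setT measurableT _ _
      (fun z _ => K'0E (z.1.2, z.2.2)) mK'2 (fun z _ => J0 z.2) mJE).
    by apply: eq_integral => z _; rewrite KE EFinD.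
  have Esd' : (\int[pi2]_z (sqdist z.1.2 z.2.2)%:E =
      \int[pi']_z (sqdist z.1 z.2)%:E)%E.
    exact: (@integral_triangular_coupling_tail _ _ _ _ _ _ nucf pi'
      (fun z => (sqdist z.1 z.2)%:E) msd' (fun z => sd0 _ _ _)).
  have Esd : (\int[pi2]_z (sqdist (CC z).1 (CC z).2)%:E =
      \int[pi2]_z (sqdist z.1.2 z.2.2)%:E +
      \int[pi2]_z ((z.2.1 - z.1.1) ^+ 2)%:E)%E.
    rewrite -(@ge0_integralD _ _ _ pi2 setT measurableT _ _
      (fun z _ => sd0 _ z.1.2 z.2.2) msd2 _ msq).
      by apply: eq_integral => z _; rewrite /CC sqdist_cons addrC EFinD.
    by move=> z _; rewrite lee_fin sqr_ge0.
  rewrite EK EK' Esd Esd'.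
  have msl : measurable_fun setT (fun y : n.-tuple X => (sqlen y)%:E : \bar R).
    by apply/measurable_EFinP; exact: measurable_sqlen.
  have mslS : measurable_fun setT (fun y : n.+1.-tuple X => (sqlen y)%:E : \bar R).
    by apply/measurable_EFinP; exact: measurable_sqlen.
  have msl2 : measurable_fun setT (fun y : X * n.-tuple X => (sqlen y.2)%:E : \bar R).
    exact: (measurableT_comp msl measurable_snd).
  have msq1 : measurable_fun setT (fun y : X * n.-tuple X => (y.1 ^+ 2)%:E : \bar R).
    by apply/measurable_EFinP; exact: measurable_funX.
  have sl0 m (y : m.-tuple X) : (0 <= (sqlen y)%:E)%E by rewrite lee_fin sqlen_ge0.
  (* The tail of [nu] is compared with [nu'] through the second marginals of [pi2] and [pi']. *)
  have nuE' : (\int[nu]_y (sqlen y)%:E =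
      \int[nu']_y (sqlen y)%:E + \int[nuc]_y (y.1 ^+ 2)%:E)%E.
    rewrite -(ge0_integral_image measurable_snd pi'2 msl)//.
    rewrite -(integral_triangular_coupling_tail nucf pi'
      (h := fun z => (sqlen z.2)%:E))//; last first.
      exact: (measurableT_comp msl measurable_snd).
    rewrite (integral_triangular_coupling_snd nucf nu'f pi'2 msl2)//.
    rewrite -ge0_integralD//; last by move=> y _; rewrite lee_fin sqr_ge0.
    rewrite -(@ge0_integral_image _ _ _ _ _ nu nuc _ (@measurable_uncons n)
      (fun A _ => erefl))//.
    - apply: eq_integral => t _ /=.
      by rewrite -EFinD addrC -(sqlen_cons (uncons t)) unconsK.
    - exact: emeasurable_funD.
    - by move=> z; rewrite adde_ge0// lee_fin sqr_ge0.
  have iK : (0 <= \int[pi']_z (K' z)%:E)%E by apply: integral_ge0.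
  have iJ : (0 <= \int[pi2]_z (J z.2)%:E)%E by apply: integral_ge0.
  rewrite nuE'; move: cost' (triangular_coupling_cost nucf nu'f pi'2) iK iJ.
  rewrite -/pi2 -/J; move: (\int[pi']_z (K' z)%:E)%E (\int[pi2]_z (J z.2)%:E)%E
    (\int[pi']_z (sqdist z.1 z.2)%:E)%E (\int[pi2]_z ((z.2.1 - z.1.1) ^+ 2)%:E)%E
    (\int[nu']_y (sqlen y)%:E)%E (\int[nuc]_y (y.1 ^+ 2)%:E)%E
    => a b c d e g h1 h2 a0 b0.
  (* Distributing the factor 2 uses only the signs, so the two cost inequalities add up in the
     extended reals even if some term is infinite. *)
  rewrite ge0_muleDr// addeACA -[n.+1%:R]natr1.
  by rewrite [(n%:R + 1)%:E]EFinD (addeACA n%:R%:E) leeD.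
Qed.

Lemma ex_tuple_coupling (lam : R) n (f : n.-tuple X -> R)
    (nu : probability (n.-tuple X) R) : 0 < lam ->
  has_density nu (gaussian_tuple n) f -> exists pi K, tuple_coupling lam f nu pi K.
Proof.
move=> lam0; elim: n f nu => [|n IH] f nu; first exact: ex_tuple_coupling0.
exact: ex_tuple_couplingS.
Qed.

End tuple_coupling.

(** * Relative entropy *)

(** Positive and negative parts are compared separately, which allows the integral of the smaller
    function to be [-oo]. *)
Lemma le_integral_measurable d (T : measurableType d) (R : realType)
    (P : {measure set T -> \bar R}) (f g : T -> \bar R) :
  measurable_fun setT f -> P.-integrable setT g -> (forall x, (f x <= g x)%E) ->
  (\int[P]_x f x <= \int[P]_x g x)%E.
Proof.
move=> mf ig fg; have mg := measurable_int _ ig.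
rewrite [leLHS]integralE [leRHS]integralE leeB//.
- apply: ge0_le_integral => //.
  + exact: measurable_funepos.
  + exact: measurable_funepos.
  + by move=> x _; rewrite !funeposE le_max2// fg.
- apply: ge0_le_integral => //.
  + exact: measurable_funeneg.
  + exact: measurable_funeneg.
  + by move=> x _; rewrite !funenegE le_max2// leeN2 fg.
Qed.

Lemma ae_le_integral d (T : measurableType d) (R : realType)
    (P : {measure set T -> \bar R}) (f g : T -> \bar R) :
  P.-integrable setT f -> P.-integrable setT g ->
  {ae P, forall x, (f x <= g x)%E} -> (\int[P]_x f x <= \int[P]_x g x)%E.
Proof.
move=> intf intg fg; have mf := measurable_int _ intf; have mg := measurable_int _ intg.
rewrite (_ : \int[P]_x f x = \int[P]_x mine (f x) (g x))%E.
  apply: le_integral_measurable => //; first exact: measurable_mine.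
  by move=> x; rewrite ge_min lexx orbT.
apply: ae_eq_integral => //; first exact: measurable_mine.
by apply: ae_imp fg => x /min_idPl ->.
Qed.

Lemma bounded_integrable d (T : measurableType d) (R : realType)
    (P : probability T R) (g : T -> R) (M : R) : measurable_fun setT g ->
  (forall x, `|g x| <= M) -> P.-integrable setT (EFin \o g).
Proof.
move=> mg gM; apply: (@le_integrable _ _ _ _ setT _ _ (fun=> M%:E)) => //.
- exact/measurable_EFinP.
- by move=> x _; rewrite /= lee_fin (le_trans (gM x))// ler_norm.
- exact: finite_measure_integrable_cst.
Qed.

Lemma ln_le_sub1 (R : realType) (x : R) : 0 < x -> ln x <= x - 1.
Proof.
by move=> x0; have := @le_ln1Dx R (x - 1); rewrite subrKC; apply; lra.
Qed.

(** Each endpoint [c] lies above the tangent at the barycenter [s]: [c * ln s <= c * ln c + s - c],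
    which is [ln u <= u - 1] at [u = s / c]. In the average of the two inequalities the affine terms
    cancel. *)
Lemma xlnx_convex (R : realType) (p a b : R) : 0 <= p <= 1 -> 0 <= a -> 0 <= b ->
  (p * a + (1 - p) * b) * ln (p * a + (1 - p) * b) <=
  p * (a * ln a) + (1 - p) * (b * ln b).
Proof.
move=> /andP[p0 p1] a0 b0; set s := p * a + (1 - p) * b.
have p1' : 0 <= 1 - p by rewrite subr_ge0.
have s0 : 0 <= s by rewrite addr_ge0// mulr_ge0.
have [sz|sn0] := eqVneq s 0.
  have /andP[pa pb] : (p * a == 0) && ((1 - p) * b == 0).
    by rewrite -paddr_eq0 ?mulr_ge0// -[X in X == _]/s sz.
  by rewrite sz mul0r !mulrA (eqP pa) (eqP pb) !mul0r addr0.
have sp : 0 < s by rewrite lt_neqAle eq_sym sn0.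
have key c : 0 <= c -> c * ln s <= c * ln c + s - c.
  move=> c0; have [->|cn0] := eqVneq c 0.
    by rewrite !mul0r add0r subr0.
  have cp : 0 < c by rewrite lt_neqAle eq_sym cn0.
  have sc : 0 < s / c by rewrite divr_gt0.
  have := ln_le_sub1 sc; rewrite ln_div ?posrE// => /(ler_wpM2l c0).
  by rewrite !mulrBr mulrCA divff// mulr1; lra.
have := ler_wpM2l p1' (key _ b0); have := ler_wpM2l p0 (key _ a0).
by rewrite /s; lra.
Qed.

Section entropy.
Context d (T : measurableType d) (R : realType).
Implicit Types mu nu rho : probability T R.
Local Open Scope ereal_scope.

Lemma measurable_lne_EFin (h : T -> R) : measurable_fun setT h ->
  measurable_fun setT (fun x => lne (h x)%:E).
Proof.
move=> mh; rewrite (_ : (fun x => _) =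
    (fun x => if (0 < h x)%R then (ln (h x))%:E else -oo)).
  apply: measurable_fun_ifT => //; first exact: measurable_fun_ltr.
  by apply/measurable_EFinP; exact: measurableT_comp.
apply/funext => x; case: ifPn => [h0|]; first by rewrite lne_EFin.
by rewrite -leNgt => h0; rewrite le0_lneNy.
Qed.

Lemma ex_dominated_density mu nu : mu `<< nu -> exists F, has_density mu nu F.
Proof.
move=> munu; pose r := Radon_Nikodym_SigmaFinite.f mu nu.
have r0 := Radon_Nikodym_SigmaFinite.f_ge0 munu.
have rfin := Radon_Nikodym_SigmaFinite.f_fin_num munu.
have mr := measurable_int _ (Radon_Nikodym_SigmaFinite.f_integrable munu).
exists (fine \o r); split.
- exact: measurableT_comp.
- by move=> x; exact: fine_ge0.
- move=> A mA; transitivity (\int[nu]_(x in A) r x).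
    exact: Radon_Nikodym_SigmaFinite.f_integral.
  by apply: eq_integral => x _; rewrite /= fineK.
Qed.

(** Changing the version of the density, and replacing the extended [lne] by [ln], alters the
    integrand on a [mu]-null set only: the two logarithms differ where the density vanishes. *)
Lemma relative_entropyE mu nu F : has_density mu nu F ->
  relative_entropy mu nu = \int[mu]_x (ln (F x))%:E.
Proof.
move=> muF; have munu := has_density_dominates muF; have [mF F0 muE] := muF.
rewrite /relative_entropy asboolT//.
set r := ('d _ '/d _)%R.
have rfin x : r x \is a fin_num by exact: Radon_Nikodym_fin_num.
have mr : measurable_fun setT r.
  have : nu.-integrable setT r by exact: Radon_Nikodym_integrable.
  exact: measurable_int.
have rF : ae_eq nu setT r (EFin \o F).
  apply: ae_eq_trans (density_RN (m := nu) muF).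
  exact/ae_eq_sym/ae_eq_Radon_Nikodym_SigmaFinite.
apply: ae_eq_integral => //.
- rewrite (_ : (fun x => lne _) = (fun x => lne (fine (r x))%:E)).
    by apply: measurable_lne_EFin; exact: measurableT_comp.
  by apply/funext => x; rewrite fineK.
- by apply/measurable_EFinP; exact: measurableT_comp.
have rFmu := null_dominates_ae_eq measurableT munu rF.
apply: ae_imp2 rFmu (density_gt0_ae (m := nu) muF) => x /(_ I) rx Fx _.
by rewrite -lne_EFin//; congr lne.
Qed.

Lemma relative_entropy_dominates mu nu : relative_entropy mu nu < +oo -> mu `<< nu.
Proof. by rewrite /relative_entropy; case: asboolP => //; rewrite ltxx. Qed.

(** The product of [F] and [- ln F] is at most 1, by [ln u <= u - 1] at [u = F^-1]. *)
Lemma density_ln_negative_part mu nu F : has_density mu nu F ->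
  \int[mu]_x ((fun x => (ln (F x))%:E)^\- x) <= 1.
Proof.
move=> muF; have [mF F0 muE] := muF.
have mlnF : measurable_fun setT (fun x => (ln (F x))%:E : \bar R).
  by apply/measurable_EFinP; exact: measurableT_comp.
rewrite (ge0_integral_density (m := nu) muF)//; last exact: measurable_funeneg.
apply: (@le_trans _ _ (\int[nu]_x 1)); last first.
  by rewrite integral_cst//= probability_setT mule1.
apply: ge0_le_integral => //.
- by move=> x _; rewrite mule_ge0// lee_fin.
- apply: emeasurable_funM; first exact: measurable_funeneg.
  exact/measurable_EFinP.
- move=> x _; rewrite funenegE -EFinN -EFin_max -EFinM lee_fin.
  have [->|Fx] := eqVneq (F x) 0%R; first by rewrite mulr0.
  have Fx0 : (0 < F x)%R by rewrite lt_neqAle eq_sym Fx F0.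
  have [_|_] := leP (- ln (F x))%R 0%R; first by rewrite mul0r.
  have Fi : (0 < (F x)^-1)%R by rewrite invr_gt0.
  have := ln_le_sub1 Fi; rewrite lnV ?posrE// => /(ler_wpM2r (F0 x)).
  by move/le_trans; apply; rewrite mulrBl mulVf// mul1r lerBlDr lerDl.
Qed.

Lemma ex_entropy_density mu nu : relative_entropy mu nu < +oo ->
  exists2 F, has_density mu nu F & mu.-integrable setT (fun x => (ln (F x))%:E).
Proof.
move=> H; have [F muF] := ex_dominated_density (relative_entropy_dominates H).
exists F => //; have [mF F0 muE] := muF.
have mlnF : measurable_fun setT (fun x => (ln (F x))%:E : \bar R).
  by apply/measurable_EFinP; exact: measurableT_comp.
have neg := le_lt_trans (density_ln_negative_part muF) (ltry 1).
apply/integrableP; split => //.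
rewrite (eq_integral (fun x => (fun x => (ln (F x))%:E)^\+ x +
    (fun x => (ln (F x))%:E)^\- x)); last first.
  by move=> x _; rewrite -[LHS]/((abse \o (fun x => (ln (F x))%:E)) x) fune_abse.
rewrite ge0_integralD//; [|exact: measurable_funepos|exact: measurable_funeneg].
rewrite lte_add_pinfty//.
rewrite (relative_entropyE muF) integralE in H; move: H.
set b := integral mu setT (funeneg _).
have b0 : 0 <= b by exact: integral_ge0.
have : b \is a fin_num by rewrite ge0_fin_numE.
move=> bfin; rewrite lteBlDr//.
by move=> /lt_le_trans; apply; rewrite leey.
Qed.

(* [ln u <= u - 1] at [u = expR (g x) / (F x * Z)]. *)
Lemma entropy_dual_le mu nu F (g : T -> R) (Z : R) : has_density mu nu F ->
  mu.-integrable setT (fun x => (ln (F x))%:E) ->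
  measurable_fun setT g -> mu.-integrable setT (EFin \o g) ->
  (0 < Z)%R -> \int[nu]_x (expR (g x))%:E <= Z%:E ->
  \int[mu]_x (g x)%:E <= \int[mu]_x (ln (F x))%:E + (ln Z)%:E.
Proof.
move=> muF ilnF mg ig Z0 gZ; have [mF F0 muE] := muF.
pose h x : R := (expR (g x) * (F x * Z)^-1)%R.
have FZ0 x : (0 <= F x * Z)%R by rewrite mulr_ge0// ltW.
have mh : measurable_fun setT h.
  apply: measurable_funM; first exact: measurableT_comp.
  by apply: ge0_measurable_funV => //; exact: measurable_funM.
have h0 x : (0 <= h x)%R by rewrite mulr_ge0 ?expR_ge0// invr_ge0.
have h1 : \int[mu]_x (h x)%:E <= 1.
  rewrite (ge0_integral_density (m := nu) muF)//; last exact/measurable_EFinP.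
  apply: (@le_trans _ _ (\int[nu]_x ((Z^-1)%:E * (expR (g x))%:E))).
    apply: ge0_le_integral => //.
    - by move=> x _; rewrite mule_ge0 ?lee_fin.
    - by apply: emeasurable_funM; exact/measurable_EFinP.
    - by apply: emeasurable_funM => //; apply/measurable_EFinP; exact: measurableT_comp.
    - move=> x _; rewrite -!EFinM lee_fin /h.
      have [->|Fx] := eqVneq (F x) 0%R.
        by rewrite mulr0 mulr_ge0 ?expR_ge0// invr_ge0 ltW.
      by rewrite invfM mulrA mulrAC mulfVK// mulrC.
  rewrite ge0_integralZl//=.
  - apply: (@le_trans _ _ ((Z^-1)%:E * Z%:E)).
      by rewrite lee_pmul2l// lte_fin invr_gt0.
    by rewrite -EFinM mulVf// gt_eqF.
  - by apply/measurable_EFinP; exact: measurableT_comp.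
  - by rewrite lee_fin invr_ge0 ltW.
have ih : mu.-integrable setT (EFin \o h).
  apply/integrableP; split; first exact/measurable_EFinP.
  rewrite (eq_integral (fun x => (h x)%:E)); first by rewrite (le_lt_trans h1)// ltry.
  by move=> x _; rewrite /= ger0_norm.
have i1 c : mu.-integrable setT (fun=> c%:E).
  exact: finite_measure_integrable_cst.
have le : \int[mu]_x (g x)%:E <=
    \int[mu]_x ((ln (F x))%:E + ((h x)%:E + (ln Z - 1)%:E)).
  apply: ae_le_integral => //.
    by apply: integrableD => //; exact: integrableD.
  apply: ae_imp (density_gt0_ae (m := nu) muF) => x Fx.
  rewrite -!EFinD lee_fin.
  have hx : (0 < h x)%R by rewrite mulr_gt0 ?expR_gt0// invr_gt0 mulr_gt0.
  have := ln_le_sub1 hx.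
  rewrite {1}/h lnM ?posrE ?expR_gt0 ?invr_gt0 ?mulr_gt0//.
  by rewrite expRK lnV ?posrE ?mulr_gt0// lnM ?posrE//; lra.
apply: (le_trans le).
rewrite integralD//; last by apply: integrableD.
apply: leeD => //; rewrite integralD// integral_cst// [X in _ * X]probability_setT mule1.
apply: le_trans (leeD2r _ h1) _.
by rewrite -EFinD lee_fin; lra.
Qed.


Lemma entropy_mixture mu1 mu2 rho nu F1 F2 (p : R) : (0 <= p <= 1)%R ->
  has_density mu1 nu F1 -> has_density mu2 nu F2 ->
  has_density rho nu (fun x => p * F1 x + (1 - p) * F2 x)%R ->
  mu1.-integrable setT (fun x => (ln (F1 x))%:E) ->
  mu2.-integrable setT (fun x => (ln (F2 x))%:E) ->
  relative_entropy rho nu <= p%:E * \int[mu1]_x (ln (F1 x))%:E +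
                             (1 - p)%:E * \int[mu2]_x (ln (F2 x))%:E.
Proof.
move=> p01 d1 d2 drho i1 i2; have [mF1 F10 _] := d1; have [mF2 F20 _] := d2.
have mln (F : T -> R) : measurable_fun setT F -> measurable_fun setT (fun x => (ln (F x))%:E : \bar R).
  by move=> mF; apply/measurable_EFinP; exact: measurableT_comp.
have mF : measurable_fun setT (fun x => p * F1 x + (1 - p) * F2 x)%R by case: drho.
rewrite (relative_entropyE drho) (integral_density (m := nu) drho); last exact: mln.
rewrite (integral_density (m := nu) d1); last exact: mln.
rewrite (integral_density (m := nu) d2); last exact: mln.
move/(integrable_density (m := nu) d1 (mln _ mF1)) : i1 => i1.
move/(integrable_density (m := nu) d2 (mln _ mF2)) : i2 => i2.
rewrite -!integralZl// -integralD//; [|exact: integrableZl..].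
apply: le_integral_measurable.
- by apply: emeasurable_funM; [exact: mln|exact/measurable_EFinP].
- by apply: integrableD => //; exact: integrableZl.
- move=> x; rewrite -!EFinM -EFinD lee_fin mulrC.
  rewrite [(ln (F1 x) * _)%R]mulrC [(ln (F2 x) * _)%R]mulrC.
  exact: xlnx_convex.
Qed.

(** The hard half of the Donsker-Varadhan formula. Without domination, a large multiple of the
    indicator of a [nu]-null set charged by [mu] suffices; otherwise the test function is the
    logarithm of the density truncated to [[expR (- n), expR n]]. *)
Lemma entropy_lt_bounded mu nu (b : R) : b%:E < relative_entropy mu nu ->
  exists (g : T -> R) (M : R), [/\ measurable_fun setT g, (forall x, `|g x| <= M)%R &
    (b < \int[mu]_x g x - ln (\int[nu]_x expR (g x)))%R].
Proof.
move=> bH; have [munu|] := pselect (mu `<< nu); last first.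
  move=> /null_content_dominatesP/existsNP[A]/not_implyP[mA]/not_implyP[nA mA0].
  have mApos : (0 < fine (mu A))%R.
    rewrite fine_gt0//; apply/andP; split; last first.
      by rewrite (le_lt_trans (probability_le1 mu mA))// ltry.
    by rewrite lt_neqAle measure_ge0 andbT eq_sym; exact/eqP.
  (* With this constant the first integral is [|b| + 1], and the logarithm vanishes because [A] is
     [nu]-null. *)
  pose c : R := ((`|b| + 1) / fine (mu A))%R.
  have c0 : (0 <= c)%R by rewrite divr_ge0 ?addr_ge0// ltW.
  exists (fun x => c * \1_A x)%R, c; split.
  - exact: measurable_funM.
  - move=> x; rewrite normrM (ger0_norm c0) indicE.
    by case: (_ \in _); rewrite ?normr1 ?mulr1// normr0 mulr0.
  - have -> : (\int[nu]_x expR (c * \1_A x) = 1)%R.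
      suff h : \int[nu]_x (expR (c * \1_A x))%:E = 1 by rewrite /Rintegral h.
      transitivity (\int[nu]_x (cst 1 x)); last first.
        by rewrite integral_cst//= probability_setT mule1.
      apply: ae_eq_integral => //.
      + by apply/measurable_EFinP; apply: measurableT_comp => //; exact: measurable_funM.
      + exists A; split => // x; apply: contra_notP => nAx _.
        by rewrite indicE memNset// mulr0 expR0.
    rewrite ln1 subr0 /Rintegral.
    under eq_integral do rewrite EFinM.
    rewrite integralZl//=.
      rewrite probability_indic// fineM ?fin_num_measure//= /c mulfVK ?gt_eqF//.
      by rewrite (le_lt_trans (ler_norm b))// ltrDl.
    apply/integrableP; split; first exact/measurable_EFinP.
    rewrite (eq_integral (fun x => (\1_A x)%:E)).
      by rewrite probability_indic// (le_lt_trans (probability_le1 _ _))// ltry.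
    by move=> x _; rewrite /= ger0_norm.
have [F muF] := ex_dominated_density munu; have [mF F0 muE] := muF.
have mlnF : measurable_fun setT (fun x => (ln (F x))%:E : \bar R).
  by apply/measurable_EFinP; exact: measurableT_comp.
rewrite (relative_entropyE muF) integralE in bH.
have negfin := le_lt_trans (density_ln_negative_part muF) (ltry 1).
pose pos x : R := Num.max (ln (F x)) 0%R.
pose neg x : R := Num.max (- ln (F x))%R 0%R.
have posE : (fun x => (ln (F x))%:E)^\+ = EFin \o pos.
  by apply/funext => x; rewrite funeposE -EFin_max.
have negE : (fun x => (ln (F x))%:E)^\- = EFin \o neg.
  by apply/funext => x; rewrite funenegE -EFin_max.
have mpos : measurable_fun setT pos.
  by apply: measurable_maxr => //; exact: measurableT_comp.
have mneg : measurable_fun setT neg.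
  by apply: measurable_maxr => //; apply: measurable_funN; exact: measurableT_comp.
have neg0 x : (0 <= neg x)%R by rewrite le_max lexx orbT.
rewrite posE negE in bH negfin.
have ineg : mu.-integrable setT (EFin \o neg).
  apply/integrableP; split; first exact/measurable_EFinP.
  rewrite (eq_integral (EFin \o neg))// => x _.
  by rewrite /= ger0_norm.
move: bH; set c := integral mu setT (EFin \o neg) => bH.
have cfin : c \is a fin_num by exact: integrable_fin_num.
pose v (n : nat) x : R := Num.min (pos x) n%:R.
have v0 n x : (0 <= v n x)%R by rewrite le_min le_max lexx orbT ler0n.
have mv n : measurable_fun setT (v n) by exact: measurable_minr.
have vcvg : \int[mu]_x (v n x)%:E @[n --> \oo] --> \int[mu]_x (pos x)%:E.
  rewrite -[X in _ --> X]/(integral mu setT (EFin \o pos)).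
  have -> : EFin \o pos = fun x => limn (fun n => (v n x)%:E).
    apply/funext => x; apply/esym/cvg_lim => //; apply: cvg_near_cst.
    near=> n; congr EFin; apply/min_idPl.
    by near: n; exact: nbhs_infty_ger.
  apply: cvg_monotone_convergence => //.
  - by move=> n; exact/measurable_EFinP.
  - by move=> n x _; rewrite lee_fin.
  - by move=> x _ m n mn; rewrite lee_fin /v le_min2// ler_nat.
(* The intermediate level [c'] leaves room for the error [expR (- n)] caused by the lower
   truncation. *)
have [c' [bc' c'a]] : exists c' : R, (b + fine c < c')%R /\ c'%:E < \int[mu]_x (pos x)%:E.
  move: bH; rewrite lteBrDr//; move: cfin => /fineK <-; rewrite -EFinD /=.
  case: (integral mu setT (EFin \o pos)) => [a| |]//.
    move=> h; exists ((b + fine c + a) / 2)%R; move: h; rewrite !lte_fin => h.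
    by split; lra.
  by move=> _; exists (b + fine c + 1)%R; rewrite ltry; split => //; lra.
(* The second requirement, with [n <= expR n], puts [expR (- n)] below the gap between [c'] and
   [b + fine c]. *)
have [n [vn nbig]] : exists n, c'%:E < \int[mu]_x (v n x)%:E /\
    ((c' - (b + fine c))^-1 < n%:R)%R.
  near \oo => n; exists n; split; near: n; last exact: nbhs_infty_gtr.
  exact: (vcvg (fun u => c'%:E < u) (open_ereal_gt' c'a)).
pose G x : R := Num.max (expR (- n%:R)) (Num.min (F x) (expR n%:R)).
have Gl x : (expR (- n%:R) <= G x)%R by rewrite le_max lexx.
have Gpos x : (0 < G x)%R by rewrite (lt_le_trans (expR_gt0 _) (Gl x)).
have nn : (expR (- n%:R) <= expR n%:R :> R)%R by rewrite ler_expR (@le_trans _ _ 0%R)// oppr_le0.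
have Gu x : (G x <= expR n%:R)%R by rewrite ge_max nn ge_min lexx orbT.
have GF x : (G x <= F x + expR (- n%:R))%R.
  rewrite ge_max lerDr F0/= ge_min; apply/orP; left.
  by rewrite lerDl expR_ge0.
have mG : measurable_fun setT G.
  apply: measurable_maxr => //; exact: measurable_minr.
have mg : measurable_fun setT (fun x => ln (G x)) by exact: measurableT_comp.
have gn x : (`|ln (G x)| <= n%:R)%R.
  rewrite ler_norml; apply/andP; split.
    by rewrite -[leLHS]expRK ler_ln ?posrE ?expR_gt0.
  by rewrite -[leRHS]expRK ler_ln ?posrE ?expR_gt0.
exists (fun x => ln (G x)), n%:R; split => //.
(* Since [G <= F + expR (- n)], its [nu]-integral is at most [1 + expR (- n)]. *)
have E1 : (ln (\int[nu]_x expR (ln (G x))) <= expR (- n%:R))%R.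
  set X := Rintegral _ _ _.
  have X1 : (X <= 1 + expR (- n%:R))%R.
    have : \int[nu]_x (expR (ln (G x)))%:E <= (1 + expR (- n%:R))%:E.
      apply: (@le_trans _ _ (\int[nu]_x ((F x)%:E + (expR (- n%:R))%:E))).
        apply: ge0_le_integral => //.
        - by apply/measurable_EFinP; exact: measurableT_comp.
        - by apply: emeasurable_funD => //; exact/measurable_EFinP.
        - by move=> x _; rewrite lnK ?posrE// -EFinD lee_fin.
      rewrite ge0_integralD//.
      - rewrite (density_integral1 (m := nu) muF) integral_cst//.
        by rewrite [X in _ * X]probability_setT mule1.
      - by move=> x _; rewrite lee_fin.
      - exact/measurable_EFinP.
    rewrite -[X in X <= _ -> _]fineK ?lee_fin//.
    apply: integrable_fin_num => //; apply: (@bounded_integrable _ _ _ _ _ (expR n%:R)).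
      exact: measurableT_comp.
    by move=> x; rewrite lnK ?posrE// ger0_norm// ltW.
  have [X0|X0] := leP X 0%R; first by rewrite ln0// expR_ge0.
  by apply: (le_trans (ln_le_sub1 X0)); lra.
have ig := bounded_integrable mu mg gn.
(* Truncation from below only raises the logarithm, so [ln G] is at least the truncated positive
   part of [ln F] minus its whole negative part. *)
have E2 : (c' - fine c < \int[mu]_x ln (G x))%R.
  rewrite -lte_fin [X in _ < X]fineK; last exact: integrable_fin_num.
  rewrite EFinB fineK// lteBlDr//.
  apply: (lt_le_trans vn); rewrite /c -integralD//.
  apply: ae_le_integral; [|exact: integrableD|].
    apply: (@bounded_integrable _ _ _ _ _ n%:R) => // x.
    by rewrite ger0_norm// ge_min lexx orbT.
  apply: ae_imp (density_gt0_ae (m := nu) muF) => x Fx; rewrite -EFinD lee_fin.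
  have : (Num.min (ln (F x)) n%:R <= ln (G x))%R.
    apply: (@le_trans _ _ (ln (Num.min (F x) (expR n%:R)))).
      by case: (leP (F x)) => _; rewrite ?expRK ge_min lexx ?orbT.
    by rewrite ler_ln ?posrE// ?lt_min ?Fx ?expR_gt0// le_max lexx orbT.
  have : (0 <= n%:R :> R)%R by [].
  rewrite /v /pos /neg; move: (n%:R : R)%R (ln (F x)) (ln (G x)) => r l q r0.
  have [] := leP l 0%R; have [] := leP (- l)%R 0%R; have [] := leP l r; have [] := leP 0%R r; lra.
have ebound : (expR (- n%:R) < c' - (b + fine c))%R.
  rewrite expRN -[X in (_ < X)%R]invrK ltf_pV2 ?posrE ?expR_gt0 ?invr_gt0 ?subr_gt0//.
  by rewrite (lt_le_trans nbig)// (le_trans _ (expR_ge1Dx _))// lerDr.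
by move: E1 E2 ebound; lra.
Unshelve. all: by end_near.
Qed.

End entropy.

(** * The transport inequality *)

Section gaussian_product.
Context (R : realType).
Notation X := (measurableTypeR R).
Local Open Scope ereal_scope.

Lemma gaussian_tuple_prod n (h : 'I_n -> R -> R) :
  (forall i, measurable_fun setT (h i)) -> (forall i v, 0 <= h i v)%R ->
  \int[gaussian_tuple n]_t (\prod_(i < n) h i (tnth t i))%:E =
  \prod_(i < n) \int[normal_prob 0 1]_v (h i v)%:E.
Proof.
elim: n h => [|n IH] h mh h0.
  rewrite big_ord0 (eq_integral (cst 1)); last by move=> x _; rewrite big_ord0.
  by rewrite integral_cst//= diracE in_setT mul1e.
have mprod k (g : 'I_k -> R -> R) : (forall i, measurable_fun setT (g i)) ->
    measurable_fun setT (fun t : k.-tuple X => (\prod_(i < k) g i (tnth t i))%:E).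
  move=> mg; apply/measurable_EFinP; apply: measurable_prod => i _.
  exact: measurableT_comp (mg i) (measurable_tnth i).
pose phi z : \bar R := (\prod_(i < n.+1) h i (tnth (@cons_pair R n z) i))%:E.
have mphi : measurable_fun setT phi.
  exact: measurableT_comp (mprod _ _ mh) (@measurable_cons_pair R n).
transitivity (\int[normal_prob 0 1 \x gaussian_tuple n]_z phi z).
  apply/esym/(@ge0_integral_image _ _ _ _ R (normal_prob 0 1 \x gaussian_tuple n)
    (gaussian_tuple n.+1) (@cons_pair R n)) => //.
  - exact: mprod.
  - by move=> x; rewrite lee_fin; apply: prodr_ge0 => i _.
have phi0 z : 0 <= phi z by rewrite lee_fin; apply: prodr_ge0 => i _.
rewrite (@product_probability_tonelli1 _ _ _ _ _ (normal_prob 0 1) (gaussian_tuple n) phi)//.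
rewrite big_ord_recl.
have hl0 i v : (0 <= h (lift ord0 i) v)%R by [].
transitivity (\int[normal_prob 0 1]_x ((h ord0 x)%:E *
    \prod_(i < n) \int[normal_prob 0 1]_v (h (lift ord0 i) v)%:E)).
  apply: eq_integral => x _.
  rewrite -IH// -ge0_integralZl//=.
  - apply: eq_integral => t _; rewrite /phi big_ord_recl tnth0 -EFinM.
    congr (_ * _)%:E; apply: eq_bigr => i _; congr (h _ _); exact: tnthS.
  - exact: (mprod n (fun i => h (lift ord0 i))).
  - by move=> t _; rewrite lee_fin prodr_ge0.
  - by rewrite lee_fin.
rewrite ge0_integralZr//.
- by apply/measurable_EFinP; exact: mh.
- by move=> x _; rewrite lee_fin.
- by apply: prode_ge0 => i _; apply: integral_ge0 => v _; rewrite lee_fin.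
Qed.

Lemma gaussian_tuple_coord n (h : R -> R) (i : 'I_n) :
  measurable_fun setT h -> (forall v, 0 <= h v)%R ->
  \int[gaussian_tuple n]_t (h (tnth t i))%:E = \int[normal_prob 0 1]_v (h v)%:E.
Proof.
move=> mh h0.
pose g (j : 'I_n) v : R := if j == i then h v else 1%R.
transitivity (\int[gaussian_tuple n]_t (\prod_(j < n) g j (tnth t j))%:E).
  apply: eq_integral => t _; rewrite (bigD1 i)//= big1 ?mulr1 /g ?eqxx//.
  by move=> j /negbTE ->.
rewrite gaussian_tuple_prod.
- rewrite (bigD1 i)//= big1 ?mule1/g ?eqxx//.
  by move=> j /negbTE ->; rewrite integral_cst//= probability_setT mul1e.
- by move=> j; rewrite /g; case: eqP.
- by move=> j v; rewrite /g; case: eqP.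
Qed.

Lemma gaussian_tuple_sqlen n : \int[gaussian_tuple n]_x (sqlen x)%:E = n%:R%:E :> \bar R.
Proof.
under eq_integral do rewrite /sqlen -sumEFin.
rewrite ge0_integral_sum//; last 2 first.
- move=> i; apply/measurable_EFinP/measurable_funX; exact: measurable_tnth.
- by move=> i x _; rewrite lee_fin sqr_ge0.
rewrite (eq_bigr (fun=> 1)).
  by rewrite sumEFin sumr_const card_ord.
move=> i _; rewrite (@gaussian_tuple_coord n (fun v => v ^+ 2)%R)//.
- by rewrite normal_second_moment// expr1n.
by move=> v; rewrite sqr_ge0.
Qed.

End gaussian_product.

(** Integrating the logarithm of the density bound gives [n * (1 - ln lam) - I <= k / lam], where
    [k] is the integral of [K]. For the chosen [lam] this reads [n * lam <= k], which goes into the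
    cost inequality. *)
Lemma entropy_transport_tuple (R : realType) n (f : n.-tuple (measurableTypeR R) -> R)
    (nu : probability (n.-tuple (measurableTypeR R)) R) (h m : R) : (0 < n)%N ->
  has_density nu (gaussian_tuple n) f ->
  nu.-integrable setT (fun x => (ln (f x))%:E) ->
  (\int[nu]_x (ln (f x))%:E = h%:E)%E -> (\int[nu]_x (sqlen x)%:E = m%:E)%E ->
  exists pi : probability (n.-tuple (measurableTypeR R) * n.-tuple (measurableTypeR R))%type R,
   [/\ forall A, measurable A -> pi (fst @^-1` A) = gaussian_tuple n A,
      forall A, measurable A -> pi (snd @^-1` A) = nu A &
      (\int[pi]_z (sqdist z.1 z.2)%:E <=
      (n%:R + m - 2 * n%:R * expR (- ((h + (n%:R - m) / 2) / n%:R)))%:E)%E].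
Proof.
move=> n0 nuf ilnf hE mE; have nr0 : 0 < n%:R :> R by rewrite ltr0n.
set I := h + _; set lam := expR (- (I / n%:R)).
have lam0 : 0 < lam by exact: expR_gt0.
have [pi [K [pi1 pi2 [mK K0] bound cost]]] := ex_tuple_coupling lam0 nuf.
exists pi; split => //.
have [mf f0 _] := nuf.
have msq k : measurable_fun setT (fun x : k.-tuple (measurableTypeR R) => (sqlen x)%:E).
  by apply/measurable_EFinP; exact: measurable_sqlen.
have sq1 : (\int[pi]_z (sqlen z.1)%:E = n%:R%:E)%E.
  rewrite -gaussian_tuple_sqlen -(@ge0_integral_image _ _ _ _ R pi _ fst _ pi1 (fun x => (sqlen x)%:E))//.
    exact: msq.
  by move=> x; rewrite lee_fin sqlen_ge0.
have sq2 : (\int[pi]_z (sqlen z.2)%:E = m%:E)%E.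
  rewrite -mE -(@ge0_integral_image _ _ _ _ R pi _ snd _ pi2 (fun x => (sqlen x)%:E))//.
    exact: msq.
  by move=> x; rewrite lee_fin sqlen_ge0.
have int (g : _ -> R) : measurable_fun setT g -> (forall z, 0 <= g z) ->
    (\int[pi]_z (g z)%:E < +oo)%E -> pi.-integrable setT (EFin \o g).
  move=> mg g0 gfin; apply/integrableP; split; first exact/measurable_EFinP.
  by rewrite (eq_integral (EFin \o g))// => x _; rewrite /= ger0_norm.
have i1 : pi.-integrable setT (fun z => (sqlen z.1)%:E).
  apply: (int (fun z => sqlen z.1)).
  - exact: measurableT_comp (@measurable_sqlen R n) measurable_fst.
  - by move=> z; exact: sqlen_ge0.
  - by rewrite sq1 ltry.
have i2 : pi.-integrable setT (fun z => (sqlen z.2)%:E).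
  apply: (int (fun z => sqlen z.2)).
  - exact: measurableT_comp (@measurable_sqlen R n) measurable_snd.
  - by move=> z; exact: sqlen_ge0.
  - by rewrite sq2 ltry.
(* The right side of the cost inequality is finite, which forces both nonnegative terms on the left
   to be finite; the rest is real arithmetic. *)
have [k kE [c cE]] : exists2 k, (\int[pi]_z (K z)%:E = k%:E)%E &
    exists c, (\int[pi]_z (sqdist z.1 z.2)%:E = c%:E)%E.
  move: cost; rewrite mE.
  have : (0 <= \int[pi]_z (K z)%:E)%E by apply: integral_ge0 => z _; rewrite lee_fin.
  have : (0 <= \int[pi]_z (sqdist z.1 z.2)%:E)%E.
    by apply: integral_ge0 => z _; rewrite lee_fin sqdist_ge0.
  case: (\int[pi]_z (K z)%:E)%E => [k| |]//; case: (\int[pi]_z (sqdist _ _)%:E)%E => [c| |]//.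
  - by move=> _ _ _; exists k => //; exists c.
  - by rewrite gt0_muley// addye// leye_eq.
  - by rewrite gt0_muley// addye// leye_eq.
have iK : pi.-integrable setT (EFin \o K) by apply: int => //; rewrite kE ltry.
rewrite kE cE mE -EFinM -!EFinD !lee_fin in cost *.
suff : n%:R * lam <= k by move: cost; lra.
have ilnf2 : pi.-integrable setT (fun z => (ln (f z.2))%:E).
  apply/(@integrable_image _ _ _ _ R pi nu snd _ pi2 (fun y => (ln (f y))%:E)) => //.
  by apply/measurable_EFinP; exact: measurableT_comp.
have lnf2 : (\int[pi]_z (ln (f z.2))%:E = h%:E)%E.
  rewrite -hE (@integral_image _ _ _ _ R pi nu snd _ pi2 (fun y => (ln (f y))%:E))//.
  by apply/measurable_EFinP; exact: measurableT_comp.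
pose C := n%:R * (1 - ln lam).
have : (\int[pi]_z ((2^-1)%:E * (sqlen z.2)%:E + C%:E) <=
    \int[pi]_z ((ln (f z.2))%:E + ((2^-1)%:E * (sqlen z.1)%:E + (lam^-1)%:E * (K z)%:E)))%E.
  have ic : pi.-integrable setT (fun=> C%:E) by exact: finite_measure_integrable_cst.
  apply: ae_le_integral.
  - by apply: integrableD => //; exact: integrableZl.
  - by apply: integrableD => //; apply: integrableD => //; exact: integrableZl.
  - apply: ae_imp bound => z hz; rewrite -!EFinM -!EFinD lee_fin.
    have fz : 0 < f z.2 by rewrite (lt_le_trans _ hz)// expR_gt0.
    have : (sqlen z.2 - sqlen z.1) / 2 + C - K z / lam <= ln (f z.2).
      by rewrite -[leLHS]expRK ler_ln ?posrE ?expR_gt0.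
    by rewrite mulrC; lra.
have ic : pi.-integrable setT (fun=> C%:E) by exact: finite_measure_integrable_cst.
rewrite integralD//; last exact: integrableZl.
rewrite integralD//; last by apply: integrableD => //; exact: integrableZl.
rewrite integralD//; [|exact: integrableZl..].
have -> : (\int[pi]__ C%:E = C%:E)%E.
  by rewrite integral_cst// [X in (_ * X)%E]probability_setT mule1.
rewrite !integralZl// sq1 sq2 lnf2 [integral pi setT _]kE -!EFinM -!EFinD lee_fin.
rewrite /C /lam expRK -/lam => H.
have : n%:R <= lam^-1 * k.
  have : n%:R * (1 - - (I / n%:R)) = n%:R + I by field; rewrite gt_eqF.
  by move=> E; move: H; rewrite E /I; lra.
by move=> /(ler_wpM2l (ltW lam0)); rewrite mulVKf ?gt_eqF// mulrC.
Qed.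

Section row_vectors.
Context (R : realType) (d : nat).
Notation X := (measurableTypeR R).
Implicit Types mu : probability 'rV[R]_d R.

Lemma measurable_continuous_row (f : 'rV[R]_d -> R) :
  continuous f -> measurable_fun setT f.
Proof.
move=> /continuousP cf; apply: (measurability _ (RGenOpens.measurableE R)).
move=> _ [_ [a [b ->] <-]]; rewrite setTI.
apply: sub_sigma_algebra; apply: cf; exact: interval_open.
Qed.

Lemma measurable_coord i : measurable_fun setT (fun x : 'rV[R]_d => x ord0 i).
Proof. by apply: measurable_continuous_row; exact: coord_continuous. Qed.

Lemma measurable_sqnorm : measurable_fun setT (@sqnorm R d).
Proof.
by apply: measurable_sum => i; apply: measurable_funX; exact: measurable_coord.
Qed.

Lemma sqnorm_ge0 (x : 'rV[R]_d) : 0 <= sqnorm x.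
Proof. by apply: sumr_ge0 => i _; exact: sqr_ge0. Qed.

Definition tuple_of_row (x : 'rV[R]_d) : d.-tuple X := [tuple x ord0 i | i < d].

Lemma row_of_tupleK : cancel (@row_of_tuple R d) tuple_of_row.
Proof. by move=> t; apply: eq_from_tnth => i; rewrite tnth_mktuple mxE. Qed.

Lemma tuple_of_rowK : cancel tuple_of_row (@row_of_tuple R d).
Proof. by move=> x; apply/rowP => i; rewrite mxE tnth_mktuple. Qed.

Lemma measurable_tuple_of_row : measurable_fun setT tuple_of_row.
Proof.
apply/measurable_fun_tnthP => i.
rewrite (_ : _ \o _ = fun x : 'rV[R]_d => x ord0 i); first exact: measurable_coord.
by apply/funext => x /=; rewrite tnth_mktuple.
Qed.

Lemma sqlen_tuple_of_row x : sqlen (tuple_of_row x) = sqnorm x.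
Proof. by apply: eq_bigr => i _; rewrite tnth_mktuple. Qed.

Lemma sqdist_tuple_of_row (s t : d.-tuple X) :
  sqdist s t = sqnorm (row_of_tuple s - row_of_tuple t).
Proof. by apply: eq_bigr => i _; rewrite !mxE. Qed.

Lemma ge0_integral_std_gaussian (h : 'rV[R]_d -> \bar R) :
  measurable_fun setT h -> (forall x, 0 <= h x)%E ->
  (\int[std_gaussian R d]_x h x = \int[gaussian_tuple d]_t h (row_of_tuple t))%E.
Proof. by move=> mh h0; rewrite ge0_integral_distribution. Qed.

Lemma std_gaussian_prod (h : 'I_d -> R -> R) :
  (forall i, measurable_fun setT (h i)) -> (forall i v, 0 <= h i v) ->
  (\int[std_gaussian R d]_x (\prod_(i < d) h i (x ord0 i))%:E =
  \prod_(i < d) \int[normal_prob 0 1]_v (h i v)%:E)%E.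
Proof.
move=> mh h0; rewrite -gaussian_tuple_prod// ge0_integral_std_gaussian.
- apply: eq_integral => t _; congr EFin; apply: eq_bigr => i _.
  by rewrite mxE.
- apply/measurable_EFinP; apply: measurable_prod => i _.
  exact: measurableT_comp (mh i) (measurable_coord i).
- by move=> x; rewrite lee_fin prodr_ge0.
Qed.

Lemma m2_std_gaussian : m2 (std_gaussian R d) = d%:R%:E.
Proof.
rewrite /m2 ge0_integral_std_gaussian.
- rewrite -gaussian_tuple_sqlen; apply: eq_integral => t _.
  by rewrite -sqlen_tuple_of_row row_of_tupleK.
- by apply/measurable_EFinP; exact: measurable_sqnorm.
- by move=> x; rewrite lee_fin sqnorm_ge0.
Qed.

Lemma has_density_tuple mu F : has_density mu (std_gaussian R d) F ->
  exists2 nu : probability (d.-tuple X) R,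
    has_density nu (gaussian_tuple d) (F \o @row_of_tuple R d) &
    forall B, measurable B -> mu (tuple_of_row @^-1` B) = nu B.
Proof.
move=> [mF F0 muE].
pose T : {mfun 'rV[R]_d >-> d.-tuple X} := mfun_Sub (mem_set measurable_tuple_of_row).
exists (distribution mu T) => //; split => //.
  exact: measurableT_comp mF (@measurable_row_of_tuple R d).
  by move=> x; exact: F0.
move=> A mA; transitivity (mu (tuple_of_row @^-1` A)) => //.
have mA' : measurable (tuple_of_row @^-1` A).
  by rewrite -[X in measurable X]setTI; exact: measurable_tuple_of_row.
rewrite muE//.
rewrite integral_mkcond [RHS]integral_mkcond ge0_integral_std_gaussian.
- apply: eq_integral => t _; rewrite !patchE.
  rewrite (_ : (row_of_tuple t \in tuple_of_row @^-1` A) = (t \in A))//.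
  by apply/idP/idP; rewrite !inE/= row_of_tupleK.
- have mF' : measurable_fun (tuple_of_row @^-1` A) (EFin \o F).
    by apply/measurable_funTS/measurable_EFinP.
  exact: ((measurable_restrictT (EFin \o F) mA').1 mF').
- by move=> x; rewrite erestrict_ge0// => y _; rewrite lee_fin.
Qed.

Lemma entropy_transport mu F (h m : R) : (0 < d)%N ->
  has_density mu (std_gaussian R d) F ->
  mu.-integrable setT (fun x => (ln (F x))%:E) ->
  (\int[mu]_x (ln (F x))%:E = h%:E)%E -> m2 mu = m%:E ->
  (W2sq (std_gaussian R d) mu <=
   (d%:R + m - 2 * d%:R * expR (- ((h + (d%:R - m) / 2) / d%:R)))%:E)%E.
Proof.
move=> d0 muF ilnF hE mE; have [mF F0 _] := muF.
have [nu nuF munu] := has_density_tuple muF.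
have mlnF : measurable_fun setT (fun t => (ln (F (@row_of_tuple R d t)))%:E).
  apply/measurable_EFinP; apply: measurableT_comp => //.
  exact: measurableT_comp mF (@measurable_row_of_tuple R d).
have msq : measurable_fun setT (fun t => (@sqlen R d t)%:E).
  by apply/measurable_EFinP; exact: measurable_sqlen.
have mT := measurable_tuple_of_row.
have [||| pi [pi1 pi2 pi_le]] := entropy_transport_tuple (h := h) (m := m) d0 nuF.
- apply/(@integrable_image _ _ _ _ R mu nu tuple_of_row mT munu _ mlnF).
  by apply: eq_integrable ilnF => // x _ /=; rewrite tuple_of_rowK.
- rewrite -hE -(@integral_image _ _ _ _ R mu nu tuple_of_row mT munu _ mlnF).
  by apply: eq_integral => x _ /=; rewrite tuple_of_rowK.
- rewrite -mE -(@ge0_integral_image _ _ _ _ R mu nu tuple_of_row mT munu _ msq).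
  + by apply: eq_integral => x _ /=; rewrite sqlen_tuple_of_row.
  + by move=> x; rewrite lee_fin sqlen_ge0.
rewrite /W2sq asboolT; last first.
  by rewrite /finite_m2 m2_std_gaussian mE !ltry.
have mphi : measurable_fun setT
    (fun z : d.-tuple X * d.-tuple X => (row_of_tuple z.1, row_of_tuple z.2)).
  apply: measurable_fun_pair.
    exact: measurableT_comp (@measurable_row_of_tuple R d) measurable_fst.
  exact: measurableT_comp (@measurable_row_of_tuple R d) measurable_snd.
pose phi : {mfun (d.-tuple X * d.-tuple X)%type >-> ('rV[R]_d * 'rV[R]_d)%type} :=
  mfun_Sub (mem_set mphi).
apply: le_trans pi_le; apply: ereal_inf_lbound.
exists (distribution pi phi).
- split=> A mA.
  + transitivity (pi (fst @^-1` (@row_of_tuple R d @^-1` A))) => //.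
    rewrite pi1// -[X in measurable X]setTI; exact: measurable_row_of_tuple.
  + transitivity (pi (snd @^-1` (@row_of_tuple R d @^-1` A))) => //.
    have mA' : measurable (@row_of_tuple R d @^-1` A).
      by rewrite -[X in measurable X]setTI; exact: measurable_row_of_tuple.
    rewrite pi2// -munu//; congr (mu _).
    by apply/seteqP; split => x /=; rewrite tuple_of_rowK.
- rewrite ge0_integral_distribution.
  + by apply: eq_integral => z _ /=; rewrite sqdist_tuple_of_row.
  + apply/measurable_EFinP; apply: measurable_sum => i; apply: measurable_funX.
    rewrite (_ : (fun _ => _) = fun z : 'rV[R]_d * 'rV[R]_d => z.1 ord0 i - z.2 ord0 i).
      apply: measurable_funB.
        exact: measurableT_comp (measurable_coord i) measurable_fst.
      exact: measurableT_comp (measurable_coord i) measurable_snd.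
    by apply/funext => z; rewrite !mxE.
  + by move=> z; rewrite lee_fin sqnorm_ge0.
Qed.

End row_vectors.

(** * Comparison of the cosine with a Gaussian *)

Section cosine_gaussian.
Context (R : realType).

(** The difference of the two sides vanishes at 0 and has derivative [t * sin t]. *)
Lemma xcos_le_sin (x : R) : 0 <= x <= pi -> x * cos x <= sin x.
Proof.
move=> /andP[x0 xpi]; pose g (t : R) := sin t - t * cos t.
have dg (t : R) : is_derive t 1 g (t * sin t).
  rewrite (_ : t * sin t = cos t - (t * (- sin t) + cos t * 1)); last by ring.
  exact: is_deriveB.
have : g 0 <= g x.
  apply: (@ger0_derive1_le_cc _ g 0 pi) => //; rewrite ?in_itv/= ?x0 ?xpi ?lexx ?pi_ge0//.
  - move=> t; rewrite in_itv/= => /andP[t0 tpi].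
    rewrite derive1E (@derive_val _ _ _ _ _ _ _ (dg t)).
    by apply: mulr_ge0; [exact: ltW|apply: sin_ge0_pi; rewrite !ltW].
  - apply: continuous_subspaceT => t.
    exact/differentiable_continuous/derivable1_diffP/(@ex_derive _ _ _ _ _ _ _ (dg t)).
by rewrite /g sin0 mul0r subrr subr_ge0.
Qed.

(** The product [cos t * expR (t ^+ 2 / 2)] is 1 at 0, and its derivative has the sign of
    [t * cos t - sin t]. *)
Lemma cos_le_gauss (x : R) : 0 <= x <= pi -> cos x <= expR (- (x ^+ 2 / 2)).
Proof.
move=> /andP[x0 xpi]; pose g (t : R) := cos t * expR (t ^+ 2 / 2).
have dg (t : R) : is_derive t 1 g (expR (t ^+ 2 / 2) * (t * cos t - sin t)).
  by apply: is_derive_eq; rewrite !scaler0 ?addr0 /GRing.scale/=; field.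
have : g x <= g 0.
  apply: (@ler0_derive1_le_cc _ g 0 pi) => //; rewrite ?in_itv/= ?x0 ?xpi ?lexx ?pi_ge0//.
  - move=> t; rewrite in_itv/= => /andP[t0 tpi].
    rewrite derive1E (@derive_val _ _ _ _ _ _ _ (dg t)).
    rewrite mulr_ge0_le0 ?expR_ge0// subr_le0 xcos_le_sin//.
    by rewrite !ltW.
  - apply: continuous_subspaceT => t.
    exact/differentiable_continuous/derivable1_diffP/(@ex_derive _ _ _ _ _ _ _ (dg t)).
rewrite /g cos0 expr0n/= mul0r expR0 mulr1.
by move=> H; rewrite expRN -[leRHS]mul1r ler_pdivlMr// expR_gt0.
Qed.

End cosine_gaussian.

Lemma fun_I_finite (R : realType) d (mu : probability 'rV[R]_d R) :
  (fun_I mu < +oo)%E ->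
  exists F h m, [/\ has_density mu (std_gaussian R d) F,
    mu.-integrable setT (fun x => (ln (F x))%:E),
    (\int[mu]_x (ln (F x))%:E = h%:E)%E, m2 mu = m%:E &
    [/\ m <= d%:R, m1 mu = 0 & fun_I mu = (h + (d%:R - m) / 2)%:E]].
Proof.
rewrite /fun_I; case: asboolP => [[f2 le2 m10]|_]; last by rewrite ltxx.
have m20 : (0 <= m2 mu)%E by apply: integral_ge0 => x _; rewrite lee_fin sqnorm_ge0.
have [m mE] : exists m, m2 mu = m%:E.
  by move: m20 f2; rewrite /finite_m2; case: (m2 mu) => // m _ _; exists m.
rewrite mE -EFinB -EFinM => H.
have Hfin : (relative_entropy mu (std_gaussian R d) < +oo)%E.
  by move: H; case: (relative_entropy _ _) => //= r _; rewrite ltry.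
have [F muF ilnF] := ex_entropy_density Hfin.
exists F, (fine (\int[mu]_x (ln (F x))%:E)%E), m.
have hE : (\int[mu]_x (ln (F x))%:E)%E \is a fin_num by exact: integrable_fin_num.
split => //; rewrite ?fineK//.
split => //; first by move: le2; rewrite mE.
 rewrite (relative_entropyE muF) -[X in (X + _)%E]fineK// -EFinD.
by congr (_ + _)%:E; rewrite mulrC.
Qed.

(** Let [a] be the value of [asin] at [q]. The cost bound says that [expR (- (I / d))] is at most
    [1 - 2 * q ^+ 2], which is the cosine of [2 * a]; comparing this cosine with a Gaussian gives
    [2 * d * a ^+ 2 <= I]. *)
Lemma alpha_W2sq_le_fun_I (R : realType) d (mu : probability 'rV[R]_d R) : (0 < d)%N ->
  (alpha d (W2sq (std_gaussian R d) mu) <= fun_I mu)%E.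
Proof.
move=> d0; have dr0 : 0 < d%:R :> R by rewrite ltr0n.
have [Ioo|] := ltP (fun_I mu) +oo%E; last first.
  by rewrite leye_eq => /eqP ->; rewrite leey.
have [F [h [m [muF ilnF hE mE [md _ IE]]]]] := fun_I_finite Ioo.
have := entropy_transport d0 muF ilnF hE mE.
have W0 : (0 <= W2sq (std_gaussian R d) mu)%E.
  rewrite /W2sq; case: ifP => // _; apply: le_ereal_inf_tmp => _ [pi _ <-].
  by apply: integral_ge0 => z _; rewrite lee_fin sqnorm_ge0.
rewrite IE; set I := h + _; move: W0.
case: (W2sq _ _) => [w| |]//; rewrite !lee_fin => w0 w1.
have e0 := expR_gt0 (- (I / d%:R)).
have w2 : w <= 2 * d%:R * (1 - expR (- (I / d%:R))) by move: w1; lra.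
(* Positivity of the exponential places [w] in the range where [alpha] is finite. *)
have w4 : w <= 4 * d%:R.
  by apply: (le_trans w2); have := mulr_gt0 dr0 e0; lra.
rewrite /alpha ifT; last by rewrite !lee_fin w0/= natrM.
rewrite /= lee_fin; set q := Num.sqrt w / _.
have q0 : 0 <= q by rewrite divr_ge0 ?sqrtr_ge0// mulr_ge0// sqrtr_ge0.
have q2 : q ^+ 2 = w / (4 * d%:R).
  rewrite /q expr_div_n exprMn (sqr_sqrtr w0) (sqr_sqrtr (ltW dr0)).
  by field; rewrite gt_eqF.
have q1 : q <= 1.
  rewrite -(@expr_le1 _ 2)// q2 ler_pdivrMr ?mulr_gt0// mul1r//.
have qI : -1 <= q <= 1 by rewrite q1 andbT (le_trans _ q0)// lerN10.
have [/andP[aN api] sina] := asin_def qI.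
set a := asin q in api sina *.
have a0 : 0 <= a.
  by rewrite leNgt; apply/negP => an; have := q0; rewrite -sina leNgt -sin0 ltr_sin ?an//;
    rewrite in_itv/= ?aN ?api// oppr_le0 divr_ge0 ?pi_ge0.
have c2 : cos (a *+ 2) = 1 - 2 * q ^+ 2.
  by rewrite cos_mulr2n cos2sin2 sina; ring.
have : expR (- (I / d%:R)) <= expR (- ((a *+ 2) ^+ 2 / 2)).
  apply: (@le_trans _ _ (cos (a *+ 2))).
    rewrite c2 q2; have : w / d%:R <= 2 * (1 - expR (- (I / d%:R))).
      by rewrite ler_pdivrMr// mulrAC.
    by rewrite invfM mulrCA; lra.
  apply: cos_le_gauss.
  by rewrite mulr2n; apply/andP; split; lra.
rewrite ler_expR lerN2 => H.
have := ler_wpM2r (ltW dr0) H; rewrite mulfVK ?gt_eqF//.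
by move=> /(le_trans _); apply; rewrite le_eqVlt; apply/orP; left; apply/eqP; rewrite -mulr_natr; field.
Qed.

(** * Lower semicontinuity *)

Lemma bounded_cvg_L1 d (T : measurableType d) (R : realType) (P : probability T R)
    (g_ : nat -> T -> R) (g : T -> R) (M : R) :
  (forall n, measurable_fun setT (g_ n)) -> measurable_fun setT g ->
  (forall n x, `|g_ n x| <= M) -> (forall x, g_ n x @[n --> \oo] --> g x) ->
  forall e, 0 < e ->
  \forall n \near \oo, (\int[P]_x (`|g x - g_ n x|)%:E <= e%:E)%E.
Proof.
move=> mg_ mg gM cvg e e0.
have [||||| _ + _] := @dominated_convergence _ T R P setT measurableT
    (fun n x => (g_ n x)%:E) (fun x => (g x)%:E) (fun=> M%:E).
- by move=> n; exact/measurable_EFinP.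
- exact/measurable_EFinP.
- by apply: aeW => x _; apply: cvg_EFin; [exact: nearW|exact: cvg].
- exact: finite_measure_integrable_cst.
- by apply: aeW => x n _; rewrite lee_fin.
move=> /(_ (fun u => (u < e%:E)%E)) h.
have : \forall n \near \oo,
    (\int[P]_x `|(g_ n x)%:E - (g x)%:E| < e%:E)%E.
  by apply: h; apply: open_ereal_lt'; rewrite lte_fin.
apply: filterS => n hn; apply: ltW; apply: le_lt_trans hn.
rewrite le_eqVlt; apply/orP; left; apply/eqP; apply: eq_integral => x _.
by rewrite -EFinB /= distrC.
Qed.

Lemma continuous_sum_ord (T : topologicalType) (R : realType) n (f : 'I_n -> T -> R) :
  (forall i, continuous (f i)) -> continuous (fun x => \sum_(i < n) f i x).
Proof.
elim: n f => [|n IH] f cf x.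
  by rewrite (_ : (fun _ => _) = cst 0); [exact: cvg_cst|apply/funext => y; rewrite big_ord0].
rewrite (_ : (fun _ => _) = (fun y => \sum_(i < n) f (widen_ord (leqnSn n) i) y) \+ f ord_max).
  by apply: continuousD; [exact: IH|exact: cf].
by apply/funext => y; rewrite big_ord_recr.
Qed.

(** * Approximation of bounded measurable functions by continuous ones *)

Section distance_to_closed.
Context (R : realType) (d : nat).
Notation V := 'rV[R]_d.

Let l1 (x y : V) : R := \sum_(i < d) `|x ord0 i - y ord0 i|.

Let l1_ge0 x y : 0 <= l1 x y.
Proof. exact: sumr_ge0. Qed.

Let l1xx x : l1 x x = 0.
Proof. by rewrite /l1 big1// => i _; rewrite subrr normr0. Qed.

Let l1C x y : l1 x y = l1 y x.
Proof. by apply: eq_bigr => i _; rewrite distrC. Qed.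

Let l1_triangle y x z : l1 x z <= l1 x y + l1 y z.
Proof.
rewrite /l1 -big_split/=; apply: ler_sum => i _.
by rewrite (le_trans _ (ler_normD _ _))// addrA subrK.
Qed.

Let continuous_l1 x : continuous (l1 x).
Proof.
apply: continuous_sum_ord => i y.
apply: (@continuous_comp _ _ _ (fun y : V => x ord0 i - y ord0 i) Num.norm).
  by apply: continuousB; [exact: cst_continuous|exact: coord_continuous].
exact: norm_continuous.
Qed.

Variable C : set V.

(** The extra element 1 keeps the set nonempty when [C] is empty and caps the distance at 1. *)
Let S x : set R := 1 |` [set l1 x y | y in C].

Let dist x : R := inf (S x).

Let S_lb x : has_lbound (S x).
Proof. by exists 0 => _ [->//|[y _ <-]]. Qed.

Let S_neq0 x : S x !=set0.
Proof. by exists 1; left. Qed.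

Let dist01 x : 0 <= dist x <= 1.
Proof.
apply/andP; split; last by apply: ge_inf => //; left.
by apply: lb_le_inf => // _ [->//|[y _ <-]].
Qed.

Let dist_lip x x' : dist x - l1 x x' <= dist x'.
Proof.
apply: lb_le_inf => // _ [->|[y Cy <-]].
  by rewrite lerBlDr (le_trans (proj2 (andP (dist01 x))))// lerDl.
rewrite lerBlDr addrC (le_trans _ (l1_triangle _ _ _))//.
by apply: ge_inf => //; right; exists y.
Qed.

Let continuous_dist : continuous dist.
Proof.
suff h (x : V) : {for x, continuous dist} by move=> x; exact: h.
have Fx : Filter (nbhs x) := nbhs_filter x.
apply/(@cvgrPdist_lt _ _ _ (nbhs x) Fx) => e e0.
have cx : {for x, continuous (l1 x)} by exact: continuous_l1.
have := (@cvgrPdist_lt _ _ _ (nbhs x) Fx _ _).1 cx e e0.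
rewrite l1xx; apply: filterS => y.
rewrite sub0r normrN ger0_norm// => xy.
rewrite (le_lt_trans _ xy)// ler_norml; apply/andP; split.
  by have := dist_lip y x; rewrite l1C; lra.
by have := dist_lip x y; lra.
Qed.

Let dist_in x : C x -> dist x = 0.
Proof.
move=> Cx; apply/eqP; rewrite eq_le (proj1 (andP (dist01 x))) andbT.
by apply: ge_inf => //; right; exists x.
Qed.

Let dist_out x : closed C -> ~ C x -> 0 < dist x.
Proof.
move=> cC nCx; have oC : open (~` C) by exact: closed_openC.
have : nbhs x (~` C) by apply: open_nbhs_nbhs; split.
move=> /nbhs_ballP[e /= e0 eC].
apply: (@lt_le_trans _ _ (Num.min e 1)); first by rewrite lt_min e0 ltr01.
apply: lb_le_inf => // _ [->|[y Cy <-]]; first by rewrite ge_min lexx orbT.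
rewrite ge_min; apply/orP; left; rewrite leNgt; apply/negP => xy.
apply: (eC y) Cy; split => // i j; rewrite (ord1 i) -ball_normE /=.
rewrite (le_lt_trans _ xy)// /l1 (bigD1 j)//= lerDl.
exact: sumr_ge0.
Qed.

(** With the capped distance, [1 - (1 - dist x) ^+ n] is 0 on [C] and tends to 1 elsewhere, because
    [0 < dist x <= 1] off a closed set. *)
Lemma ex_continuous_to_indic : closed C -> exists h : nat -> V -> R,
  [/\ forall n, continuous (h n), forall n x, `|h n x| <= 1 &
    forall x, h n x @[n --> \oo] --> (\1_(~` C) x : R)].
Proof.
move=> cC; exists (fun n x => 1 - (1 - dist x) ^+ n); split.
- move=> n x.
  apply: (@continuous_comp _ _ _ dist (fun t => 1 - (1 - t) ^+ n)).
    exact: continuous_dist.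
  apply: continuousB; first exact: cst_continuous.
  apply: (@continuous_comp _ _ _ (fun t : R => 1 - t) (fun t => t ^+ n)); last exact: exprn_continuous.
  by apply: continuousB; [exact: cst_continuous|exact: cvg_id].
- move=> n x; have /andP[d0 d1] := dist01 x.
  have e0 : 0 <= (1 - dist x) ^+ n by rewrite exprn_ge0// subr_ge0.
  have e1 : (1 - dist x) ^+ n <= 1 by rewrite exprn_ile1 ?subr_ge0// gerBl.
  by rewrite ger0_norm; lra.
- move=> x; have /andP[d0 d1] := dist01 x; rewrite indicE.
  have [Cx|nCx] := pselect (C x).
    rewrite memNset/=; last by apply.
    rewrite dist_in//; under eq_fun do rewrite subr0 expr1n subrr.
    exact: cvg_cst.
  rewrite mem_set//= -[X in _ --> X]subr0; apply: cvgB; first exact: cvg_cst.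
  apply: cvg_expr; rewrite ger0_norm ?subr_ge0// ltrBlDr ltrDl.
  exact: dist_out.
Qed.

End distance_to_closed.

Section continuous_approximation.
Context (R : realType) (d : nat).
Notation V := 'rV[R]_d.
Variable P : bool -> probability V R.

(** Closeness is required for two laws at once, because the Donsker-Varadhan functional integrates
    its test function against both. *)
Let close (e : R) (g h : V -> R) : Prop :=
  forall b, (\int[P b]_x (`|g x - h x|)%:E <= e%:E)%E.

Let measurable_dist (u v : V -> R) : measurable_fun setT u -> measurable_fun setT v ->
  measurable_fun setT (fun x => (`|u x - v x|)%:E).
Proof.
by move=> mu mv; apply/measurable_EFinP; apply: measurableT_comp => //; exact: measurable_funB.
Qed.

Let close_trans e1 e2 (g h k : V -> R) : measurable_fun setT g ->
  measurable_fun setT h -> measurable_fun setT k ->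
  close e1 g h -> close e2 h k -> close (e1 + e2) g k.
Proof.
move=> mg mh mk gh hk b; rewrite EFinD.
apply: le_trans (leeD (gh b) (hk b)).
rewrite -ge0_integralD//; [|exact: measurable_dist..].
apply: ge0_le_integral => //; first exact: measurable_dist.
- by apply: emeasurable_funD; exact: measurable_dist.
- by move=> x _; rewrite -EFinD lee_fin (le_trans _ (ler_normD _ _))// addrA subrK.
Qed.

(** The bound on [h] is not tied to that of [g] along the construction; a final truncation restores
    it. *)
Let approx (g : V -> R) : Prop := measurable_fun setT g /\
  forall e : R, 0 < e -> exists h : V -> R,
    [/\ continuous h, exists M : R, forall x, `|h x| <= M & close e g h].

Let approx_close (g : V -> R) : measurable_fun setT g ->
  (forall e : R, 0 < e -> exists2 k, approx k & close e g k) -> approx g.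
Proof.
move=> mg H; split => // e e0; have e20 : 0 < e / 2 by rewrite divr_gt0.
have [k [mk /(_ _ e20)[h [ch hM kh]]] gk] := H _ e20.
exists h; split => //; rewrite [e]splitr.
by apply: close_trans gk kh => //; exact: measurable_continuous_row.
Qed.

Let approx_cvg (g_ : nat -> V -> R) (g : V -> R) (M : R) : measurable_fun setT g ->
  (forall n, approx (g_ n)) -> (forall n x, `|g_ n x| <= M) ->
  (forall x, g_ n x @[n --> \oo] --> g x) -> approx g.
Proof.
move=> mg ag gM cg; apply: approx_close => // e e0.
have mg_ n : measurable_fun setT (g_ n) by case: (ag n).
have [n [h1 h2]] : exists n,
    (\int[P true]_x (`|g x - g_ n x|)%:E <= e%:E)%E /\
    (\int[P false]_x (`|g x - g_ n x|)%:E <= e%:E)%E.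
  have Ht := bounded_cvg_L1 (P true) mg_ mg gM cg e0.
  have Hf := bounded_cvg_L1 (P false) mg_ mg gM cg e0.
  have [n _ /(_ n (leqnn n))] := filterI Ht Hf.
  by exists n.
by exists (g_ n) => //; case.
Qed.

Let approx_continuous (g : V -> R) (M : R) : continuous g -> (forall x, `|g x| <= M) -> approx g.
Proof.
move=> cg gM; split; first exact: measurable_continuous_row.
move=> e e0; exists g; split => //; first by exists M.
move=> b; under eq_integral do rewrite subrr normr0.
by rewrite integral0 lee_fin ltW.
Qed.

Let approxD g1 g2 : approx g1 -> approx g2 -> approx (fun x => g1 x + g2 x).
Proof.
move=> [m1 a1] [m2 a2]; split; first exact: measurable_funD.
move=> e e0; have e20 : 0 < e / 2 by rewrite divr_gt0.
have [h1 [c1 [M1 hM1] l1]] := a1 _ e20; have [h2 [c2 [M2 hM2] l2]] := a2 _ e20.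
have mh1 := measurable_continuous_row c1; have mh2 := measurable_continuous_row c2.
exists (fun x => h1 x + h2 x); split.
- by move=> x; apply: continuousD; [exact: c1|exact: c2].
- by exists (M1 + M2) => x; rewrite (le_trans (ler_normD _ _))// lerD.
move=> b; rewrite [e]splitr EFinD.
apply: le_trans (leeD (l1 b) (l2 b)).
rewrite -ge0_integralD//; [|exact: measurable_dist..].
apply: ge0_le_integral => //.
- by apply: measurable_dist; exact: measurable_funD.
- by apply: emeasurable_funD; exact: measurable_dist.
- by move=> x _; rewrite -EFinD lee_fin opprD addrACA ler_normD.
Qed.

Let approxZ c g : approx g -> approx (fun x => c * g x).
Proof.
move=> [mg ag]; split; first exact: measurable_funM.
move=> e e0; have c0 : 0 < `|c| + 1 by rewrite ltr_wpDl.
have ec0 : 0 < e / (`|c| + 1) by rewrite divr_gt0.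
have [h [ch [M hM] lh]] := ag _ ec0; have mh := measurable_continuous_row ch.
exists (fun x => c * h x); split.
- by move=> x; apply: continuousM; [exact: cst_continuous|exact: ch].
- by exists (`|c| * M) => x; rewrite normrM ler_wpM2l.
move=> b; apply: (@le_trans _ _ (\int[P b]_x (`|c|%:E * (`|g x - h x|)%:E))%E).
  rewrite le_eqVlt; apply/orP; left; apply/eqP; apply: eq_integral => x _.
  by rewrite -mulrBr normrM.
rewrite ge0_integralZl//=; last exact: measurable_dist.
apply: (@le_trans _ _ (`|c|%:E * (e / (`|c| + 1))%:E)%E).
  by rewrite lee_wpmul2l// lee_fin.
by rewrite -EFinM lee_fin mulrCA ler_piMr ?(ltW e0)// ler_pdivrMr// mul1r lerDl.
Qed.

(** Open sets are stable under intersection and generate the Borel sets, while the sets whose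
    indicator is approximable form a lambda-system. *)
Let approx_indic (A : set V) : measurable A -> approx \1_A.
Proof.
move=> mA0; have [] : [set B | measurable B /\ approx \1_B] A; last by [].
move: A mA0; apply: (@lambda_system_subset _ (@open V) _ setT) => //.
- by move=> A1 A2; exact: openI.
- split => //.
  + split => //; apply: (@approx_continuous _ 1); first by rewrite indicT; exact: cst_continuous.
    by move=> x; rewrite indicT /cst normr1.
  + move=> A1 A2 A21 [mA1 a1] [mA2 a2]; split; first exact: measurableD.
    have : approx (fun x => \1_A1 x + (-1) * \1_A2 x).
      by apply: approxD => //; exact: approxZ.
    rewrite (_ : (fun _ => _) = \1_(A1 `\` A2))//; apply/funext => x.
    rewrite !indicE in_setD; case: (boolP (x \in A2)) => [|_].
      by move=> /set_mem/A21/mem_set ->; rewrite andbF mulN1r subrr.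
    by rewrite andbT mulN1r oppr0 addr0.
  + move=> F ndF aF; have mUF : measurable (\bigcup_i F i).
      by apply: bigcupT_measurable => i; case: (aF i).
    split => //; apply: (@approx_cvg (fun n => \1_(F n)) _ 1) => //.
    * by move=> n; case: (aF n).
    * by move=> n x; rewrite indicE; case: (_ \in _); rewrite ?normr1 ?normr0.
    * move=> x; rewrite indicE; apply: cvg_near_cst.
      have [[n _ Fnx]|nF] := pselect ((\bigcup_i F i) x).
        exists n => // m /= nm; rewrite indicE !mem_set//; first by exists n.
        by have /subsetPset := ndF _ _ nm; exact.
      by apply: nearW => n; rewrite indicE !memNset// => Fn; apply: nF; exists n.
- move=> U oU; have mU : measurable U by exact: sub_sigma_algebra.
  have [h [ch hM hU]] := ex_continuous_to_indic (open_closedC oU).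
  rewrite setCK in hU; split => //; apply: (@approx_cvg h _ 1) => //.
  by move=> n; exact: (@approx_continuous _ 1).
Qed.

Import HBSimple HBNNSimple.

Lemma ex_continuous_L1_close (g : V -> R) (M e : R) : measurable_fun setT g ->
  (forall x, `|g x| <= M) -> 0 < e ->
  exists h : V -> R, [/\ continuous h, forall x, `|h x| <= M &
    forall b, (\int[P b]_x (`|g x - h x|)%:E <= e%:E)%E].
Proof.
move=> mg gM e0.
have ag : approx g.
  (* The shift makes the function nonnegative, as monotone approximation by simple functions
     requires. *)
  pose f x := g x + M.
  have f0 x : 0 <= f x by have := gM x; rewrite ler_norml /f; lra.
  have fM x : f x <= M + M by have := gM x; rewrite ler_norml /f; lra.
  have mf' : measurable_fun setT f by exact: measurable_funD.
  have mf : measurable_fun setT (EFin \o f) by exact/measurable_EFinP.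
  have [u [ndu cu]] := approximation measurableT mf (fun x _ => f0 x).
  have cuf x : u n x @[n --> \oo] --> f x.
    by have /fine_cvgP[] := cu x Logic.I.
  have uf n x : u n x <= f x.
    rewrite -(cvg_lim _ (cuf x))//; apply: nondecreasing_cvgn_le.
      by move=> i j ij; have /lefP := ndu _ _ ij; exact.
    by apply/cvg_ex; exists (f x); exact: cuf.
  have au n : approx (u n).
    rewrite (_ : (u n : V -> R) = fun x => \sum_(i < size (finmap.enum_fset (fset_set (range (u n)))))
      (finmap.enum_fset (fset_set (range (u n))))`_i *
      \1_(u n @^-1` [set (finmap.enum_fset (fset_set (range (u n))))`_i]) x).
      move: (finmap.enum_fset _) => s; elim: (size s) => [|k IH].
        rewrite (_ : (fun _ => _) = cst 0).
          by apply: (@approx_continuous _ 0); [exact: cst_continuous|move=> x; rewrite normr0].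
        by apply/funext => x; rewrite big_ord0.
      rewrite (_ : (fun _ => _) = (fun x => (\sum_(i < k) s`_i * \1_(u n @^-1` [set s`_i]) x) +
        s`_k * \1_(u n @^-1` [set s`_k]) x)).
        by apply: approxD => //; apply: approxZ; exact: approx_indic.
      by apply/funext => x; rewrite big_ord_recr.
    by apply/funext => x; exact: fimfunEord.
  have af : approx f.
    apply: (@approx_cvg u _ (M + M)) => // n x.
    by rewrite ger0_norm// (le_trans (uf n x)).
  have : approx (fun x => f x + (-1) * M).
    apply: approxD => //; apply: (@approx_continuous _ `|(-1) * M|) => //.
    exact: cst_continuous.
  rewrite (_ : (fun _ => _) = g)//.
  by apply/funext => x; rewrite /f mulN1r addrK.
have [h [ch _ gh]] := ag.2 e e0; have mh := measurable_continuous_row ch.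
(* As [g] takes its values in [[-M, M]], clipping [h] to that interval does not increase its
   distance to [g]. *)
exists (fun x => Num.max (- M) (Num.min (h x) M)); split.
- move=> x; apply: (@continuous_max _ _ (cst (- M)) (fun x => Num.min (h x) M)); first exact: cst_continuous.
  by apply: (@continuous_min _ _ h (cst M)); [exact: ch|exact: cst_continuous].
- move=> x; have M0 : 0 <= M by rewrite (le_trans _ (gM x)).
  rewrite ler_norml le_max lexx/= ge_max ge_min lexx orbT andbT; lra.
- move=> b; apply: le_trans (gh b); apply: ge0_le_integral => //.
  + apply: measurable_dist => //.
    by apply: measurable_maxr => //; exact: measurable_minr.
  + exact: measurable_dist.
  + move=> x _; rewrite lee_fin; have := gM x; rewrite ler_norml => /andP[].
    move: (g x) (h x) => p q p1 p2.
    have := ler_norm (p - q); have := ler_norm (q - p); rewrite distrC => h1 h2.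
    have [qM|qM] := leP q M; last first.
      rewrite max_r ?(le_trans p1)// distrC ger0_norm ?subr_ge0//; lra.
    by have [qM'|qM'] := leP (- M) q => //; rewrite ger0_norm; lra.
Qed.

End continuous_approximation.

(** By convexity, [expR b] lies above the tangent at [a]. *)
Lemma expR_le_lip (R : realType) (M a b : R) : a <= M ->
  expR a <= expR b + expR M * `|a - b|.
Proof.
move=> aM; have := expR_ge1Dx (b - a).
move=> /(ler_wpM2l (expR_ge0 a)); rewrite -expRD subrKC mulrDr mulr1 => H.
rewrite -lerBlDl; apply: (@le_trans _ _ (expR a * (a - b))).
  by move: H; rewrite !mulrBr; lra.
apply: (@le_trans _ _ (expR a * `|a - b|)).
  by rewrite ler_wpM2l ?expR_ge0// ler_norm.
by rewrite ler_wpM2r// ler_expR.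
Qed.

(** The logarithm grows by at most [expR M * expR M * e], because [E] is at least [expR (- M)], and
    the other term drops by at most [e]. The last summand 1 in the equation for [e] leaves a margin
    [e], which makes the conclusion strict. *)
Lemma log_perturbation (R : realType) (M e I E J X b : R) : 0 < e -> 0 < E -> 0 < X ->
  expR (- M) <= E -> X <= E + expR M * e -> I - e <= J ->
  e * (expR M * expR M + 1 + 1) = I - ln E - b -> b < J - ln X.
Proof.
move=> e0 E0 X0 ME XE IJ eE.
have lnX : ln X <= ln E + expR M * expR M * e.
  have := ln_le_sub1 (divr_gt0 X0 E0); rewrite ln_div ?posrE// => H.
  have : X / E <= 1 + expR M * expR M * e; last by lra.
  have EM : 1 <= expR M * E by rewrite -(expRxMexpNx_1 M) ler_wpM2l ?expR_ge0.
  have := ler_wpM2l (mulr_ge0 (expR_ge0 M) (ltW e0)) EM.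
  by rewrite ler_pdivrMr// => ?; apply: (le_trans XE); lra.
by move: lnX; lra.
Qed.

(** The test function of [entropy_lt_bounded] is replaced by a continuous one with the same bound
    [M], close to it in L1 for both laws; [log_perturbation] absorbs the change. *)
Lemma entropy_lt_continuous (R : realType) d (mu nu : probability 'rV[R]_d R) (b : R) :
  (b%:E < relative_entropy mu nu)%E ->
  exists (g : 'rV[R]_d -> R) (M : R), [/\ continuous g, (forall x, `|g x| <= M) &
    b < \int[mu]_x g x - ln (\int[nu]_x expR (g x))].
Proof.
move=> /entropy_lt_bounded[g [M [mg gM]]].
set I := \int[mu]_x g x; set E := \int[nu]_x expR (g x) => bI.
have expM (f : 'rV[R]_d -> R) : (forall x, `|f x| <= M) ->
    forall x, expR (- M) <= expR (f x) <= expR M.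
  by move=> fM x; have := fM x; rewrite ler_norml !ler_expR.
have iexp (f : 'rV[R]_d -> R) : measurable_fun setT f -> (forall x, `|f x| <= M) ->
    nu.-integrable setT (fun x => (expR (f x))%:E).
  move=> mf fM; apply: (@bounded_integrable _ _ _ _ _ (expR M)).
    exact: measurableT_comp.
  by move=> x; rewrite ger0_norm ?expR_ge0//; have /andP[] := expM f fM x.
have exp_low (f : 'rV[R]_d -> R) : measurable_fun setT f -> (forall x, `|f x| <= M) ->
    expR (- M) <= \int[nu]_x expR (f x).
  move=> mf fM; have -> : expR (- M) = \int[nu]_x (cst (expR (- M)) x).
    by rewrite Rintegral_cst//= [X in fine X]probability_setT mulr1.
  apply: le_Rintegral => //; first exact: finite_measure_integrable_cst.
    exact: iexp.
  by move=> x _; have /andP[] := expM f fM x.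
pose c := expR M * expR M + 1.
have c1 : 1 <= c by rewrite lerDr mulr_ge0 ?expR_ge0.
pose e := (I - ln E - b) / (c + 1).
have e0 : 0 < e by rewrite divr_gt0; lra.
pose P (i : bool) := if i then mu else nu.
have [h [ch hM gh]] := ex_continuous_L1_close P mg gM e0.
have mh := measurable_continuous_row ch.
have mgh : measurable_fun setT (fun x => `|g x - h x|).
  by apply: measurableT_comp => //; exact: measurable_funB.
have igh (i : bool) : (P i).-integrable setT (fun x => (`|g x - h x|)%:E).
  apply: (@bounded_integrable _ _ _ _ _ (M + M)) => // x.
  by rewrite normr_id (le_trans (ler_normB _ _))// lerD.
have close i : \int[P i]_x `|g x - h x| <= e.
  by rewrite -lee_fin fineK; [exact: gh|exact: (integrable_fin_num _ (igh i))].
have imu : mu.-integrable setT (EFin \o (fun x => `|g x - h x|)) := igh true.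
have inu : nu.-integrable setT (EFin \o (fun x => `|g x - h x|)) := igh false.
have cmu : \int[mu]_x `|g x - h x| <= e := close true.
have cnu : \int[nu]_x `|g x - h x| <= e := close false.
exists h, M; split; [exact: ch|exact: hM|].
have Ih : I - e <= \int[mu]_x h x.
  have ig := bounded_integrable mu mg gM; have ih := bounded_integrable mu mh hM.
  rewrite lerBlDr; apply: le_trans (lerD (lexx _) cmu).
  rewrite -RintegralD//; apply: le_Rintegral => //.
    exact: (integrableD measurableT ih imu).
  by move=> x _; rewrite -lerBlDl ler_norm.
have Eh : \int[nu]_x expR (h x) <= E + expR M * e.
  apply: (@le_trans _ _ (E + expR M * \int[nu]_x `|g x - h x|)); last first.
    by rewrite lerD2l ler_wpM2l ?expR_ge0//; exact: cnu.
  rewrite -RintegralZl//.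
  have iZ : nu.-integrable setT (EFin \o (fun x => expR M * `|g x - h x|)).
    exact: (integrableZl measurableT (expR M) inu).
  rewrite -RintegralD//; last exact: iexp.
  apply: le_Rintegral => //; first exact: iexp.
    exact: (integrableD measurableT (iexp _ mg gM) iZ).
  move=> x _; rewrite distrC; apply: expR_le_lip.
  by have := hM x; rewrite ler_norml => /andP[].
have E0 := exp_low _ mg gM; have Eh0 := exp_low _ mh hM.
have Epos : 0 < E by rewrite (lt_le_trans (expR_gt0 _) E0).
have Ehpos : 0 < \int[nu]_x expR (h x) by rewrite (lt_le_trans (expR_gt0 _) Eh0).
apply: (@log_perturbation _ M e I E) => //.
by rewrite /e divfK// gt_eqF//; lra.
Qed.

(** * The Gaussian N(0, s^2 Id) as a tilt of the standard one *)

Section tilted_normal.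
Context (R : realType).
Local Open Scope ereal_scope.

Definition tilt (s v : R) : R := (normal_pdf 0 s v / normal_pdf 0 1 v)%R.

Lemma tiltE (s v : R) : (0 < s)%R ->
  tilt s v = (normal_peak s / normal_peak 1 * expR ((1 - s ^- 2) / 2 * v ^+ 2))%R.
Proof.
move=> s0; rewrite /tilt normal_pdf0E// normal_pdf0E// invfM mulrACA -expRN -expRD; congr (_ * expR _)%R.
by field; rewrite gt_eqF.
Qed.

Lemma tilt_gt0 (s v : R) : (0 < s)%R -> (0 < tilt s v)%R.
Proof. by move=> s0; rewrite divr_gt0// normal_pdf_gt0. Qed.

Lemma measurable_tilt (s : R) : (0 < s)%R -> measurable_fun setT (tilt s).
Proof.
move=> s0; apply: measurable_funM; first exact: measurable_normal_pdf.
apply: ge0_measurable_funV; first exact: measurable_normal_pdf.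
by move=> x; exact: normal_pdf_ge0.
Qed.

Lemma ge0_integral_tilt (s : R) (h : R -> \bar R) : (0 < s)%R -> measurable_fun setT h ->
  (forall v, 0 <= h v) ->
  \int[normal_prob 0 1]_v (h v * (tilt s v)%:E) = \int[normal_prob 0 s]_v h v.
Proof.
move=> s0 mh h0.
rewrite (ge0_integral_density (m := lebesgue_measure) (normal_has_density s))//.
rewrite (ge0_integral_density (m := lebesgue_measure) (normal_has_density (1 : R)))//.
- apply: eq_integral => v _; rewrite -muleA -EFinM divfK// gt_eqF//.
  exact: normal_pdf_gt0.
- apply: emeasurable_funM => //; apply/measurable_EFinP; exact: measurable_tilt.
- by move=> v; rewrite mule_ge0// lee_fin ltW// tilt_gt0.
Qed.

Lemma integral_tilt (s : R) : (0 < s)%R -> \int[normal_prob 0 1]_v (tilt s v)%:E = 1.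
Proof.
move=> s0; transitivity (\int[normal_prob 0 1]_v (1 * (tilt s v)%:E)).
  by apply: eq_integral => v _; rewrite mul1e.
by rewrite (@ge0_integral_tilt s (cst 1))// integral_cst//= probability_setT mule1.
Qed.

End tilted_normal.

(** [k] is the logarithm of the ratio of the normalizing constants, that is [- d * ln s]. Its sign
    for [s >= 1] serves in the entropy bound of the recovery sequence. *)
Lemma prod_tiltE (R : realType) d (s : R) : 0 < s ->
  exists2 k : R, 1 <= s -> k <= 0 & forall x : 'rV[R]_d,
    \prod_(i < d) tilt s (x ord0 i) = expR (k + (1 - s ^- 2) / 2 * sqnorm x).
Proof.
move=> s0; pose c : R := normal_peak s / normal_peak 1.
have p0 (t : R) : 0 < t -> 0 < normal_peak t.
  by move=> t0; rewrite normal_peak_gt0// gt_eqF.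
have c0 : 0 < c by rewrite divr_gt0// p0.
exists (d%:R * ln c) => [s1|x].
  apply: mulr_ge0_le0 => //; apply: ln_le0; rewrite ler_pdivrMr ?p0// mul1r.
  have q0 (t : R) : 0 < t -> 0 < t ^+ 2 * pi *+ 2.
    by move=> t0; rewrite mulrn_wgt0// mulr_gt0 ?pi_gt0// exprn_gt0.
  rewrite /normal_peak lef_pV2 ?posrE ?sqrtr_gt0 ?q0// ler_wsqrtr// ler_wMn2r//.
  by rewrite ler_wpM2r ?pi_ge0// expr1n expr_ge1// ltW.
under eq_bigr do rewrite tiltE//.
rewrite big_split/= prodr_const card_ord expRD expRM_natl lnK ?posrE//.
by congr (_ * _); rewrite mulr_sumr expR_sum.
Qed.

Lemma integral_prod_tilt (R : realType) d (s : R) : 0 < s ->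
  (\int[std_gaussian R d]_x (\prod_(i < d) tilt s (x ord0 i))%:E = 1)%E.
Proof.
move=> s0; rewrite (@std_gaussian_prod R d (fun=> tilt s)).
- by rewrite big1// => i _; exact: integral_tilt.
- by move=> i; exact: measurable_tilt.
- by move=> i v; rewrite ltW// tilt_gt0.
Qed.

Lemma has_density_trans d (T : measurableType d) (R : realType)
    (p q m : probability T R) f g :
  has_density p q f -> has_density q m g -> has_density p m (fun x => f x * g x).
Proof.
move=> [mf f0 pE] qg; have [mg g0 _] := qg; split.
- exact: measurable_funM.
- by move=> x; rewrite mulr_ge0.
- move=> A mA; rewrite pE// integral_mkcond [RHS]integral_mkcond.
  rewrite (ge0_integral_density (m := m) qg).
  + apply: eq_integral => x _; rewrite !patchE; case: ifPn => _; last by rewrite mul0e.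
    by rewrite EFinM.
  + have mf' : measurable_fun A (EFin \o f) by apply/measurable_funTS/measurable_EFinP.
    exact: ((measurable_restrictT (EFin \o f) mA).1 mf').
  + by move=> x; rewrite erestrict_ge0// => y _; rewrite lee_fin.
Qed.

Section entropy_tilting.
Context (R : realType) (d : nat) (s k : R).
Hypothesis s0 : 0 < s.
Let L (x : 'rV[R]_d) := k + (1 - s ^- 2) / 2 * sqnorm x.
Variable gs : probability 'rV[R]_d R.
Hypothesis gsL : has_density gs (std_gaussian R d) (fun x => expR (L x)).

Let mL : measurable_fun setT L.
Proof.
apply: measurable_funD => //; apply: measurable_funM => //.
exact: measurable_sqnorm.
Qed.

Lemma integrable_sqnorm (mu : probability 'rV[R]_d R) (m : R) : m2 mu = m%:E ->
  mu.-integrable setT (fun x => (sqnorm x)%:E).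
Proof.
move=> mE; apply/integrableP; split; first by apply/measurable_EFinP; exact: measurable_sqnorm.
rewrite (eq_integral (fun x => (sqnorm x)%:E)); first by rewrite [X in (X < _)%E]mE ltry.
by move=> x _; rewrite /= ger0_norm ?sqnorm_ge0.
Qed.

Let integral_L (mu : probability 'rV[R]_d R) (m : R) : m2 mu = m%:E ->
  mu.-integrable setT (EFin \o L) /\
  (\int[mu]_x (L x)%:E = (k + (1 - s ^- 2) / 2 * m)%:E)%E.
Proof.
move=> mE; have isq := integrable_sqnorm mE.
have ik : mu.-integrable setT (EFin \o cst k) by exact: finite_measure_integrable_cst.
have iZ := integrableZl measurableT ((1 - s ^- 2) / 2) isq.
split; first exact: (integrableD measurableT ik iZ).
under eq_integral do rewrite /L EFinD EFinM.
rewrite integralD// integralZl// integral_cst// [X in (_ * X + _)%E]probability_setT mule1.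
by rewrite [X in (_ + _ * X)%E]mE.
Qed.

(** When the tilted entropy is finite, the two sides differ by exactly [s ^- 2 * m / 2], a
    nonnegative term that is dropped here. *)
Lemma fun_I_le_tilted_entropy (mu : probability 'rV[R]_d R) (m : R) :
  m2 mu = m%:E -> m <= d%:R -> m1 mu = 0 ->
  (fun_I mu <= relative_entropy mu gs + (k + d%:R / 2)%:E)%E.
Proof.
move=> mE md m10; have m0 : 0 <= m.
  by rewrite -lee_fin -mE; apply: integral_ge0 => x _; rewrite lee_fin sqnorm_ge0.
have [Hoo|] := ltP (relative_entropy mu gs) +oo%E; last first.
  by rewrite leye_eq => /eqP ->; rewrite addye ?leey.
have [F muF ilnF] := ex_entropy_density Hoo; have [mF F0 _] := muF.
have muFL := has_density_trans muF gsL; have [mFL _ _] := muFL.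
have [iL LE] := integral_L mE.
have mln (f : _ -> R) : measurable_fun setT f -> measurable_fun setT (fun x : 'rV[R]_d => (ln (f x))%:E).
  by move=> mf; apply/measurable_EFinP; exact: measurableT_comp.
rewrite /fun_I asboolT; last by rewrite /finite_m2 mE ltry lee_fin.
rewrite (relative_entropyE muFL) (relative_entropyE muF) mE.
have -> : (\int[mu]_x (ln (F x * expR (L x)))%:E =
    \int[mu]_x ((ln (F x))%:E + (L x)%:E))%E.
  apply: ae_eq_integral => //; first exact: mln.
    by apply: emeasurable_funD; [exact: mln|exact/measurable_EFinP].
  apply: ae_imp (density_gt0_ae (m := gs) muF) => x Fx _.
  by rewrite lnM ?posrE ?expR_gt0// expRK EFinD.
rewrite integralD// LE.
have : (\int[mu]_x (ln (F x))%:E)%E \is a fin_num by exact: integrable_fin_num.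
move: (\int[mu]_x _)%E => h /fineK <-.
rewrite -EFinB -EFinM -!EFinD lee_fin.
have : 0 <= s ^- 2 * m by rewrite mulr_ge0// invr_ge0 exprn_ge0// ltW.
lra.
Qed.

(** The dual inequality is applied to the unbounded test function [g + L] relative to the standard
    Gaussian, for which [expR L] is the density of [gs]. Bounding [m] by [d] in the remaining term
    leaves a left side that depends on [nu] only through the integral of [g]. *)
Lemma fun_I_ge_tilted (nu : probability 'rV[R]_d R) (g : 'rV[R]_d -> R) (M : R) :
  measurable_fun setT g -> (forall x, `|g x| <= M) ->
  ((\int[nu]_x g x - ln (\int[gs]_x expR (g x)) +
    k + d%:R / 2 - s ^- 2 * d%:R / 2)%:E <= fun_I nu)%E.
Proof.
move=> mg gM; have [Ioo|] := ltP (fun_I nu) +oo%E; last first.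
  by rewrite leye_eq => /eqP ->; rewrite leey.
have [F [h [m [nuF ilnF hE mE [md m10 ->]]]]] := fun_I_finite Ioo.
have [iL LE] := integral_L mE; have ig := bounded_integrable nu mg gM.
have igL := integrableD measurableT ig iL.
have mexp : measurable_fun setT (fun x => expR (g x)) by exact: measurableT_comp.
have iexp : gs.-integrable setT (EFin \o (fun x => expR (g x))).
  apply: (@bounded_integrable _ _ _ _ _ (expR M)) => //.
  move=> x; rewrite ger0_norm ?expR_ge0// ler_expR.
  by have := gM x; rewrite ler_norml => /andP[].
set E := \int[gs]_x expR (g x).
have EE : (\int[std_gaussian R d]_x (expR (g x + L x))%:E = E%:E)%E.
  rewrite fineK; last exact: (integrable_fin_num _ iexp).
  rewrite (ge0_integral_density (m := std_gaussian R d) gsL).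
  - by apply: eq_integral => x _; rewrite expRD EFinM.
  - exact/measurable_EFinP.
  - by move=> x; rewrite lee_fin expR_ge0.
have E0 : 0 < E.
  have : expR (- M) <= E.
    have -> : expR (- M) = \int[gs]_x (cst (expR (- M)) x).
      by rewrite Rintegral_cst//= [X in fine X]probability_setT mulr1.
    apply: le_Rintegral => //; first exact: finite_measure_integrable_cst.
    move=> x _; rewrite ler_expR.
    by have := gM x; rewrite ler_norml => /andP[].
  by apply: lt_le_trans; exact: expR_gt0.
have mgL : measurable_fun setT (fun x => g x + L x) by exact: measurable_funD.
have := entropy_dual_le nuF ilnF mgL igL E0.
rewrite EE => /(_ (lexx _)).
have -> : (\int[nu]_x (g x + L x)%:E = (\int[nu]_x g x + (k + (1 - s ^- 2) / 2 * m))%:E)%E.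
  under eq_integral do rewrite EFinD.
  rewrite integralD// LE [RHS]EFinD fineK//.
  exact: (integrable_fin_num _ ig).
rewrite hE -EFinD !lee_fin.
have := ler_wpM2l (_ : 0 <= s ^- 2) md.
rewrite invr_ge0 exprn_ge0 ?(ltW s0)// => /(_ isT); lra.
Qed.

End entropy_tilting.

(** * Weak neighborhoods on which [fun_I] is large *)

Section weak_neighborhoods.
Context (R : realType) (d : nat).
Notation V := 'rV[R]_d.

Lemma weak_continuous_integral (f : V -> R) (M : R) (mu : weak_probability R d) :
  continuous f -> (forall x, `|f x| <= M) ->
  (fun nu : weak_probability R d => \int[nu]_x f x) @ nbhs mu --> (\int[mu]_x f x : R).
Proof.
move=> cf fM; have bf : continuous f /\ exists M : R, forall x, `|f x| <= M.
  by split => //; exists M.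
have Fmu : Filter (nbhs mu) := nbhs_filter mu.
exact: ((weak_probability_cvg mu Fmu).1 (fun A => id) (exist _ f bf)).
Qed.

Lemma nbhs_integral_gt (f : V -> R) (M c : R) (mu : weak_probability R d) :
  continuous f -> (forall x, `|f x| <= M) -> c < \int[mu]_x f x ->
  nbhs mu [set nu : weak_probability R d | c < \int[nu]_x f x].
Proof.
move=> cf fM cmu; have Fmu : Filter (nbhs mu) := nbhs_filter mu.
have h := @cvgr_gt R _ (nbhs mu) Fmu (fun nu : weak_probability R d => \int[nu]_x f x) _ (weak_continuous_integral (mu := mu) cf fM) c cmu.
exact: h.
Qed.

Lemma continuous_sqnorm : continuous (@sqnorm R d).
Proof.
apply: continuous_sum_ord => i x.
apply: (@continuous_comp _ _ _ (fun y : V => y ord0 i) (fun t => t ^+ 2)).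
  exact: coord_continuous.
exact: exprn_continuous.
Qed.

(** Some truncation of [sqnorm], which is bounded and continuous, already has integral above [d].
    This persists on a neighborhood, where [fun_I] is infinite. *)
Lemma fun_I_gt_of_m2 (mu : weak_probability R d) (a : R) : (d%:R%:E < m2 mu)%E ->
  exists2 W, nbhs mu W & forall nu : weak_probability R d, W nu -> (a%:E < fun_I nu)%E.
Proof.
move=> dm.
pose t (n : nat) (x : V) : R := Num.min (sqnorm x) n%:R.
have t0 n x : 0 <= t n x by rewrite le_min sqnorm_ge0/=.
have tn n x : `|t n x| <= n%:R by rewrite ger0_norm// ge_min lexx orbT.
have ct n : continuous (t n).
  move=> x; apply: (@continuous_min _ _ (@sqnorm R d) (cst n%:R)).
    exact: continuous_sqnorm.
  exact: cst_continuous.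
have mt n := measurable_continuous_row (ct n).
have tcvg : (\int[mu]_x (t n x)%:E @[n --> \oo] --> m2 mu)%E.
  rewrite /m2.
  have -> : (fun x : V => (sqnorm x)%:E) = (fun x => limn (fun n => (t n x)%:E)).
    apply/funext => x; apply/esym/cvg_lim => //; apply: cvg_near_cst.
    near=> n; congr EFin; apply/min_idPl.
    by near: n; exact: nbhs_infty_ger.
  apply: cvg_monotone_convergence => //.
  - by move=> n; exact/measurable_EFinP.
  - by move=> n x _; rewrite lee_fin.
  - by move=> x _ m n mn; rewrite lee_fin /t le_min2// ler_nat.
have [n hn] : exists n, (d%:R%:E < \int[mu]_x (t n x)%:E)%E.
  have [n _ /(_ n (leqnn n))] := tcvg (fun u => d%:R%:E < u)%E (open_ereal_gt' dm).
  by exists n.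
have itn (nu : probability V R) : (\int[nu]_x (t n x)%:E)%E \is a fin_num.
  exact: (integrable_fin_num _ (bounded_integrable nu (mt n) (tn n))).
exists [set nu : weak_probability R d | d%:R < \int[nu]_x t n x].
  apply: (nbhs_integral_gt (ct n) (tn n)).
  by rewrite -lte_fin fineK//; exact: itn.
move=> nu /= Wnu; rewrite /fun_I asboolF ?ltry// => -[_ + _].
apply/negP; rewrite -ltNge.
apply: (@lt_le_trans _ _ (\int[nu]_x (t n x)%:E)%E).
  by rewrite -(fineK (itn nu)) lte_fin.
apply: ge0_le_integral => //.
- by move=> x _; rewrite lee_fin.
- exact/measurable_EFinP.
- by apply/measurable_EFinP; exact: measurable_sqnorm.
- by move=> x _; rewrite lee_fin ge_min lexx.
Unshelve. all: by end_near.
Qed.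

Let clip (K v : R) : R := Num.max (- K) (Num.min v K).

Let clip_le (K v : R) : 0 < K -> `|clip K v| <= K.
Proof.
move=> K0; rewrite ler_norml le_max lexx/= ge_max ge_min lexx orbT andbT; lra.
Qed.

Let clip_dist (K v : R) : 0 < K -> `|v - clip K v| <= v ^+ 2 / K.
Proof.
move=> K0; rewrite ler_pdivlMr// /clip.
have [vK|vK] := leP v K.
  have [Kv|Kv] := leP (- K) v; first by rewrite subrr normr0 mul0r sqr_ge0.
  rewrite ler0_norm; nra.
rewrite max_r; last lra.
by rewrite ger0_norm; nra.
Qed.

Lemma sqr_coord_le (x : V) (i : 'I_d) : x ord0 i ^+ 2 <= sqnorm x.
Proof. by rewrite /sqnorm (bigD1 i)//= lerDl sumr_ge0// => j _; rewrite sqr_ge0. Qed.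

Lemma integrable_coord (mu : probability V R) (i : 'I_d) (m : R) : m2 mu = m%:E ->
  mu.-integrable setT (EFin \o (fun x : V => x ord0 i)).
Proof.
move=> mE; have isq := integrable_sqnorm mE.
have i1 : mu.-integrable setT (EFin \o cst 1).
  exact: finite_measure_integrable_cst.
apply: (le_integrable measurableT _ _ (integrableD measurableT i1 isq)).
  by apply/measurable_EFinP; exact: measurable_coord.
move=> x _; rewrite /= lee_fin [leRHS]ger0_norm ?addr_ge0 ?sqnorm_ge0//.
have := sqr_coord_le x i; have := sqr_ge0 (`|x ord0 i| - 1); rewrite -(real_normK (num_real (x ord0 i))).
nra.
Qed.

Let integral_clip_dist (mu : probability V R) (i : 'I_d) (K m : R) : 0 < K ->
  m2 mu = m%:E ->
  `|\int[mu]_x (x ord0 i) - \int[mu]_x (clip K (x ord0 i))| <= m / K.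
Proof.
move=> K0 mE; have isq := integrable_sqnorm mE.
have mclip : measurable_fun setT (fun x : V => clip K (x ord0 i)).
  by apply: measurable_maxr => //; apply: measurable_minr => //; exact: measurable_coord.
have iclip := bounded_integrable mu mclip (fun x => clip_le (x ord0 i) K0).
have icoord := integrable_coord i mE.
rewrite -RintegralB//; apply: le_trans (le_normr_Rintegral _ _) _ => //.
  exact: (integrableB measurableT icoord iclip).
have iZ := integrableZl measurableT (K^-1) isq.
have : \int[mu]_x `|x ord0 i - clip K (x ord0 i)| <= \int[mu]_x (K^-1 * sqnorm x).
  apply: le_Rintegral => //.
    exact: (integrable_abse (integrableB measurableT icoord iclip)).
  move=> x _; rewrite mulrC; apply: (le_trans (clip_dist _ K0)).
  by rewrite ler_pM2r ?invr_gt0// sqr_coord_le.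
move=> /le_trans; apply; rewrite RintegralZl// mulrC.
by rewrite /Rintegral [X in fine X]mE.
Qed.

(** Clipping a coordinate at [K] makes it bounded and changes its mean by at most [d / K], uniformly
    over the laws with second moment at most [d]. A nonzero mean at [mu] thus excludes nearby laws
    that satisfy both constraints. *)
Lemma fun_I_gt_of_m1 (mu : weak_probability R d) (a : R) : (m2 mu <= d%:R%:E)%E ->
  m1 mu != 0 ->
  exists2 W, nbhs mu W & forall nu : weak_probability R d, W nu -> (a%:E < fun_I nu)%E.
Proof.
move=> md m10.
have m2_fin (nu : probability V R) : (m2 nu <= d%:R%:E)%E -> exists2 m, m2 nu = m%:E & m <= d%:R.
  have : (0 <= m2 nu)%E by apply: integral_ge0 => x _; rewrite lee_fin sqnorm_ge0.
  by case: (m2 nu) => // m _; rewrite lee_fin => ?; exists m.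
have [m mE md'] := m2_fin _ md.
have [i ci] : exists i, m1 mu ord0 i != 0.
  by apply/existsP; apply: contraNT m10 => /existsPn h; apply/eqP/rowP => i;
    rewrite [RHS]mxE; apply/eqP; have := h i; rewrite negbK.
rewrite mxE in ci; set c := Rintegral _ _ _ in ci.
have c0 : 0 < `|c| by rewrite normr_gt0.
(* Chosen so that twice [d / K] is below [|c|]: one error is spent at [mu], the other at [nu]. *)
pose K := (2 * d%:R + 1) / `|c|.
have K0 : 0 < K by rewrite divr_gt0// ltr_wpDl// mulr_ge0.
have Kc : d%:R / K + d%:R / K < `|c|.
  rewrite -mulrDl ltr_pdivrMr// /K mulrC divfK ?gt_eqF//; lra.
pose f (x : V) := clip K (x ord0 i).
have cf : continuous f.
  move=> x; apply: (@continuous_max _ _ (cst (- K)) (fun x : V => Num.min (x ord0 i) K)); first exact: cst_continuous.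
  by apply: (@continuous_min _ _ (fun x : V => x ord0 i) (cst K)); [exact: coord_continuous|exact: cst_continuous].
have fK x : `|f x| <= K by exact: clip_le.
have mdK : m / K <= d%:R / K by rewrite ler_pM2r// invr_gt0.
have := integral_clip_dist i K0 mE; rewrite -/c => hmu.
exists [set nu : weak_probability R d | d%:R / K < `|\int[nu]_x f x|].
  have Fmu : Filter (nbhs mu) := nbhs_filter mu.
  apply: (@cvgr_norm_gt R R _ (nbhs mu) Fmu (fun nu : weak_probability R d => \int[nu]_x f x) _ (weak_continuous_integral (mu := mu) cf fK)).
  have : `|c| - `|\int[mu]_x f x| <= `|c - \int[mu]_x f x| by exact: lerB_dist.
  by move: hmu; rewrite -/f; lra.
move=> nu /= Wnu; rewrite /fun_I asboolF ?ltry// => -[_ nud nu1].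
have [m' m'E m'd] := m2_fin _ nud.
have := integral_clip_dist i K0 m'E.
have -> : \int[nu]_x (x ord0 i) = 0 by have /rowP/(_ i) := nu1; rewrite !mxE.
rewrite sub0r normrN => h; have : m' / K <= d%:R / K by rewrite ler_pM2r// invr_gt0.
by move=> /(le_trans h); rewrite leNgt Wnu.
Qed.

Lemma fun_I_gt_of_entropy (mu : weak_probability R d) (a : R) :
  (m2 mu <= d%:R%:E)%E -> m1 mu = 0 -> (a%:E < fun_I mu)%E ->
  exists2 W, nbhs mu W & forall nu : weak_probability R d, W nu -> (a%:E < fun_I nu)%E.
Proof.
move=> md m10 aI.
have [m mE md'] : exists2 m, m2 mu = m%:E & m <= d%:R.
  have : (0 <= m2 mu)%E by apply: integral_ge0 => x _; rewrite lee_fin sqnorm_ge0.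
  by case: (m2 mu) md => // m; rewrite lee_fin; exists m.
(* [s] is so large that the loss [s ^- 2 * d / 2] of [fun_I_ge_tilted] fits into the gap between [a]
   and [fun_I mu]; the intermediate [b] covers an infinite [fun_I mu]. *)
have [s s0 aI'] : exists2 s : R, 0 < s & ((a + s ^- 2 * d%:R / 2)%:E < fun_I mu)%E.
  have d0 : 0 <= d%:R :> R by [].
  have [b ab bI] : exists2 b, a < b & (b%:E <= fun_I mu)%E.
    move: aI; case: (fun_I mu) => [I| |]//; first by rewrite lte_fin; exists I.
    by move=> _; exists (a + 1); rewrite ?leey// ltrDl.
  pose e := (b - a) / (d%:R + 1).
  have e0 : 0 < e by rewrite divr_gt0 ?subr_gt0// ltr_wpDl.
  exists (Num.sqrt e^-1); first by rewrite sqrtr_gt0 invr_gt0.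
  rewrite sqr_sqrtr ?invr_ge0 ?ltW// invrK (lt_le_trans _ bI)// lte_fin.
  have : e * (d%:R + 1) = b - a by rewrite /e divfK// gt_eqF// ltr_wpDl.
  have : 0 <= e * d%:R by rewrite mulr_ge0// ltW.
  lra.
have [k _ kE] := prod_tiltE d s0.
have := integral_prod_tilt d s0; under eq_integral do rewrite kE; move=> k1.
have mL : measurable_fun setT (fun x : V => expR (k + (1 - s ^- 2) / 2 * sqnorm x)).
  apply: measurableT_comp => //; apply: measurable_funD => //.
  by apply: measurable_funM => //; exact: measurable_sqnorm.
have [gs gsL] := ex_density mL (fun x => expR_ge0 _) k1.
have := fun_I_le_tilted_entropy s0 gsL mE md' m10.
move=> /(lt_le_trans aI'); rewrite -lteBlDr// -EFinB.
move=> /entropy_lt_continuous[g [M [cg gM gI]]].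
(* Only the integral of the bounded continuous [g] varies with [nu]; the term with [gs] is a
   constant. *)
exists [set nu : weak_probability R d |
    a + s ^- 2 * d%:R / 2 - (k + d%:R / 2) + ln (\int[gs]_x expR (g x)) < \int[nu]_x g x].
  by apply: (nbhs_integral_gt cg gM); rewrite -ltrBrDr.
move=> nu /= Wnu; have mg := measurable_continuous_row cg.
apply: lt_le_trans (fun_I_ge_tilted s0 gsL nu mg gM).
by rewrite lte_fin; move: Wnu; lra.
Qed.

Lemma lower_semicontinuous_fun_I :
  lower_semicontinuous (fun_I : weak_probability R d -> \bar R).
Proof.
move=> mu a aI; have [md|md] := leP (m2 mu) d%:R%:E; last exact: fun_I_gt_of_m2.
have [m10|m10] := eqVneq (m1 mu) 0; last exact: fun_I_gt_of_m1.
exact: fun_I_gt_of_entropy.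
Qed.

End weak_neighborhoods.

(** * Recovery sequences *)

Section mixture.
Context d (T : measurableType d) (R : realType).
Variables (mu nu rho m : probability T R) (F G : T -> R) (p : R).
Hypotheses (muF : has_density mu m F) (nuG : has_density nu m G).
Hypothesis rhoFG : has_density rho m (fun x => p * F x + (1 - p) * G x).

Lemma integral_mixture (h : T -> R) : measurable_fun setT h ->
  mu.-integrable setT (EFin \o h) -> nu.-integrable setT (EFin \o h) ->
  rho.-integrable setT (EFin \o h) /\
  (\int[rho]_x (h x)%:E =
   p%:E * \int[mu]_x (h x)%:E + (1 - p)%:E * \int[nu]_x (h x)%:E)%E.
Proof.
move=> mh imu inu; have mh' : measurable_fun setT (EFin \o h) by exact/measurable_EFinP.
have i1 := (integrable_density (m := m) muF mh').1 imu.
have i2 := (integrable_density (m := m) nuG mh').1 inu.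
have j1 := integrableZl measurableT p i1.
have j2 := integrableZl measurableT (1 - p) i2.
have E x : ((h x)%:E * (p * F x + (1 - p) * G x)%:E =
    p%:E * ((h x)%:E * (F x)%:E) + (1 - p)%:E * ((h x)%:E * (G x)%:E))%E.
  by rewrite -!EFinM -EFinD; congr EFin; ring.
split.
  apply/(integrable_density (m := m) rhoFG mh').
  apply: eq_integrable (integrableD measurableT j1 j2) => // x _.
  by rewrite /= E.
rewrite (integral_density (m := m) rhoFG)//.
rewrite (integral_density (m := m) muF)// (integral_density (m := m) nuG)//.
rewrite -integralZl// -integralZl// -integralD//.
by apply: eq_integral => x _; rewrite E.
Qed.

End mixture.

Lemma ex_density_mixture d (T : measurableType d) (R : realType)
    (mu nu m : probability T R) (F G : T -> R) (p : R) : 0 <= p <= 1 ->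
  has_density mu m F -> has_density nu m G -> exists rho : probability T R,
  has_density rho m (fun x => p * F x + (1 - p) * G x).
Proof.
move=> /andP[p0 p1] muF nuG; have [mF F0 _] := muF; have [mG G0 _] := nuG.
have q0 : 0 <= 1 - p by rewrite subr_ge0.
apply: ex_density.
- by apply: measurable_funD; exact: measurable_funM.
- by move=> x; rewrite addr_ge0// mulr_ge0.
- under eq_integral do rewrite EFinD.
  rewrite ge0_integralD//.
  + under eq_integral do rewrite EFinM.
    under [X in (_ + X)%E]eq_integral do rewrite EFinM.
    rewrite ge0_integralZl//=; [|exact/measurable_EFinP|by move=> x _; rewrite lee_fin].
    rewrite ge0_integralZl//=; [|exact/measurable_EFinP|by move=> x _; rewrite lee_fin].
    rewrite (density_integral1 (m := m) muF) (density_integral1 (m := m) nuG).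
    by rewrite !mule1 -EFinD subrKC.
  + by move=> x _; rewrite lee_fin mulr_ge0.
  + by apply/measurable_EFinP; exact: measurable_funM.
  + by move=> x _; rewrite lee_fin mulr_ge0.
  + by apply/measurable_EFinP; exact: measurable_funM.
Qed.

Section isotropic_gaussian.
Context (R : realType) (d : nat) (s : R).
Hypothesis s0 : 0 < s.
Variable gs : probability 'rV[R]_d R.
Hypothesis gsE : has_density gs (std_gaussian R d) (fun x => \prod_(i < d) tilt s (x ord0 i)).

(** In the product of one-dimensional integrals, every factor except the one of index [i] is the
    integral of a tilt, that is 1. *)
Lemma isotropic_gaussian_coord (i : 'I_d) (A : set R) : measurable A ->
  gs ((fun x : 'rV[R]_d => x ord0 i) @^-1` A) = normal_prob 0 s A.
Proof.
move=> mA; have mt := measurable_tilt s0.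
have mpre : measurable ((fun x : 'rV[R]_d => x ord0 i) @^-1` A).
  by rewrite -[X in measurable X]setTI; exact: (measurable_coord i).
rewrite -probability_indic// -[RHS]probability_indic//.
rewrite (ge0_integral_density (m := std_gaussian R d) gsE)//; last first.
  exact/measurable_EFinP/measurable_indic.
pose h (j : 'I_d) v : R := (if j == i then \1_A v else 1) * tilt s v.
transitivity (\int[std_gaussian R d]_x (\prod_(j < d) h j (x ord0 j))%:E)%E.
  apply: eq_integral => x _; rewrite -EFinM /h; congr EFin.
  rewrite [RHS]big_split/= [X in _ = X * _](bigD1 i)//= eqxx [X in _ * X * _]big1.
    by rewrite mulr1.
  by move=> j /negbTE ->.
rewrite std_gaussian_prod; last 2 first.
- move=> j; rewrite /h; case: (j == i); apply: measurable_funM => //.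
- by move=> j v; rewrite mulr_ge0 ?(ltW (tilt_gt0 _ s0))//; case: ifP.
rewrite (bigD1 i)//= big1 ?mule1; last first.
  move=> j /negbTE ji; rewrite /h ji; under eq_integral do rewrite mul1r.
  exact: integral_tilt.
rewrite /h eqxx; under eq_integral do rewrite EFinM.
apply: (@ge0_integral_tilt R s (fun v => (\1_A v)%:E)) => //.
exact/measurable_EFinP/measurable_indic.
Qed.

Lemma isotropic_gaussian_m2 : m2 gs = (d%:R * s ^+ 2)%:E.
Proof.
rewrite /m2 /sqnorm; under eq_integral do rewrite -sumEFin.
rewrite ge0_integral_sum//; last 2 first.
- move=> i; apply/measurable_EFinP/measurable_funX; exact: measurable_coord.
- by move=> i x _; rewrite lee_fin sqr_ge0.
rewrite (eq_bigr (fun=> (s ^+ 2)%:E)).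
  by rewrite sumEFin sumr_const card_ord mulr_natl.
move=> i _; rewrite -(normal_second_moment s0).
apply: (@ge0_integral_image _ _ _ _ R gs (normal_prob 0 s) (fun x : 'rV[R]_d => x ord0 i)
  (measurable_coord i) (isotropic_gaussian_coord i) (fun v => (v ^+ 2)%:E)).
- by apply/measurable_EFinP; exact: measurable_funX.
- by move=> v; rewrite lee_fin sqr_ge0.
Qed.

Lemma isotropic_gaussian_mean (i : 'I_d) : (\int[gs]_x (x ord0 i)%:E = 0)%E.
Proof.
rewrite -(normal_mean s0).
apply: (@integral_image _ _ _ _ R gs (normal_prob 0 s) (fun x : 'rV[R]_d => x ord0 i)
  (measurable_coord i) (isotropic_gaussian_coord i) (fun v => v%:E)).
exact/measurable_EFinP.
Qed.

(** The logarithm of the density is at most half of [sqnorm], since [k <= 0] when [s >= 1]. *)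
Lemma isotropic_gaussian_entropy : 1 <= s ->
  gs.-integrable setT (fun x => (ln (\prod_(i < d) tilt s (x ord0 i)))%:E) /\
  (\int[gs]_x (ln (\prod_(i < d) tilt s (x ord0 i)))%:E <= (d%:R * s ^+ 2 / 2)%:E)%E.
Proof.
move=> s1; have [k /(_ s1) k0 kE] := prod_tiltE d s0.
have isq := integrable_sqnorm isotropic_gaussian_m2.
have ik : gs.-integrable setT (EFin \o cst k) by exact: finite_measure_integrable_cst.
have iZ := integrableZl measurableT ((1 - s ^- 2) / 2) isq.
have E (x : 'rV[R]_d) : (ln (\prod_(i < d) tilt s (x ord0 i)) = k + (1 - s ^- 2) / 2 * sqnorm x).
  by rewrite kE expRK.
have iL : gs.-integrable setT (fun x => (ln (\prod_(i < d) tilt s (x ord0 i)))%:E).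
  apply: eq_integrable (integrableD measurableT ik iZ) => // x _.
  by rewrite E EFinD EFinM.
split => //; have iH := integrableZl measurableT (2^-1) isq.
apply: (@le_trans _ _ (\int[gs]_x ((2^-1)%:E * (sqnorm x)%:E))%E).
  apply: le_integral => // x _; rewrite -EFinM lee_fin E.
  have : 0 <= s ^- 2 * sqnorm x.
    by rewrite mulr_ge0 ?sqnorm_ge0// invr_ge0 exprn_ge0// ltW.
  lra.
rewrite integralZl// [X in (_ * X)%E]isotropic_gaussian_m2 -EFinM lee_fin; lra.
Qed.

End isotropic_gaussian.

(** Both estimates are explicit in the mass [e] of the Gaussian, so that the entropy bound and the
    weak convergence follow together as [e] tends to 0. *)
Lemma mixture_recovery (R : realType) d (mu : probability 'rV[R]_d R) F (h m e : R) :
  (0 < d)%N -> has_density mu (std_gaussian R d) F ->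
  mu.-integrable setT (fun x => (ln (F x))%:E) ->
  (\int[mu]_x (ln (F x))%:E = h%:E)%E -> m2 mu = m%:E -> m <= d%:R -> m1 mu = 0 ->
  0 < e <= 1 ->
  exists rho : probability 'rV[R]_d R,
    (fun_J rho <= ((1 - e) * h + (d%:R - (1 - e) * m) / 2)%:E)%E /\
    forall (f : 'rV[R]_d -> R) (M : R), measurable_fun setT f -> (forall x, `|f x| <= M) ->
      `|\int[mu]_x f x - \int[rho]_x f x| <= e * (M + M).
Proof.
move=> d0 muF ilnF hE mE md m10 /andP[e0 e1].
have dr0 : 0 < d%:R :> R by rewrite ltr0n.
have m0 : 0 <= m.
  by rewrite -lee_fin -mE; apply: integral_ge0 => x _; rewrite lee_fin sqnorm_ge0.
(* The variance solving [(1 - e) * m + e * (d * t) = d]. It is at least 1 because [m <= d], as the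
   entropy bound for the Gaussian demands. *)
pose t := (d%:R - (1 - e) * m) / (e * d%:R).
have ed0 : 0 < e * d%:R by rewrite mulr_gt0.
have t1 : 1 <= t.
  rewrite /t ler_pdivlMr// mul1r.
  have : 0 <= (1 - e) * (d%:R - m) by rewrite mulr_ge0 ?subr_ge0.
  lra.
pose s := Num.sqrt t; have t0 : 0 < t by rewrite (lt_le_trans _ t1).
have s0 : 0 < s by rewrite sqrtr_gt0.
have s1 : 1 <= s by rewrite -[leLHS]sqrtr1 ler_wsqrtr.
have s2 : s ^+ 2 = t by rewrite sqr_sqrtr// ltW.
have mprod : measurable_fun setT (fun x : 'rV[R]_d => \prod_(i < d) tilt s (x ord0 i)).
  apply: measurable_prod => i _.
  exact: measurableT_comp (measurable_tilt s0) (measurable_coord i).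
have prod0 (x : 'rV[R]_d) : 0 <= \prod_(i < d) tilt s (x ord0 i).
  by apply: prodr_ge0 => i _; rewrite ltW// tilt_gt0.
have [gs gsE] := ex_density mprod prod0 (integral_prod_tilt d s0).
have gm2 := isotropic_gaussian_m2 s0 gsE.
have [igl glE] := isotropic_gaussian_entropy s0 gsE s1.
have p01 : 0 <= 1 - e <= 1 by rewrite subr_ge0 e1 gerBl ltW.
have [rho rhoE] := ex_density_mixture p01 muF gsE.
have etd : e * (d%:R * t) = d%:R - (1 - e) * m.
  by rewrite mulrA /t mulrC divfK// gt_eqF.
have rm2 : m2 rho = d%:R%:E.
  have [_ rE] := integral_mixture muF gsE rhoE (@measurable_sqnorm R d)
    (integrable_sqnorm mE) (integrable_sqnorm gm2).
  rewrite [LHS]rE [X in (_ * X + _)%E]mE [X in (_ + _ * X)%E]gm2 -!EFinM -EFinD.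
  by congr EFin; rewrite s2 opprB subrKC etd subrKC.
have rm1 : m1 rho = 0.
  apply/rowP => i; rewrite !mxE /Rintegral.
  have [_ ->] := integral_mixture muF gsE rhoE (measurable_coord i)
    (integrable_coord i mE) (integrable_coord i gm2).
  rewrite (isotropic_gaussian_mean s0 gsE) mule0 adde0.
  have imu := integrable_fin_num measurableT (integrable_coord i mE).
  by rewrite fineM//; have /rowP/(_ i) := m10; rewrite !mxE /Rintegral => ->; rewrite mulr0.
exists rho; split.
  rewrite /fun_J asboolT; last by split => //; rewrite /finite_m2 rm2 ltry.
  apply: le_trans (entropy_mixture p01 muF gsE rhoE ilnF igl) _.
  rewrite hE opprB subrKC.
  apply: (@le_trans _ _ ((1 - e)%:E * h%:E + e%:E * (d%:R * s ^+ 2 / 2)%:E)%E).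
    by rewrite leeD2l// lee_wpmul2l// lee_fin ltW.
  rewrite -!EFinM -EFinD lee_fin s2 lerD2l; move: etd; lra.
move=> f M mf fM.
have imu := bounded_integrable mu mf fM; have igs := bounded_integrable gs mf fM.
have [_ rE] := integral_mixture muF gsE rhoE mf imu igs.
have fmu := integrable_fin_num measurableT imu; have fgs := integrable_fin_num measurableT igs.
have -> : \int[rho]_x f x = (1 - e) * \int[mu]_x f x + e * \int[gs]_x f x.
  by rewrite /Rintegral rE opprB subrKC fineD ?fin_numM// fineM// fineM.
have bound (nu : probability 'rV[R]_d R) : `|\int[nu]_x f x| <= M.
  have inu := bounded_integrable nu mf fM.
  apply: (le_trans (le_normr_Rintegral _ _)) => //.
  have -> : M = \int[nu]_x (cst M x).
    by rewrite Rintegral_cst//= [X in fine X]probability_setT mulr1.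
  apply: le_Rintegral => //; first exact: (integrable_abse inu).
  exact: finite_measure_integrable_cst.
(* The mixture differs from [mu] only by the mass [e], which gives a total variation estimate. *)
rewrite (_ : _ - _ = e * (\int[mu]_x f x - \int[gs]_x f x)); last by ring.
rewrite normrM (gtr0_norm e0) ler_wpM2l ?(ltW e0)//.
by rewrite (le_trans (ler_normB _ _))// lerD.
Qed.

(** If [g mu] exceeded [fun_I mu], a level [a] strictly between would stay below [g] on a
    neighborhood of [mu]; the recovery sequence enters it with values of [fun_J] below [a]. *)
Lemma lsc_le_fun_I (R : realType) d (g : weak_probability R d -> \bar R)
    (mu : weak_probability R d) : (0 < d)%N -> lower_semicontinuous g ->
  (forall nu, g nu <= fun_J nu)%E -> (g mu <= fun_I mu)%E.
Proof.
move=> d0 lscg gJ; have [Ioo|] := ltP (fun_I mu) +oo%E; last first.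
  by rewrite leye_eq => /eqP ->; rewrite leey.
have [F [h [m [muF ilnF hE mE [md m10 IE]]]]] := fun_I_finite Ioo.
rewrite IE leNgt; apply/negP => Ig.
set I := h + _ in IE Ig.
have [a Ia ag] : exists2 a, I < a & (a%:E < g mu)%E.
  move: Ig; case: (g mu) => [b| |]//.
    by rewrite lte_fin => Ib; exists ((I + b) / 2); rewrite ?lte_fin; lra.
  by move=> _; exists (I + 1); rewrite ?ltry//; lra.
have [W Wmu Wg] := lscg mu a ag.
pose e (n : nat) : R := harmonic n.
have e01 n : 0 < e n <= 1.
  by rewrite /e /harmonic invr_gt0 ltr0n/= invf_le1 ?ltr0n// ler1n.
have /choice[u uP] : forall n, exists rho : weak_probability R d,
    (fun_J rho <= ((1 - e n) * h + (d%:R - (1 - e n) * m) / 2)%:E)%E /\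
    forall (f : 'rV[R]_d -> R) (M : R), measurable_fun setT f -> (forall x, `|f x| <= M) ->
      `|\int[mu]_x f x - \int[rho]_x f x| <= e n * (M + M).
  by move=> n; exact: (mixture_recovery d0 muF ilnF hE mE md m10 (e01 n)).
have ecvg : e n @[n --> \oo] --> (0 : R) by exact: cvg_harmonic.
have ucvg : u @ \oo --> mu.
  apply/weak_probability_cvg => -[f [cf [M fM]]] /=.
  have mf := measurable_continuous_row cf.
  have eM : e n * (M + M) @[n --> \oo] --> (0 : R).
    by rewrite -(mul0r (M + M)); apply: cvgMl.
  apply/cvgrPdist_lt => r r0.
  have : \forall n \near \oo, e n * (M + M) < r by apply: (cvgr_lt _ eM).
  apply: filterS => n; apply: le_lt_trans.
  by have [_] := uP n; apply.
have ca : (1 - e n) * h + (d%:R - (1 - e n) * m) / 2 @[n --> \oo] --> I.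
  (* The entropy bound of the mixture is affine in [e n], with value [I] at 0. *)
  rewrite (_ : (fun _ => _) = (fun n => I + e n * (m / 2 - h))).
    rewrite -[X in _ --> X]addr0; apply: cvgD; first exact: cvg_cst.
    by rewrite -(mul0r (m / 2 - h)); apply: cvgMl.
  by apply/funext => n; rewrite /I; field.
have ea : \forall n \near \oo, (1 - e n) * h + (d%:R - (1 - e n) * m) / 2 < a.
  by apply: (cvgr_lt _ ca).
have uW : \forall n \near \oo, W (u n) := ucvg W Wmu.
have [n _ /(_ n (leqnn n))[/= Wn an]] := filterI uW ea.
have := Wg _ Wn; rewrite ltNge => /negP; apply.
apply: (le_trans (gJ _)); apply: (le_trans (uP n).1).
by rewrite lee_fin ltW.
Qed.

Lemma fun_I_le_fun_J (R : realType) d (mu : weak_probability R d) :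
  (fun_I mu <= fun_J mu)%E.
Proof.
rewrite /fun_J; case: asboolP => [[f2 m10 m2d]|_]; last by rewrite leey.
by rewrite /fun_I asboolT ?m2d// subee// mule0 adde0.
Qed.

Theorem proposition5p1 (R : realType) (d : nat) (hd : (0 < d)%N) :
  (forall mu : probability 'rV[R]_d R,
     (alpha d (W2sq (std_gaussian R d) mu) <= fun_I mu)%E) /\
  (forall mu : weak_probability R d, fun_I mu = lsc_envelope fun_J mu).
Proof.
split=> [mu|mu]; first exact: alpha_W2sq_le_fun_I.
apply/eqP; rewrite eq_le; apply/andP; split.
(* [fun_I] is itself one of the functions over which the supremum is taken. *)
- apply: ereal_sup_ubound; exists fun_I => //; split => [|nu].
    exact: lower_semicontinuous_fun_I.
  exact: fun_I_le_fun_J.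
- by apply: ge_ereal_sup => _ [g [lscg gJ] <-]; exact: lsc_le_fun_I.
Qed.
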